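(* Let $(B,g_B,J_1)$ be an almost product nondegenerate semi-Riemannian manifold, let $(F,g_F,J_2)$ be an almost product semi-regular semi-Riemannian manifold, and let $f\in C^\infty(B)$. Then the warped product manifold $(B\times_fF,J)$, with $J=(J_1,J_2)$, is an almost product semi-regular semi-Riemannian manifold.
   Context: A singular semi-Riemannian manifold $(M,g)$ is a smooth manifold with a smooth symmetric $(0,2)$-tensor field $g=\langle\cdot,\cdot\rangle$, possibly degenerate and of varying signature. It is an almost product singular semi-Riemannian manifold if it carries $J:TM\to TM$ with $J^2=\mathrm{id}$ and $g(JX,JY)=g(X,Y)$ for all $X,Y$. The Koszul form is $\mathcal K(X,Y,Z)=\tfrac12\{X\langle Y,Z\rangle+Y\langle Z,X\rangle-Z\langle X,Y\rangle-\langle X,[Y,Z]\rangle+\langle Y,[Z,X]\rangle+\langle Z,[X,Y]\rangle\}$; the almost product Koszul form is $\widetilde{\mathcal K}(X,Y,Z)=\tfrac12[\mathcal K(X,Y,Z)+\mathcal K(X,JY,JZ)]$, and $\widetilde\nabla^\flat_XY:=\widetilde{\mathcal K}(X,Y,\cdot)$. $\mathcal A^\bullet(M)$ is the set of smooth 1-forms $\omega$ such that for each $p$ there is $u\in T_pM$ with $\omega_p=\langle u,\cdot\rangle$. For covectors $\omega_p=\langle u,\cdot\rangle$, $\tau_p=\langle v,\cdot\rangle$ put $\langle\langle\omega,\tau\rangle\rangle_\bullet=\langle u,v\rangle$. $(M,g)$ is radical-stationary if $\mathcal K(X,Y,\cdot)\in\mathcal A^\bullet(M)$ for all $X,Y$.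 For a radical-stationary almost product manifold and $\omega\in\mathcal A^\bullet(M)$, $(\widetilde\nabla_X\omega)(Y)=X(\omega(Y))-\langle\langle\widetilde\nabla^\flat_XY,\omega\rangle\rangle_\bullet$, smooth on the regions of constant signature (an open dense set); elsewhere values are understood by smooth extension when it exists. An almost product singular semi-Riemannian manifold $(M,g,J)$ is almost product semi-regular if $\widetilde\nabla^\flat_XY\in\mathcal A^\bullet(M)$ and $\widetilde\nabla_Z(\widetilde\nabla^\flat_XY)\in\mathcal A^\bullet(M)$ for all $X,Y,Z\in\Gamma(TM)$; the manifold is taken to be radical-stationary so that $\widetilde\nabla$ is defined. For $f\in C^\infty(B)$ (possibly with zeros), $B\times_fF$ is $B\times F$ with the metric $\pi_B^*(g_B)+(f\circ\pi_B)^2\pi_F^*(g_F)$ and the almost product structure $J=(J_1,J_2)$ acting as $J_1$ on $TB$ and $J_2$ on $TF$. *)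

(* Defs.v *)
From HB Require Import structures.
From mathcomp Require Import all_boot all_order all_algebra.
From mathcomp Require Import all_classical all_reals all_analysis.
Set Implicit Arguments.
Unset Strict Implicit.
Unset Printing Implicit Defensive.
Import Order.TTheory GRing.Theory Num.Theory.
Import numFieldNormedType.Exports.
Local Open Scope classical_set_scope.
Local Open Scope ring_scope.

Fixpoint Ck_on (R : realType) (V W : normedModType R) (k : nat)
    (U : set V) (f : V -> W) : Prop :=
  match k with
  | 0 => forall y, U y -> {for y, continuous f}
  | k'.+1 => (forall y, U y -> differentiable f y) /\
             forall v, Ck_on k' U (fun y => 'd f y v)
  end.

(* Used on open U only, so that values of f outside U are irrelevant. *)
Definition smooth_on (R : realType) (V W : normedModType R)
  (U : set V) (f : V -> W) : Prop := forall k, Ck_on k U f.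

(* Only the values of cmap on cdom, and those of cinv on cmap @` cdom, are
   meaningful. *)
Record chart (R : realType) (n : nat) (M : Type) := Chart {
  cdom : set M;
  cmap : M -> 'rV[R]_n;
  cinv : 'rV[R]_n -> M }.

Definition chart_image (R : realType) (n : nat) (M : Type) (c : chart R n M) :
  set 'rV[R]_n := cmap c @` cdom c.

Definition is_chart (R : realType) (n : nat) (M : topologicalType)
    (c : chart R n M) : Prop :=
  [/\ open (cdom c), open (chart_image c),
      (forall x, cdom c x -> cinv c (cmap c x) = x),
      (forall x, cdom c x -> {for x, continuous (cmap c)}) &
      (forall y, chart_image c y -> {for y, continuous (cinv c)})].

(* An atlas is indexed by the points: chart_at p is a chart around p.  This
   selects at each p a basis of T_p M, so that T_p M is 'rV[R]_(mdim M). *)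
Record charted_space (R : realType) := ChartedSpace {
  mdim : nat;
  carrier :> topologicalType;
  chart_at : carrier -> chart R mdim carrier }.

Definition smooth_manifold (R : realType) (M : charted_space R) : Prop :=
  [/\ hausdorff_space M, @second_countable M,
      (forall p : M, is_chart (chart_at p) /\ cdom (chart_at p) p) &
      (forall p q : M,
        smooth_on (cmap (chart_at p) @` (cdom (chart_at p) `&` cdom (chart_at q)))
                  (cmap (chart_at q) \o cinv (chart_at p)))].

Notation tangent M := 'rV_(mdim M).

Definition smooth_fun (R : realType) (M : charted_space R) (h : M -> R) : Prop :=
  forall p : M, smooth_on (chart_image (chart_at p))
    (h \o cinv (chart_at p) : 'rV[R]_(mdim M) -> R^o).

(* Coordinates in chart_at p of a tangent vector v at q, and the tangent vector
   at q with coordinates v in chart_at p, for q in the domain of chart_at p. *)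
Definition tcoord (R : realType) (M : charted_space R) (p q : M)
    (v : tangent M) : tangent M :=
  'd (cmap (chart_at p) \o cinv (chart_at q)) (cmap (chart_at q) q) v.

Definition tvec (R : realType) (M : charted_space R) (p q : M)
    (v : tangent M) : tangent M :=
  'd (cmap (chart_at q) \o cinv (chart_at p)) (cmap (chart_at p) q) v.

Definition vfield (R : realType) (M : charted_space R) : Type :=
  M -> 'rV[R]_(mdim M).

Definition vfield_in_chart (R : realType) (M : charted_space R) (X : vfield M)
    (p : M) (y : 'rV[R]_(mdim M)) : 'rV[R]_(mdim M) :=
  let q := cinv (chart_at p) y in tcoord p q (X q).

Definition smooth_vfield (R : realType) (M : charted_space R) (X : vfield M) :
  Prop :=
  forall p : M, smooth_on (chart_image (chart_at p)) (vfield_in_chart X p).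

Definition vderive (R : realType) (M : charted_space R) (X : vfield M)
    (h : M -> R) : M -> R := fun p =>
  'd (h \o cinv (chart_at p) : 'rV[R]_(mdim M) -> R^o) (cmap (chart_at p) p)
    (X p).

(* [X, Y] = dY(X) - dX(Y) in chart_at p, where the frame of chart_at p at p
   itself is the chosen basis of T_p M. *)
Definition lie_bracket (R : realType) (M : charted_space R) (X Y : vfield M) :
  vfield M := fun p =>
  'd (vfield_in_chart Y p) (cmap (chart_at p) p) (X p)
  - 'd (vfield_in_chart X p) (cmap (chart_at p) p) (Y p).

Definition tensor02 (R : realType) (M : charted_space R) : Type :=
  M -> 'rV[R]_(mdim M) -> 'rV[R]_(mdim M) -> R.

Definition tensor11 (R : realType) (M : charted_space R) : Type :=
  M -> 'rV[R]_(mdim M) -> 'rV[R]_(mdim M).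

Definition tapply (R : realType) (M : charted_space R) (J : tensor11 M)
  (X : vfield M) : vfield M := fun p => J p (X p).

Definition inner (R : realType) (M : charted_space R) (g : tensor02 M)
  (X Y : vfield M) : M -> R := fun p => g p (X p) (Y p).

Definition singular_metric (R : realType) (M : charted_space R)
    (g : tensor02 M) : Prop :=
  [/\ (forall p u v, g p u v = g p v u),
      (forall p u, linear (g p u : 'rV[R]_(mdim M) -> R^o)) &
      (forall (p : M) (u v : tangent M), smooth_on (chart_image (chart_at p))
        (fun y => let q := cinv (chart_at p) y in
                  g q (tvec p q u) (tvec p q v) : R^o))].

Definition nondegenerate_metric (R : realType) (M : charted_space R)
    (g : tensor02 M) : Prop :=
  forall p u, (forall v, g p u v = 0) -> u = 0.

Definition almost_product_structure (R : realType) (M : charted_space R)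
    (g : tensor02 M) (J : tensor11 M) : Prop :=
  [/\ (forall p, linear (J p)),
      (forall (p : M) (v : tangent M), smooth_on (chart_image (chart_at p))
        (fun y => let q := cinv (chart_at p) y in
                  tcoord p q (J q (tvec p q v)))),
      (forall p v, J p (J p v) = v) &
      (forall p u v, g p (J p u) (J p v) = g p u v)].

Definition almost_product_singular_manifold (R : realType)
    (M : charted_space R) (g : tensor02 M) (J : tensor11 M) : Prop :=
  [/\ smooth_manifold M, singular_metric g & almost_product_structure g J].

Definition koszul (R : realType) (M : charted_space R) (g : tensor02 M)
    (X Y Z : vfield M) : M -> R := fun p =>
  2^-1 * (vderive X (inner g Y Z) p + vderive Y (inner g Z X) p
          - vderive Z (inner g X Y) p
          - inner g X (lie_bracket Y Z) p + inner g Y (lie_bracket Z X) p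
          + inner g Z (lie_bracket X Y) p).

Definition ap_koszul (R : realType) (M : charted_space R) (g : tensor02 M)
    (J : tensor11 M) (X Y Z : vfield M) : M -> R := fun p =>
  2^-1 * (koszul g X Y Z p + koszul g X (tapply J Y) (tapply J Z) p).

(* 1-forms as C^oo(M)-linear maps from smooth vector fields to C^oo(M). *)
Definition one_form (R : realType) (M : charted_space R) : Type :=
  vfield M -> M -> R.

Definition smooth_form (R : realType) (M : charted_space R) (w : one_form M) :
  Prop :=
  (forall Y, smooth_vfield Y -> smooth_fun (w Y)) /\
  (forall (h : M -> R) (Y Z : vfield M), smooth_fun h -> smooth_vfield Y ->
    smooth_vfield Z -> forall p,
    w (fun q => h q *: Y q + Z q) p = h p * w Y p + w Z p).

(* w_p = <u, .> *)
Definition represents (R : realType) (M : charted_space R) (g : tensor02 M)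
    (p : M) (u : tangent M) (w : one_form M) : Prop :=
  forall Y, smooth_vfield Y -> w Y p = g p u (Y p).

(* The set A^bullet(M) of smooth radical-annihilator 1-forms. *)
Definition A_bullet (R : realType) (M : charted_space R) (g : tensor02 M)
    (w : one_form M) : Prop :=
  smooth_form w /\ forall p, exists u, represents g p u w.

(* <<w, t>>_bullet at p; the value does not depend on the representatives u, v,
   and is 0 by convention if w_p or t_p has none. *)
Definition copairing (R : realType) (M : charted_space R) (g : tensor02 M)
    (w t : one_form M) : M -> R := fun p =>
  xget 0 [set r : R | exists u v,
    [/\ represents g p u w, represents g p v t & r = g p u v]].

Definition radical_stationary (R : realType) (M : charted_space R)
    (g : tensor02 M) : Prop :=
  forall X Y, smooth_vfield X -> smooth_vfield Y -> A_bullet g (koszul g X Y).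

Definition nabla_flat (R : realType) (M : charted_space R) (g : tensor02 M)
  (J : tensor11 M) (X Y : vfield M) : one_form M := ap_koszul g J X Y.

Definition nabla_form (R : realType) (M : charted_space R) (g : tensor02 M)
    (J : tensor11 M) (X : vfield M) (w : one_form M) : one_form M := fun Y p =>
  vderive X (w Y) p - copairing g (nabla_flat g J X Y) w p.

Definition pos_index (R : realType) (n : nat)
    (b : 'rV[R]_n -> 'rV[R]_n -> R) : nat :=
  \max_(k < n.+1 | `[< exists V : 'M[R]_n, \rank V = k /\
     forall v : 'rV[R]_n, (v <= V)%MS -> v != 0 -> 0 < b v v >]) k.

Definition form_signature (R : realType) (n : nat)
    (b : 'rV[R]_n -> 'rV[R]_n -> R) : nat * nat :=
  (pos_index b, pos_index (fun u v => - b u v)).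

Definition constant_signature_region (R : realType) (M : charted_space R)
    (g : tensor02 M) : set M :=
  [set p | \forall q \near p, form_signature (g q) = form_signature (g p)].

(* nabla_X w, given by nabla_form where the signature is locally constant and
   by smooth extension elsewhere, exists and lies in A^bullet(M); the extension
   e is unique as the constant signature region is dense. *)
Definition nabla_form_in_A_bullet (R : realType) (M : charted_space R)
    (g : tensor02 M) (J : tensor11 M) (X : vfield M) (w : one_form M) : Prop :=
  exists2 e : one_form M, A_bullet g e &
    forall Y, smooth_vfield Y -> forall p, constant_signature_region g p ->
      e Y p = nabla_form g J X w Y p.

Definition almost_product_semi_regular (R : realType) (M : charted_space R)
    (g : tensor02 M) (J : tensor11 M) : Prop :=
  [/\ almost_product_singular_manifold g J,
      radical_stationary g,
      (forall X Y, smooth_vfield X -> smooth_vfield Y ->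
        A_bullet g (nabla_flat g J X Y)) &
      (forall X Y Z, smooth_vfield X -> smooth_vfield Y -> smooth_vfield Z ->
        nabla_form_in_A_bullet g J Z (nabla_flat g J X Y))].

Definition prod_chart (R : realType) (m n : nat) (M N : Type)
    (c : chart R m M) (d : chart R n N) : chart R (m + n) (M * N)%type :=
  Chart (cdom c `*` cdom d)
        (fun x => row_mx (cmap c x.1) (cmap d x.2))
        (fun y => (cinv c (lsubmx y), cinv d (rsubmx y))).

(* lsubmx and rsubmx identify T_(p, q) (B x F) with T_p B x T_q F: they are the
   differentials of the two projections. *)
Definition prod_space (R : realType) (B F : charted_space R) :
  charted_space R :=
  @ChartedSpace R (mdim B + mdim F)%N (B * F)%type
    (fun x => prod_chart (chart_at x.1) (chart_at x.2)).

Definition warped_metric (R : realType) (B F : charted_space R)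
    (gB : tensor02 B) (gF : tensor02 F) (f : B -> R) :
  tensor02 (prod_space B F) :=
  fun (x : B * F) (u v : 'rV[R]_(mdim B + mdim F)) =>
    gB x.1 (lsubmx u) (lsubmx v) + f x.1 ^+ 2 * gF x.2 (rsubmx u) (rsubmx v).

Definition prod_structure (R : realType) (B F : charted_space R)
    (J1 : tensor11 B) (J2 : tensor11 F) : tensor11 (prod_space B F) :=
  fun (x : B * F) (u : 'rV[R]_(mdim B + mdim F)) =>
    row_mx (J1 x.1 (lsubmx u)) (J2 x.2 (rsubmx u)).

(* Main.v *)
(* In a chart K (X, Y, Z) = Gamma (X, Y, Z) + <dY X, Z> with a trilinear Gamma, and
   the almost product Koszul form is Gt (X, Y, Z) + <dY X, Z>.  Hence being
   radical-stationary means that the forms Gamma_p (u, v, .) are represented by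
   vectors, and, with L = Gt (X, Y, .) + <dY X, .>,
     (nabla_Z nabla_X^flat Y)(W) = (d_Z L)(W) - <<Gt (Z, W, .), L>>,
   where the derivatives of W have cancelled.  For the warped product
     Gt = Gt_B + f^2 Gt_F + f (terms in df and g_F);
   the fibre part of L is f^2 Gt_F (X, Y, .) + f g_F (m, .) for a smooth vector m, and
   similarly for Gt (Z, W, .), so the factor f^2 of the metric makes the pairing
     f^2 <<Gt_F, Gt_F>> + f Gt_F (Z, W, m) + f Gt_F (X, Y, m') + g_F (m, m')
   plus a base term given by the inverse of g_B.  Semi-regularity of F extends
   <<Gt_F, Gt_F>> smoothly, and this formula then extends the pairing on B x F
   through the zeros of f; the fibre part of the extended derivative is again
   f times a form represented by g_F, hence represented by f^2 g_F, also where f = 0.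
   The local extensions agree because the constant signature region is dense.  At a
   point of this region where f <> 0 the fibre has constant signature, and where
   f = 0 either g_F = 0 or f vanishes nearby. *)

From HB Require Import structures.
Require Import Defs.
From mathcomp Require Import all_boot all_order all_algebra.
From mathcomp Require Import all_classical all_reals all_analysis.
From mathcomp Require Import ring lra zify.
Set Implicit Arguments.
Unset Strict Implicit.
Unset Printing Implicit Defensive.
Import Order.TTheory GRing.Theory Num.Theory.
Import numFieldNormedType.Exports.
Local Open Scope classical_set_scope.
Local Open Scope ring_scope.

(** * Smooth maps between normed modules *)

Section Calculus.
Context {R : realType}.

Section Generic.
Context {V W : normedModType R}.
Implicit Types (f g : V -> W) (U : set V).

(** The hypothesis on the fibre speaks of global vector fields on F, whereas the fibre components of
    a field on B x F also depend on the base point, so it cannot be applied to them directly. It is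
    therefore turned into pointwise statements in a fibre chart: smooth coefficients indexed by
    basis vectors, and representability of the derivative of the fibre Koszul form minus these
    coefficients. Such statements pull back to the product and can be contracted with arbitrary
    fields. Coordinate fields are made global by bump functions, hence the flat functions; the
    bracket is moved to an arbitrary chart by symmetry of second derivatives. Divisibility of the
    extended derivative by f on the fibre does not hold term by term. The terms without the factor
    are df(Z) g_F (m, .), once from differentiating f g_F (m, .) and once from the pairing, and they
    cancel. Moreover the derivative of g_F (m, W) along Z and the pairing term Gt_F (Z, W, m) are
    not separately known to be represented as forms in W; metric compatibility combines them into
    Gt_F (Z, m, W), which is. *)

Lemma near_zero_is_diff (k : V -> W) (x : V) :
  (\forall z \near x, k z = 0) -> is_diff x k (0 : V -> W).
Proof.
move=> k0.
have c0 : continuous (\0 : V -> W) by exact: cst_continuous.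
have e0 : k \o shift x = cst (k x) + (\0 : V -> W) +o_ 0 id.
  apply/eqaddoP => _/posnumP[e].
  rewrite (nbhs_singleton k0).
  move: k0; rewrite (near_shift 0) subr0.
  apply: filterS => h /= kh; change (`|k (h + x) - (0 + 0)| <= e%:num * `|h|).
  by rewrite kh addr0 subr0 normr0 mulr_ge0.
have dk : 'd k x = \0 :> (V -> W) by apply: diff_unique.
by apply: DiffDef => //; apply/diff_locallyP; rewrite dk.
Qed.

Lemma near_eq_is_diff f g (x : V) : differentiable f x ->
  (\forall z \near x, f z = g z) -> is_diff x g ('d f x).
Proof.
move=> df fg; have h : is_diff x (g - f) (0 : V -> W).
  by apply: near_zero_is_diff; apply: filterS fg => z /= fgz; rewrite !fctE fgz subrr.
have dfx : is_diff x f ('d f x) by exact: DiffDef.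
have -> : g = (g - f) + f by rewrite subrK.
by apply: is_diff_eq (is_diffD h dfx) _; rewrite add0r.
Qed.

Lemma open_eq_is_diff U f g (x : V) : open U -> (forall y, U y -> f y = g y) ->
  U x -> differentiable f x -> is_diff x g ('d f x).
Proof.
move=> oU fg Ux df; apply: near_eq_is_diff => //.
by near=> z; apply: fg; near: z; exact: open_nbhs_nbhs.
Unshelve. all: by end_near. Qed.

Lemma open_eq_diff U f g (x : V) : open U -> (forall y, U y -> f y = g y) ->
  U x -> differentiable f x -> 'd g x = 'd f x :> (V -> W).
Proof. by move=> oU fg Ux df; have [] := open_eq_is_diff oU fg Ux df. Qed.

(** Derivatives at a point of [U] see the values on a neighbourhood, so openness of [U] is what
    makes agreement on [U] enough. *)
Lemma Ck_on_ext k : forall U f g, open U -> (forall y, U y -> f y = g y) ->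
  Ck_on k U f -> Ck_on k U g.
Proof.
elim: k => [|k IH] U f g oU fg /=.
  move=> cf y Uy; have := cf _ Uy; rewrite /prop_for /continuous_at -(fg _ Uy).
  apply: cvg_trans; apply: near_eq_cvg; near=> z; apply: fg; near: z.
  exact: open_nbhs_nbhs.
move=> [df Cf]; split=> [y Uy|v].
  by have [] := open_eq_is_diff oU fg Uy (df _ Uy).
apply: (IH _ _ _ oU _ (Cf v)) => y Uy.
by have -> := open_eq_diff oU fg Uy (df _ Uy).
Unshelve. all: by end_near. Qed.

Lemma smooth_on_ext U f g : open U -> (forall y, U y -> f y = g y) ->
  smooth_on U f -> smooth_on U g.
Proof. by move=> oU fg sf k; apply: Ck_on_ext (sf k). Qed.

(** [Ck_on] imposes conditions point by point on a function defined on the whole space, so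
    smoothness can be checked on arbitrary local pieces [N]. *)
Lemma Ck_on_cover k : forall U f,
  (forall x, U x -> exists2 N : set V, N x & Ck_on k N f) -> Ck_on k U f.
Proof.
elim: k => [|k IH] U f h /=; first by move=> y /h[N Ny]; apply.
split=> [y /h[N Ny [+ _]]|v]; first exact.
by apply: IH => x /h[N Nx [_ /(_ v)]]; exists N.
Qed.

Lemma Ck_on_sub k U U' f : U' `<=` U -> Ck_on k U f -> Ck_on k U' f.
Proof. by move=> UU' Cf; apply: Ck_on_cover => x /UU'; exists U. Qed.

Lemma smooth_on_sub U U' f : U' `<=` U -> smooth_on U f -> smooth_on U' f.
Proof. by move=> UU' sf k; apply: Ck_on_sub (sf k). Qed.

Lemma smooth_on_cover U f :
  (forall x, U x -> exists2 N : set V, N x & smooth_on N f) -> smooth_on U f.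
Proof. by move=> h k; apply: Ck_on_cover => x /h[N Nx /(_ k)]; exists N. Qed.

Lemma Ck_on_pred k : forall U f, Ck_on k.+1 U f -> Ck_on k U f.
Proof.
elim: k => [|k IH] U f [df Cf].
  by move=> y /df; exact: differentiable_continuous.
by split=> // v; apply: IH.
Qed.

Lemma smooth_on_differentiable U f y : smooth_on U f -> U y -> differentiable f y.
Proof. by move=> /(_ 1%N)[h _] /h. Qed.

Lemma smooth_on_continuous U f y : smooth_on U f -> U y -> {for y, continuous f}.
Proof. by move=> /(_ 0%N) h /h. Qed.

Lemma smooth_on_diff U f v : smooth_on U f -> smooth_on U (fun y => 'd f y v).
Proof. by move=> sf k; have [_ h] := sf k.+1; exact: h. Qed.

Lemma Ck_on_cst k : forall U (w : W), Ck_on k U (fun=> w).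
Proof.
elim: k => [|k IH] U w /=; first by move=> y _; exact: cst_continuous.
split=> [y _|v]; first exact: differentiable_cst.
have -> : (fun y => 'd (cst w) y v) = (fun=> 0 : W).
  by apply/funext => y; rewrite diff_cst.
exact: IH.
Qed.

Lemma smooth_on_cst U (w : W) : smooth_on U (fun=> w).
Proof. by move=> k; exact: Ck_on_cst. Qed.

Lemma smooth_on_linear U (f : {linear V -> W}) : continuous f -> smooth_on U f.
Proof.
move=> cf [|k] /=; first by move=> y _; exact: cf.
split=> [y _|v]; first exact: linear_differentiable.
have -> : (fun y => 'd f y v) = (fun=> f v).
  by apply/funext => y; rewrite diff_lin.
exact: Ck_on_cst.
Qed.

Lemma Ck_on_add k : forall U f g, open U -> Ck_on k U f -> Ck_on k U g ->
  Ck_on k U (fun y => f y + g y).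
Proof.
elim: k => [|k IH] U f g oU /=.
  by move=> cf cg y Uy; apply: continuousD; [exact: cf|exact: cg].
move=> [df Cf] [dg Cg]; split=> [y Uy|v].
  by apply: differentiableD; [exact: df|exact: dg].
apply: Ck_on_ext (IH _ _ _ oU (Cf v) (Cg v)) => // y Uy.
by rewrite (_ : (fun y => f y + g y) = f + g)// diffD//; [exact: df|exact: dg].
Qed.

Lemma smooth_on_add U f g : open U -> smooth_on U f -> smooth_on U g ->
  smooth_on U (fun y => f y + g y).
Proof. by move=> oU sf sg k; apply: Ck_on_add. Qed.

Lemma Ck_on_scale k a : forall U f, open U -> Ck_on k U f ->
  Ck_on k U (fun y => a *: f y).
Proof.
elim: k => [|k IH] U f oU /=.
  by move=> cf y Uy; apply: continuousZr; exact: cf.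
move=> [df Cf]; split=> [y Uy|v].
  by apply: differentiableZ; exact: df.
apply: Ck_on_ext (IH _ _ oU (Cf v)) => // y Uy.
by rewrite (_ : (fun y => a *: f y) = a *: f)// diffZ//; exact: df.
Qed.

Lemma smooth_on_scale U a f : open U -> smooth_on U f ->
  smooth_on U (fun y => a *: f y).
Proof. by move=> oU sf k; apply: Ck_on_scale. Qed.

Lemma smooth_on_sum U (I : Type) (r : seq I) (P : pred I) (F : I -> V -> W) :
  open U -> (forall i, P i -> smooth_on U (F i)) ->
  smooth_on U (fun y => \sum_(i <- r | P i) F i y).
Proof.
move=> oU sF; elim: r => [|i r IH].
  by under eq_fun do rewrite big_nil; exact: smooth_on_cst.
under eq_fun do rewrite big_cons.
by case: (boolP (P i)) => Pi //; apply: smooth_on_add => //; exact: sF.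
Qed.

End Generic.

Section Scalar.
Context {V : normedModType R}.
Implicit Types (f g : V -> R^o) (U : set V).

Lemma diffM_ext f g y v : differentiable f y -> differentiable g y ->
  'd (fun z => f z * g z : R^o) y v = f y * 'd g y v + 'd f y v * g y.
Proof.
move=> df dg; 
have -> := diffM df dg.
change (f y * 'd g y v + g y * 'd f y v = f y * 'd g y v + 'd f y v * g y).
by rewrite [g y * _]mulrC.
Qed.

(** The product rule leaves one factor undifferentiated, so the induction also uses that order k + 1
    implies order k. *)
Lemma Ck_on_mul k : forall U f g, open U -> Ck_on k U f -> Ck_on k U g ->
  Ck_on k U (fun y => f y * g y : R^o).
Proof.
elim: k => [|k IH] U f g oU.
  by move=> cf cg y Uy; apply: continuousM; [exact: cf|exact: cg].
move=> Hf Hg; have [df Cf] := Hf; have [dg Cg] := Hg; split=> [y Uy|v].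
  by apply: differentiableM; [exact: df|exact: dg].
apply: Ck_on_ext (Ck_on_add oU (IH _ _ _ oU (Ck_on_pred Hf) (Cg v))
   (IH _ _ _ oU (Cf v) (Ck_on_pred Hg))) => // y Uy.
by rewrite diffM_ext//; [exact: df|exact: dg].
Qed.

Lemma smooth_on_mul U f g : open U -> smooth_on U f -> smooth_on U g ->
  smooth_on U (fun y => f y * g y : R^o).
Proof. by move=> oU sf sg k; apply: Ck_on_mul. Qed.

Lemma smooth_on_prod U (I : Type) (r : seq I) (P : pred I) (F : I -> V -> R^o) :
  open U -> (forall i, P i -> smooth_on U (F i)) ->
  smooth_on U (fun y => \prod_(i <- r | P i) F i y : R^o).
Proof.
move=> oU sF; elim: r => [|i r IH].
  by under eq_fun do rewrite big_nil; exact: smooth_on_cst.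
under eq_fun do rewrite big_cons.
by case: (boolP (P i)) => Pi //; apply: smooth_on_mul => //; exact: sF.
Qed.

Lemma diffV_ext f y v : differentiable f y -> f y != 0 ->
  'd (fun z => (f z)^-1 : R^o) y v = - ((f y)^-1 * (f y)^-1 * 'd f y v).
Proof.
move=> df f0; have -> := diffV df f0.
change (- (f y) ^- 2 * 'd f y v = - ((f y)^-1 * (f y)^-1 * 'd f y v)).
by rewrite mulNr expr2 invfM.
Qed.

(** The derivative of 1/f is a product of df with two copies of 1/f, so the induction hypothesis for
    1/f itself closes the step. *)
Lemma Ck_on_inv k : forall U f, open U -> (forall y, U y -> f y != 0) ->
  Ck_on k U f -> Ck_on k U (fun y => (f y)^-1 : R^o).
Proof.
elim: k => [|k IH] U f oU f0.
  by move=> cf y Uy; apply: cvgV; [exact: f0|exact: cf].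
move=> Hf; have [df Cf] := Hf; split=> [y Uy|v].
  by apply: differentiableV; [exact: df|exact: f0].
have h := IH _ _ oU f0 (Ck_on_pred Hf).
apply: Ck_on_ext (Ck_on_scale (-1) oU (Ck_on_mul oU (Ck_on_mul oU h h) (Cf v))) => // y Uy.
by rewrite diffV_ext ?f0//; [rewrite scaleN1r|exact: df].
Qed.

Lemma smooth_on_inv U f : open U -> (forall y, U y -> f y != 0) ->
  smooth_on U f -> smooth_on U (fun y => (f y)^-1 : R^o).
Proof. by move=> oU f0 sf k; apply: Ck_on_inv. Qed.

End Scalar.
End Calculus.

Section ScaleDiff.
Context {R : realType} {V W : normedModType R}.
Implicit Types (U : set V) (k : V -> R^o) (f : V -> W).

Lemma scale_is_diff k f y : differentiable k y -> differentiable f y ->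
  is_diff y (fun z => k z *: f z) (fun v => k y *: 'd f y v + 'd k y v *: f y).
Proof.
move=> dk df.
(* Presenting [a *: w] as a continuous bilinear map makes the Leibniz rule an instance of the
   differential of a bilinear map composed with a pair. *)
have scale_bilin : bilinear_for
    (GRing.Scale.Law.clone _ _ *:%R _) (GRing.Scale.Law.clone _ _ *:%R _)
    (fun (a : R^o) (w : W) => a *: w).
  split=> [u'|u] a x z /=; first by rewrite scalerDl scalerA.
  by rewrite scalerDr !scalerA mulrC.
pose scB := bilinear_isBilinear.Build R R^o W W _ _ _ scale_bilin.
pose sc : {bilinear R^o -> W -> W} := HB.pack (fun (a : R^o) (w : W) => a *: w) scB.
have csc : continuous (fun p : R^o * W => sc p.1 p.2) by exact: scale_continuous.
have dsc p : is_diff p (fun q : R^o * W => sc q.1 q.2)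
    (fun q => sc p.1 q.2 + sc q.1 p.2).
  by apply: DiffDef; [exact: differentiable_bilin|exact: diff_bilin].
have dkf := is_diff_pair (differentiableP dk) (differentiableP df).
exact: (is_diff_comp dkf (dsc _)).
Qed.

Lemma Ck_on_scalev n : forall U k f, open U -> Ck_on n U k -> Ck_on n U f ->
  Ck_on n U (fun y => k y *: f y).
Proof.
elim: n => [|n IH] U k f oU.
  move=> ck cf y Uy; apply: (@continuousZ _ _ _ k f); [exact: ck|exact: cf].
move=> Hk Hf; have [dk Ck] := Hk; have [df Cf] := Hf; split=> [y Uy|v].
  by have [] := scale_is_diff (dk _ Uy) (df _ Uy).
apply: (Ck_on_ext oU _ (Ck_on_add oU (IH _ _ _ oU (Ck_on_pred Hk) (Cf v))
   (IH _ _ _ oU (Ck v) (Ck_on_pred Hf)))) => y Uy.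
by have [_ ->] := scale_is_diff (dk _ Uy) (df _ Uy).
Qed.

Lemma smooth_on_scalev U k f : open U -> smooth_on U k -> smooth_on U f ->
  smooth_on U (fun y => k y *: f y).
Proof. by move=> oU sk sf n; apply: Ck_on_scalev. Qed.

End ScaleDiff.

(** * Finite-dimensional sources: coordinates, composition and families of linear maps *)

Section RowVectors.
Context {R : realType}.

Lemma rV_sum n (v : 'rV[R]_n) : v = \sum_j v 0 j *: 'e_j.
Proof. by rewrite [LHS]row_sum_delta. Qed.

Lemma linear_sum_delta n (W : normedModType R) (f : 'rV[R]_n -> W) v :
  linear f -> f v = \sum_j v 0 j *: f 'e_j.
Proof.
move=> lf; pose fL : {linear _ -> _} := HB.pack f (GRing.isLinear.Build _ _ _ _ _ lf).
rewrite {1}(rV_sum v) -[f]/(fL : _ -> _) linear_sum; apply: eq_bigr => j _.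
by rewrite linearZ.
Qed.

Lemma linear_rV_continuous n (W : normedModType R) (f : 'rV[R]_n -> W) :
  linear f -> continuous f.
Proof.
move=> lf v; rewrite (_ : f = fun v => \sum_j v 0 j *: f 'e_j); last first.
  by apply/funext => w; exact: linear_sum_delta.
elim: (index_enum _) => [|j s IH].
  by under eq_fun do rewrite big_nil; exact: cst_continuous.
under eq_fun do rewrite big_cons.
apply: continuousD IH.
apply: (@continuousZ _ _ _ (fun v : 'rV[R]_n => v 0 j : R^o) (fun=> f 'e_j)).
  exact: coord_continuous.
exact: cst_continuous.
Qed.

Section LinearMaps.
Context {V W : normedModType R} (f : V -> W).
Hypotheses (lf : linear f) (cf : continuous f).

Lemma linear_is_diff x : is_diff x f f.
Proof.
pose fL : {linear _ -> _} := HB.pack f (GRing.isLinear.Build _ _ _ _ _ lf).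
have h : is_diff x fL fL.
  by apply: DiffDef; [exact: linear_differentiable|exact: diff_lin].
exact: h.
Qed.

Lemma linear_smooth_on U : smooth_on U f.
Proof.
pose fL : {linear _ -> _} := HB.pack f (GRing.isLinear.Build _ _ _ _ _ lf).
exact: (@smooth_on_linear _ _ _ U fL).
Qed.

Lemma is_diff_linear_comp (V' : normedModType R) (g : V' -> V) y :
  differentiable g y -> is_diff y (f \o g) (f \o 'd g y).
Proof.
move=> dg; exact: (is_diff_comp (differentiableP dg) (linear_is_diff (g y))).
Qed.

Lemma Ck_on_linear_comp k (V' : normedModType R) : forall (g : V' -> V) U, open U ->
  Ck_on k U g -> Ck_on k U (f \o g).
Proof.
elim: k => [|k IH] g U oU.
  by move=> cg y Uy; apply: continuous_comp; [exact: cg|exact: cf].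
move=> [dg Cg]; split=> [y Uy|v]; first by have [] := is_diff_linear_comp (dg _ Uy).
apply: (Ck_on_ext oU _ (IH _ _ oU (Cg v))) => y Uy /=.
by have [_ ->] := is_diff_linear_comp (dg _ Uy).
Qed.

Lemma smooth_on_linear_comp (V' : normedModType R) (g : V' -> V) U : open U ->
  smooth_on U g -> smooth_on U (f \o g).
Proof. by move=> oU sg k; exact: Ck_on_linear_comp. Qed.

End LinearMaps.

Definition coord {n} (j : 'I_n) (v : 'rV[R]_n) : R^o := v 0 j.

Lemma coord_linear n (j : 'I_n) : linear (coord j).
Proof. by move=> a u v; rewrite /coord !mxE. Qed.

Lemma coord_cont n (j : 'I_n) : continuous (coord j).
Proof. exact: coord_continuous. Qed.

Section Coordinates.
Context {V : normedModType R} {n : nat}.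
Implicit Types (U : set V) (f : V -> 'rV[R]_n).

Lemma diff_coord f y v j : differentiable f y ->
  'd (fun z => f z 0 j : R^o) y v = 'd f y v 0 j.
Proof.
by move=> df; have [_ ->] := is_diff_linear_comp (@coord_linear n j) (@coord_cont n j) df.
Qed.

Lemma smooth_on_coord f U j : open U -> smooth_on U f ->
  smooth_on U (fun y => f y 0 j : R^o).
Proof.
by move=> oU; exact: (smooth_on_linear_comp (@coord_linear n j) (@coord_cont n j)).
Qed.

Lemma smooth_on_row f U : open U ->
  (forall j, smooth_on U (fun y => f y 0 j : R^o)) -> smooth_on U f.
Proof.
move=> oU sf.
apply: (smooth_on_ext oU (f := fun y => \sum_j f y 0 j *: 'e_j)) => [y _|].
  by rewrite -rV_sum.
apply: smooth_on_sum => // j _; apply: smooth_on_scalev => //.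
exact: smooth_on_cst.
Qed.

End Coordinates.

Section Composition.
Context {V : normedModType R} {n : nat}.

(** [Ck_on] iterates derivatives in fixed directions, while the chain rule produces ['d g] in the
    direction ['d f y v], which varies with [y]. Expanding that direction in the standard basis of
    the intermediate space restores fixed directions. *)
Lemma Ck_on_comp (W : normedModType R) k : forall (g : 'rV[R]_n -> W) (f : V -> 'rV[R]_n) (U : set V)
  (U' : set 'rV[R]_n),
  open U -> open U' -> (forall y, U y -> U' (f y)) ->
  smooth_on U f -> smooth_on U' g -> Ck_on k U (g \o f).
Proof.
elim: k => [|k IH] g f U U' oU oU' UU' sf sg.
  move=> y Uy; apply: continuous_comp; first exact: smooth_on_continuous sf Uy.
  exact: smooth_on_continuous sg (UU' _ Uy).
have dgf y : U y -> is_diff y (g \o f) ('d g (f y) \o 'd f y).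
  move=> Uy; apply: is_diff_comp; apply: DiffDef => //.
    exact: smooth_on_differentiable sf Uy.
  exact: smooth_on_differentiable sg (UU' _ Uy).
split=> [y Uy|v]; first by have [] := dgf _ Uy.
apply: (Ck_on_ext oU (f := fun y => \sum_j 'd f y v 0 j *: 'd g (f y) 'e_j)) => [y Uy|].
  by have [_ ->] := dgf _ Uy; rewrite /= [RHS](linear_sum_delta _ (@linearP _ _ _ _ _)).
rewrite (_ : (fun _ => _) = (fun y => \sum_(j < n) ('d f y v 0 j *: ((fun z => 'd g z 'e_j) \o f) y)))//.
elim: (index_enum _) => [|j s IHs].
  by under eq_fun do rewrite big_nil; exact: Ck_on_cst.
under eq_fun do rewrite big_cons.
apply: Ck_on_add => //; apply: Ck_on_scalev => //.
  by apply: (smooth_on_coord j oU (smooth_on_diff v sf)).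
exact: (IH _ f U U' oU oU' UU' sf (smooth_on_diff _ sg)).
Qed.

Lemma smooth_on_comp (W : normedModType R) (g : 'rV[R]_n -> W) (f : V -> 'rV[R]_n) (U : set V)
  (U' : set 'rV[R]_n) :
  open U -> open U' -> (forall y, U y -> U' (f y)) ->
  smooth_on U f -> smooth_on U' g -> smooth_on U (g \o f).
Proof. by move=> oU oU' UU' sf sg k; apply: Ck_on_comp sf sg. Qed.

End Composition.

Section LinearFamilies.
Context {V W : normedModType R} {n : nat}.
Implicit Types (U : set V) (A : V -> 'rV[R]_n -> W) (X : V -> 'rV[R]_n).

(** Smoothness is asked for each fixed vector only; expanding in the standard basis of the
    finite-dimensional source then gives smoothness of [A y (X y)] for every smooth [X]. *)
Definition linear_family U A :=
  (forall y, U y -> linear (A y)) /\ (forall v, smooth_on U (fun y => A y v)).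

Lemma linear_family_apply U A X : open U -> linear_family U A -> smooth_on U X ->
  smooth_on U (fun y => A y (X y)).
Proof.
move=> oU [lA sA] sX.
apply: (smooth_on_ext oU (f := fun y => \sum_j X y 0 j *: A y 'e_j)) => [y Uy|].
  by rewrite -linear_sum_delta//; exact: lA.
apply: smooth_on_sum => // j _; apply: smooth_on_scalev => //.
exact: smooth_on_coord.
Qed.

(** Differentiating the finite sum of [X z 0 j *: A z 'e_j] term by term separates the contribution
    of [A], with the vector frozen at [X y], from that of the coordinates of [X]. *)
Lemma linear_family_diff U A X y v : open U -> linear_family U A -> smooth_on U X -> U y ->
  'd (fun z => A z (X z)) y v = 'd (fun z => A z (X y)) y v + A y ('d X y v).
Proof.
move=> oU [lA sA] sX Uy.
have dX : differentiable X y := smooth_on_differentiable sX Uy.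
have dXj j : differentiable (fun z => X z 0 j : R^o) y.
  exact: smooth_on_differentiable (smooth_on_coord j oU sX) Uy.
have dA j : differentiable (fun z => A z 'e_j) y.
  exact: smooth_on_differentiable (sA _) Uy.
pose F j z := X z 0 j *: A z 'e_j.
pose F' j z := X y 0 j *: A z 'e_j.
have dF j : is_diff y (F j) (fun v => X y 0 j *: 'd (fun z => A z 'e_j) y v +
    'd (fun z => X z 0 j : R^o) y v *: A y 'e_j).
  exact: scale_is_diff.
have dF' j : is_diff y (F' j) (fun v => X y 0 j *: 'd (fun z => A z 'e_j) y v).
  by apply: DiffDef; [exact: differentiableZ|rewrite diffZ].
have dsum (G : 'I_n -> V -> W) (dG : 'I_n -> V -> W) (s : seq 'I_n) :
    (forall j, is_diff y (G j) (dG j)) ->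
    is_diff y (fun z => \sum_(j <- s) G j z) (fun v => \sum_(j <- s) dG j v).
  move=> dG'; elim: s => [|j s IH].
    under eq_fun do rewrite big_nil; under [X in is_diff _ _ X]eq_fun do rewrite big_nil.
    exact: is_diff_cst.
  under eq_fun do rewrite big_cons; under [X in is_diff _ _ X]eq_fun do rewrite big_cons.
  exact: (is_diffD (dG' j) IH).
have [d1 e1] := dsum _ _ (index_enum _) dF.
have [d2 e2] := dsum _ _ (index_enum _) dF'.
rewrite (open_eq_diff oU (g := fun z => A z (X z)) _ Uy d1); last first.
  by move=> z Uz; rewrite [RHS](linear_sum_delta _ (lA _ Uz)).
rewrite (open_eq_diff oU (g := fun z => A z (X y)) _ Uy d2); last first.
  by move=> z Uz; rewrite [RHS](linear_sum_delta _ (lA _ Uz)).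
rewrite e1 e2 big_split; congr (_ + _).
rewrite (linear_sum_delta _ (lA _ Uy)); apply: eq_bigr => j _.
by rewrite diff_coord.
Qed.

End LinearFamilies.
End RowVectors.

(** * Symmetry of second derivatives *)

Section Schwarz.
Context {R : realType}.

Lemma diff_line_is_derive (V : normedModType R) (f : V -> R^o) (u w : V) (s : R) :
  differentiable f (s *: u + w) ->
  is_derive s (1 : R) (fun r : R => f (r *: u + w) : R) ('d f (s *: u + w) u).
Proof.
move=> df.
have dl : is_diff s (fun r : R => r *: u + w) (fun r : R => r *: u).
  have h : is_diff s ((fun r : R => r *: u) + cst w) ((fun r : R => r *: u) + 0).
    by apply: is_diffD.
  by rewrite addr0 in h.
have dc : is_diff s (f \o (fun r : R => r *: u + w))
    ('d f (s *: u + w) \o (fun r : R => r *: u)).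
  by apply: is_diff_comp; apply: DiffDef.
have [dd e] := dc.
apply: DeriveDef; first exact/diff_derivable.
by rewrite deriveE// e /= scale1r.
Qed.

(* The mean value theorem in each variable; exchanging u and v yields the
   symmetry of the second derivative. *)
Lemma second_difference (V : normedModType R) (U : set V) (f : V -> R^o) (x u v : V) (h : R) :
  0 < h ->
  (forall s t : R, 0 <= s <= h -> 0 <= t <= h -> U (s *: u + (t *: v + x))) ->
  (forall y, U y -> differentiable f y) ->
  (forall y, U y -> differentiable (fun z => 'd f z u) y) ->
  exists s t : R, [/\ 0 <= s <= h, 0 <= t <= h &
    f (h *: u + (h *: v + x)) - f (h *: u + x) - f (h *: v + x) + f x =
    'd (fun z => 'd f z u) (s *: u + (t *: v + x)) v * h * h].
Proof.
move=> h0 hU df ddf.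
have hU0 s : 0 <= s <= h -> U (s *: u + x).
  by move=> sh; have := hU s 0 sh; rewrite lexx ltW// scale0r add0r; exact.
have hh : 0 <= h <= h by rewrite lexx ltW.
(* [g] is the increment of [f] in the direction [v], viewed along [u]. Its mean value is an
   increment of ['d f] applied to [u], to which the theorem applies once more through [k]. *)
pose g (s : R) : R := f (s *: u + (h *: v + x)) - f (s *: u + x).
have dg (s : R) : 0 <= s <= h -> is_derive s (1 : R) g
    ('d f (s *: u + (h *: v + x)) u - 'd f (s *: u + x) u).
  move=> sh; apply: is_deriveB; apply: diff_line_is_derive; apply: df.
    exact: hU.
  exact: hU0.
have [s sh gs] : exists2 c, c \in `]0, h[%R & g h - g 0 =
    ('d f (c *: u + (h *: v + x)) u - 'd f (c *: u + x) u) * (h - 0).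
  apply: (MVT (df := fun c => 'd f (c *: u + (h *: v + x)) u - 'd f (c *: u + x) u)) => //.
    by move=> c; rewrite in_itv/= => /andP[c0 ch]; apply: dg; rewrite !ltW.
  apply: derivable_within_continuous => c; rewrite in_itv/= => ch.
  by have [] := dg _ ch.
have {}sh : 0 <= s <= h by move: sh; rewrite in_itv/= => /andP[? ?]; rewrite !ltW.
pose k (t : R) : R := 'd f (t *: v + (s *: u + x)) u.
have dk (t : R) : 0 <= t <= h -> is_derive t (1 : R) k
    ('d (fun z => 'd f z u) (t *: v + (s *: u + x)) v).
  move=> th; apply: (@diff_line_is_derive _ (fun z => 'd f z u)); apply: ddf.
  by rewrite addrCA; apply: hU.
have [t th kt] : exists2 c, c \in `]0, h[%R & k h - k 0 =
    'd (fun z => 'd f z u) (c *: v + (s *: u + x)) v * (h - 0).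
  apply: (MVT (df := fun c => 'd (fun z => 'd f z u) (c *: v + (s *: u + x)) v)) => //.
    by move=> c; rewrite in_itv/= => /andP[c0 ch]; apply: dk; rewrite !ltW.
  apply: derivable_within_continuous => c; rewrite in_itv/= => ch.
  by have [] := dk _ ch.
have {}th : 0 <= t <= h by move: th; rewrite in_itv/= => /andP[? ?]; rewrite !ltW.
exists s, t; split=> //.
rewrite subr0 in kt gs.
rewrite [s *: u + _]addrCA -kt /k [h *: v + (s *: u + x)]addrCA scale0r add0r -gs.
rewrite /g !scale0r !add0r.
by rewrite [in RHS]opprB [in RHS]addrA addrAC.
Qed.

(** The second difference over a parallelogram is unchanged when [u] and [v] are exchanged, so the
    two mixed derivatives agree at suitable points near [x]. Both are continuous at [x], hence their
    values there differ by at most any positive [e]. *)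
Lemma diff_symmetric (V : normedModType R) (U : set V) (f : V -> R^o) (x u v : V) :
  open U -> smooth_on U f -> U x ->
  'd (fun z => 'd f z u) x v = 'd (fun z => 'd f z v) x u.
Proof.
move=> oU sf Ux.
have cont a b : {for x, continuous (fun y => 'd (fun z => 'd f z a) y b)}.
  exact: smooth_on_continuous (smooth_on_diff b (smooth_on_diff a sf)) Ux.
apply/eqP; rewrite -subr_eq0 -normr_le0; apply/ler_addgt0Pl => e e0; rewrite addr0.
have e20 : 0 < e / 2 by rewrite divr_gt0.
have [d d0 hd] : exists2 d : R, 0 < d & forall y, `|y - x| < d -> [/\ U y,
   `|'d (fun z => 'd f z u) y v - 'd (fun z => 'd f z u) x v| < e / 2 &
   `|'d (fun z => 'd f z v) y u - 'd (fun z => 'd f z v) x u| < e / 2].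
  have h : \forall y \near x, [/\ U y,
   `|'d (fun z => 'd f z u) y v - 'd (fun z => 'd f z u) x v| < e / 2 &
   `|'d (fun z => 'd f z v) y u - 'd (fun z => 'd f z v) x u| < e / 2].
    near=> y; split; near: y; first exact: open_nbhs_nbhs.
      by move/cvgrPdist_lt: (cont u v) => /(_ _ e20); apply: filterS => z; rewrite distrC.
    by move/cvgrPdist_lt: (cont v u) => /(_ _ e20); apply: filterS => z; rewrite distrC.
  move/nbhs_normP: h => [d /= d0 hd]; exists d => // y yd; apply: hd.
  by rewrite /ball_/= distrC.
(* With sides [h] the parallelogram stays within [h * c = d / 2] of [x]; the summand 1 keeps [c]
   positive when [u] and [v] vanish. *)
pose c : R := 1 + `|u| + `|v|.
have c0 : 0 < c by rewrite /c -addrA ltr_pwDl// addr_ge0.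
pose h := d / 2 / c.
have h0 : 0 < h by rewrite !divr_gt0.
have near_x a b (s t : R) : `|a| + `|b| <= c -> 0 <= s <= h -> 0 <= t <= h ->
    `|s *: a + (t *: b + x) - x| < d.
  move=> abc /andP[s0 sh] /andP[t0 th]; rewrite addrA addrK.
  apply: (le_lt_trans (ler_normD _ _)); rewrite !normrZ !ger0_norm//.
  apply: (@le_lt_trans _ _ (h * c)).
    apply: (@le_trans _ _ (h * (`|a| + `|b|))); last by rewrite ler_wpM2l// ltW.
    by rewrite mulrDr lerD// ler_wpM2r.
  by rewrite /h divfK ?gt_eqF// ltr_pdivrMr// ltr_pMr// ltr1n.
have uvc : `|u| + `|v| <= c by rewrite /c -addrA lerDr.
have vuc : `|v| + `|u| <= c by rewrite addrC.
have sd a : forall y, `|y - x| < d -> differentiable (fun z => 'd f z a) y.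
  by move=> y /hd[Uy _ _]; exact: smooth_on_differentiable (smooth_on_diff a sf) Uy.
have sd0 : forall y, `|y - x| < d -> differentiable f y.
  by move=> y /hd[Uy _ _]; exact: smooth_on_differentiable sf Uy.
have [s [t [sh th E1]]] := @second_difference V [set y | `|y - x| < d] f x u v h h0
  (fun s t => near_x u v s t uvc) sd0 (sd u).
have [s' [t' [sh' th' E2]]] := @second_difference V [set y | `|y - x| < d] f x v u h h0
  (fun s t => near_x v u s t vuc) sd0 (sd v).
have E : 'd (fun z => 'd f z u) (s *: u + (t *: v + x)) v =
    'd (fun z => 'd f z v) (s' *: v + (t' *: u + x)) u.
  apply: (mulIf (lt0r_neq0 h0)); apply: (mulIf (lt0r_neq0 h0)).
  rewrite -E1 -E2 [h *: u + (h *: v + x)]addrCA.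
  by congr (_ + _); rewrite addrAC.
have [_ + _] := hd _ (near_x u v s t uvc sh th).
have [_ _] := hd _ (near_x v u s' t' vuc sh' th').
rewrite -E; set A := 'd _ _ _; set P := 'd _ _ _; set Q := 'd _ _ _ => h1 h2.
rewrite -(subrKA A) [e](splitr e).
by apply: (le_trans (ler_normD _ _)); rewrite lerD// ltW// distrC.
Unshelve. all: by end_near. Qed.

Lemma diff_symmetric_row (V : normedModType R) n (U : set V) (f : V -> 'rV[R]_n) (x u v : V) :
  open U -> smooth_on U f -> U x ->
  'd (fun z => 'd f z u) x v = 'd (fun z => 'd f z v) x u.
Proof.
move=> oU sf Ux; apply/rowP => j.
rewrite -!diff_coord; try exact: smooth_on_differentiable (smooth_on_diff _ sf) Ux.
have sfj := smooth_on_coord j oU sf.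
have e w y : U y -> 'd (fun z => f z 0 j : R^o) y w = 'd f y w 0 j.
  by move=> Uy; apply: diff_coord; exact: smooth_on_differentiable sf Uy.
rewrite (open_eq_diff oU (e u) Ux); last first.
  exact: smooth_on_differentiable (smooth_on_diff _ sfj) Ux.
rewrite (open_eq_diff oU (e v) Ux); last first.
  exact: smooth_on_differentiable (smooth_on_diff _ sfj) Ux.
exact: diff_symmetric sfj Ux.
Qed.

End Schwarz.

(** * Bump functions *)

Section Bump.
Context {R : realType}.

(* x^-m exp (- 1 / x): the extra power of 1/x closes the family under derivation. *)
Definition flat (m : nat) (x : R) : R :=
  if 0 < x then x^-1 ^+ m * expR (- x^-1) else 0.

Lemma flat_ge0 m x : 0 <= flat m x.
Proof.
rewrite /flat; case: ifP => // x0.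
by rewrite mulr_ge0 ?expR_ge0// exprn_ge0// invr_ge0 ltW.
Qed.

Lemma flat0_gt0 x : 0 < x -> 0 < flat 0 x.
Proof. by move=> x0; rewrite /flat x0 expr0 mul1r expR_gt0. Qed.

Lemma flat_le0 m x : x <= 0 -> flat m x = 0.
Proof. by rewrite /flat ltNge => ->. Qed.

(** One term of the exponential series bounds [expR x^-1] below by [x^-1 ^+ m.+2] over the factorial
    of m + 2. The two spare powers leave a quadratic bound, which gives differentiability with zero
    derivative at the origin. *)
Lemma flat_le_sqr m x : flat m x <= (m.+2)`!%:R * x ^+ 2.
Proof.
rewrite /flat; case: ifP => x0; last by rewrite mulr_ge0// sqr_ge0.
rewrite expRN ler_pdivrMr ?expR_gt0//.
have h : x^-1 ^+ m.+2 / (m.+2)`!%:R <= expR x^-1.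
  by apply: le_trans (expR_ge1Dxn m.+1 _); rewrite ?lerDr// invr_ge0 ltW.
have c0 : 0 <= (m.+2)`!%:R * x ^+ 2 by rewrite mulr_ge0// sqr_ge0.
apply: le_trans (ler_wpM2l c0 h).
rewrite -[m.+2]addn2 exprD [X in _ <= X](_ : _ = x^-1 ^+ m); first exact: lexx.
have f0 : ((m + 2)`!%:R : R) != 0 by rewrite pnatr_eq0 -lt0n fact_gt0.
have xn0 : x != 0 by rewrite gt_eqF.
by field; rewrite f0 xn0.
Qed.

Lemma quadratic_is_diff0 (V W : normedModType R) (k : V -> W) (C : R) :
  k 0 = 0 -> (forall z, `|k z| <= C * `|z| ^+ 2) -> is_diff (0 : V) k (0 : V -> W).
Proof.
move=> k0 kC.
have c0 : continuous (\0 : V -> W) by exact: cst_continuous.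
have e0 : k \o shift 0 = cst (k 0) + (\0 : V -> W) +o_ 0 id.
  apply/eqaddoP => _/posnumP[e].
  have C0 : 0 < `|C| + 1 by rewrite ltr_wpDl.
  have e1 : 0 < (`|C| + 1)^-1 * e%:num by rewrite mulr_gt0// invr_gt0.
  have : \forall z \near (0 : V), `|z| <= (`|C| + 1)^-1 * e%:num by exact: nbhs0_le.
  apply: filterS => z hz; change (`|k (z + 0) - (k 0 + 0)| <= e%:num * `|z|).
  rewrite k0 !addr0 subr0; apply: (le_trans (kC z)); rewrite expr2 mulrA ler_wpM2r//.
  apply: (@le_trans _ _ ((`|C| + 1) * `|z|)).
    by rewrite ler_wpM2r// (le_trans (ler_norm C))// lerDl.
  by rewrite -ler_pdivlMl.
have dk : 'd k 0 = \0 :> (V -> W) by apply: diff_unique.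
by apply: DiffDef => //; apply/diff_locallyP; rewrite dk.
Qed.

Lemma flat_is_derive m x :
  is_derive x (1 : R) (flat m) (- m%:R * flat m.+1 x + flat m.+2 x).
Proof.
case: (ltrgtP x 0) => [x0|x0|->].
- rewrite !flat_le0 ?(ltW x0)// mulr0 addr0.
  apply: (near_eq_is_derive (f := cst 0)).
    near=> z; rewrite flat_le0//; apply: ltW.
    by near: z; apply: open_nbhs_nbhs; split => //; exact: open_lt.
- have xn0 : x != 0 by rewrite gt_eqF.
  apply: (near_eq_is_derive (f := (fun y : R => y^-1) ^+ m * (expR \o (fun y : R => - y^-1)))).
  - near=> z; rewrite /flat ifT; first by rewrite !fctE.
    by near: z; apply: open_nbhs_nbhs; split => //; exact: open_gt.
  have dV : is_derive x (1 : R) (fun y : R => y^-1) (- x ^- 2 *: 1).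
    by apply: is_deriveV.
  apply: is_derive_eq.
  rewrite /flat x0 !fctE /GRing.scale/= mulr1.
  case: m => [|m].
    by rewrite !mulr0n !mul0r mulr0 addr0 oppr0 mul0r add0r mul1r opprK exprVn mulrC.
  rewrite [m.+1.-1]/= opprK.
  set E := expR _; rewrite -!exprVn.
  by rewrite !exprS; ring.
- rewrite !flat_le0// mulr0 addr0.
  have [dk e] : is_diff (0 : R) (flat m) (0 : R -> R).
    apply: (@quadratic_is_diff0 _ _ _ (m.+2)`!%:R); first by rewrite flat_le0.
    by move=> z; rewrite ger0_norm ?flat_ge0// real_normK ?num_real// flat_le_sqr.
  by apply: DeriveDef; [exact: diff_derivable|rewrite deriveE// e].
Unshelve. all: by end_near. Qed.

Lemma flat_is_diff m x : is_diff x (flat m : R^o -> R^o)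
  (fun v => v * (- m%:R * flat m.+1 x + flat m.+2 x)).
Proof.
have d := flat_is_derive m x.
have dd : differentiable (flat m : R^o -> R^o) x by apply/derivable1_diffP.
apply: DiffDef => //; apply/funext => v.
rewrite -[v in LHS]mulr1 -[v * 1]/(v *: (1 : R^o)) linearZ -deriveE//.
by rewrite derive_val.
Qed.

(** A copy of [flat] on rows of length one, the shape that the composition lemma for smooth maps
    asks of its intermediate space. *)
Definition flat_row m (w : 'rV[R]_1) : R^o := flat m (w 0 0).

(** Differentiating [flat m] gives a combination of [flat m.+1] and [flat m.+2], so the induction
    must cover all [m] at once. *)
Lemma flat_row_Ck k : forall m, Ck_on k setT (flat_row m).
Proof.
have df m w : is_diff w (flat_row m) (fun v => v 0 0 *
    (- m%:R * flat m.+1 (w 0 0) + flat m.+2 (w 0 0))).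
  exact: (is_diff_comp (linear_is_diff (@coord_linear R 1 0) (@coord_cont R 1 0) w)
    (flat_is_diff m (w 0 0))).
elim: k => [|k IH] m.
  by move=> w _; have [d _] := df m w; exact: differentiable_continuous.
split=> [w _|v]; first by have [] := df m w.
apply: (Ck_on_ext openT (f := fun w => v 0 0 *: (- m%:R *: flat_row m.+1 w + flat_row m.+2 w))).
  by move=> w _; have [_ ->] := df m w.
apply: Ck_on_scale; first exact: openT.
apply: Ck_on_add; [exact: openT| |exact: IH].
by apply: Ck_on_scale; [exact: openT|exact: IH].
Qed.

Lemma flat_comp_smooth n (q : 'rV[R]_n -> R^o) : smooth_on setT q ->
  smooth_on setT (fun y => flat 0 (q y) : R^o).
Proof.
move=> sq.
have -> : (fun y => flat 0 (q y)) = flat_row 0 \o (fun y => const_mx (q y)).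
  by apply/funext => y; rewrite /flat_row/= mxE.
apply: (smooth_on_comp (U' := setT) openT openT) => //; last by move=> k; exact: flat_row_Ck.
apply: smooth_on_row => [|j]; first exact: openT.
by apply: (smooth_on_ext openT _ sq) => y _; rewrite mxE.
Qed.

Lemma bump_exists n (y0 : 'rV[R]_n) (r : R) : 0 < r ->
  exists b : 'rV[R]_n -> R^o, [/\ smooth_on setT b,
    (\forall y \near y0, b y = 1) & forall y, b y != 0 -> `|y - y0| <= r].
Proof.
move=> r0; pose N (y : 'rV[R]_n) : R^o := \sum_j (y 0 j - y0 0 j) * (y 0 j - y0 0 j).
have sN : smooth_on setT N.
  apply: smooth_on_sum => [|j _]; first exact: openT.
  have h : smooth_on setT (fun y : 'rV[R]_n => y 0 j - y0 0 j : R^o).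
    apply: smooth_on_add; first exact: openT.
      exact: (linear_smooth_on (@coord_linear R n j) (@coord_cont R n j)).
    exact: smooth_on_cst.
  exact: (smooth_on_mul openT h h).
(* [q] is affine in the squared Euclidean distance [N]: it is at least 1 for [N <= rho] and positive
   exactly for [N < 2 * rho = r ^+ 2]. *)
pose rho : R := r ^+ 2 / 2.
have rho0 : 0 < rho by rewrite divr_gt0// exprn_gt0.
pose q (y : 'rV[R]_n) : R^o := 2 - rho^-1 * N y.
have sq : smooth_on setT q.
  apply: smooth_on_add; [exact: openT|exact: smooth_on_cst|].
  apply: (smooth_on_ext openT (f := fun y => - rho^-1 *: N y)) => [y _|].
    by rewrite scaleNr.
  by apply: smooth_on_scale => //; exact: openT.
have sq' : smooth_on setT (fun y => 1 - q y : R^o).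
  apply: smooth_on_add; [exact: openT|exact: smooth_on_cst|].
  apply: (smooth_on_ext openT (f := fun y => - 1 *: q y)) => [y _|].
    by rewrite scaleN1r.
  by apply: smooth_on_scale => //; exact: openT.
(* The quotient of [flat 0 (q y)] by [D y] is 1 where [q >= 1] and 0 where [q <= 0]; [D] never
   vanishes since [q] and [1 - q] are not both nonpositive. *)
pose D y : R^o := flat 0 (q y) + flat 0 (1 - q y).
have D0 y : D y != 0.
  rewrite /D gt_eqF//; case: (ltrP 0 (q y)) => [q0|q0].
    by rewrite ltr_pwDl// ?flat0_gt0// flat_ge0.
  by rewrite ltr_wpDl// ?flat_ge0// flat0_gt0// subr_gt0 (le_lt_trans q0).
exists (fun y => flat 0 (q y) * (D y)^-1); split.
- apply: smooth_on_mul; [exact: openT|exact: flat_comp_smooth|].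
  apply: smooth_on_inv => [||]; [exact: openT|by move=> y _; exact: D0|].
  by apply: smooth_on_add; [exact: openT|exact: flat_comp_smooth|exact: flat_comp_smooth].
- have N0 : N y0 = 0 by rewrite /N big1// => j _; rewrite subrr mul0r.
  have cN : {for y0, continuous N} by exact: smooth_on_continuous sN _.
  have : \forall y \near y0, N y < rho.
    have h : N y0 < rho by rewrite N0.
    apply: (cN [set z : R | z < rho]); apply: open_nbhs_nbhs.
    by split; [exact: open_lt|].
  apply: filterS => y Ny.
  have q1 : 1 <= q y.
    by rewrite /q lerBrDl addrC -lerBrDl (_ : 2 - 1 = 1)// ?ler_pdivrMl ?mulr1 ?ltW//; ring.
  have D1 : D y = flat 0 (q y) by rewrite /D [X in _ + X]flat_le0 ?addr0// subr_le0.
  by rewrite -D1 divff.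
- move=> y; rewrite mulf_eq0 negb_or => /andP[fq _].
  have q0 : 0 < q y by rewrite ltNge; apply/negP => /(flat_le0 0) h; rewrite h eqxx in fq.
  have Ny : N y < r ^+ 2.
    move: q0; rewrite /q subr_gt0 ltr_pdivrMl// => h.
    by apply: (lt_le_trans h); rewrite /rho divfK.
  (* The norm of a row vector is the maximum of the absolute values of its entries, and the square
     of a single entry is at most [N y]. *)
  rewrite [leLHS]/Num.Def.normr/= mx_normrE; apply: bigmax_le => [|[i j] _]; first exact: ltW.
  rewrite !mxE ord1/= -ler_sqr ?nnegrE ?(ltW r0)//; apply: ltW.
  rewrite real_normK ?num_real//.
  apply: le_lt_trans Ny; rewrite /N (bigD1 j)//= expr2 lerDl sumr_ge0// => l _.
  by rewrite -expr2 sqr_ge0.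
Qed.
End Bump.

(** * Families of multilinear forms *)

Section LinearProp.
Context {R : realType} {U V : lmodType R}.
Implicit Types f : U -> V.

Lemma linear_add f : linear f -> {morph f : u v / u + v}.
Proof. by move=> lf u v; rewrite -[u in LHS]scale1r lf scale1r. Qed.

Lemma linear_zero f : linear f -> f 0 = 0.
Proof. by move=> lf; have := lf (-1) 0 0; rewrite scaler0 addr0 scaleN1r addNr. Qed.

Lemma linear_scale f a u : linear f -> f (a *: u) = a *: f u.
Proof. by move=> lf; rewrite -[a *: u]addr0 lf linear_zero// addr0. Qed.

Lemma linear_opp f u : linear f -> f (- u) = - f u.
Proof. by move=> lf; rewrite -scaleN1r linear_scale// scaleN1r. Qed.

Lemma linear_sub f : linear f -> {morph f : u v / u - v}.
Proof. by move=> lf u v; rewrite linear_add// linear_opp. Qed.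

Lemma linear_sum_prop f (I : Type) (r : seq I) (F : I -> U) : linear f ->
  f (\sum_(i <- r) F i) = \sum_(i <- r) f (F i).
Proof.
move=> lf; elim: r => [|i r IH]; first by rewrite !big_nil linear_zero.
by rewrite !big_cons linear_add// IH.
Qed.

End LinearProp.

(* Directional derivative, locked: unification would otherwise unfold 'd. *)
HB.lock Definition dird (R : realType) (V W : normedModType R) (f : V -> W) (y v : V) : W :=
  'd f y v.

Section DirectionalDerivative.
Context {R : realType} {V W : normedModType R}.
Implicit Types (U : set V) (f g : V -> W).

Lemma dirdE f y v : 'd f y v = dird f y v.
Proof. by rewrite unlock. Qed.

Lemma dird_linear f y : linear (dird f y).
Proof. by rewrite unlock; exact: linearP. Qed.

Lemma open_eq_dird U f g y v : open U -> (forall z, U z -> f z = g z) -> U y ->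
  differentiable f y -> dird g y v = dird f y v.
Proof. by move=> oU fg Uy df; rewrite unlock (open_eq_diff oU fg Uy df). Qed.

Lemma smooth_on_dird U f v : smooth_on U f -> smooth_on U (fun y => dird f y v).
Proof. by rewrite unlock; exact: smooth_on_diff. Qed.

Lemma dird_cst (w : W) (y v : V) : dird (fun=> w) y v = 0.
Proof. by rewrite unlock (diff_cst w y). Qed.

Lemma dirdD f g y v : differentiable f y -> differentiable g y ->
  dird (fun z => f z + g z) y v = dird f y v + dird g y v.
Proof. by move=> df dg; rewrite unlock; have -> := diffD df dg. Qed.

Lemma dirdZ f a y v : differentiable f y -> dird (fun z => a *: f z) y v = a *: dird f y v.
Proof. by move=> df; rewrite unlock; have -> := diffZ a df. Qed.

End DirectionalDerivative.

Lemma dirdM (R : realType) (V : normedModType R) (f g : V -> R^o) y v :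
  differentiable f y -> differentiable g y ->
  dird (fun z => f z * g z : R^o) y v = f y * dird g y v + dird f y v * g y.
Proof. by move=> df dg; rewrite unlock; exact: diffM_ext. Qed.

Lemma linear_family_dird (R : realType) (V W : normedModType R) n (U : set V)
    (A : V -> 'rV[R]_n -> W) X y v :
  open U -> linear_family U A -> smooth_on U X -> U y ->
  dird (fun z => A z (X z)) y v = dird (fun z => A z (X y)) y v + A y (dird X y v).
Proof. by move=> oU lA sX Uy; rewrite -!dirdE; exact: linear_family_diff sX Uy. Qed.

Section Multilinear.
Context {R : realType} {n : nat}.
Local Notation V := 'rV[R]_n.
Implicit Types (U : set V) (X Y Z : V -> V).

Lemma linear_family_dird_dir (W : normedModType R) U (f : V -> W) :
  smooth_on U f -> linear_family U (fun y v => dird f y v).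
Proof.
move=> sf; split=> [y _|v]; first exact: dird_linear.
exact: smooth_on_dird.
Qed.

Lemma smooth_on_dird_along (W : normedModType R) U (f : V -> W) X : open U ->
  smooth_on U f -> smooth_on U X -> smooth_on U (fun y => dird f y (X y)).
Proof.
by move=> oU sf sX; exact: (linear_family_apply oU (linear_family_dird_dir sf) sX).
Qed.

Lemma linear_family_dird_fam (W : normedModType R) U (A : V -> V -> W) X : open U ->
  linear_family U A -> smooth_on U X ->
  linear_family U (fun y w => dird (fun z => A z w) y (X y)).
Proof.
move=> oU [lA sA] sX; split=> [y Uy a u v|v].
  have du := smooth_on_differentiable (sA u) Uy.
  have dv := smooth_on_differentiable (sA v) Uy.
  have dau : differentiable (fun z => a *: A z u) y by exact: differentiableZ.
  have e z : U z -> a *: A z u + A z v = A z (a *: u + v) by move=> Uz; rewrite (lA _ Uz).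
  rewrite (open_eq_dird _ oU e Uy); last exact: differentiableD.
  by rewrite dirdD// dirdZ.
exact: smooth_on_dird_along.
Qed.

Section Bilinear.
Context {W : normedModType R}.
Implicit Types (A : V -> V -> V -> W).

Definition bilinear_family U A :=
  (forall v, linear_family U (fun y u => A y u v)) /\
  (forall u, linear_family U (fun y v => A y u v)).

Lemma bilinear_family_l U A Y : open U -> bilinear_family U A -> smooth_on U Y ->
  linear_family U (fun y u => A y u (Y y)).
Proof.
move=> oU [lA rA] sY; split=> [y Uy|u].
  by have [+ _] := lA (Y y); exact.
exact: linear_family_apply (rA u) sY.
Qed.

Lemma bilinear_family_r U A X : open U -> bilinear_family U A -> smooth_on U X ->
  linear_family U (fun y v => A y (X y) v).
Proof.
move=> oU [lA rA] sX; split=> [y Uy|v].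
  by have [+ _] := rA (X y); exact.
exact: linear_family_apply (lA v) sX.
Qed.

Lemma bilinear_family_apply U A X Y : open U -> bilinear_family U A ->
  smooth_on U X -> smooth_on U Y -> smooth_on U (fun y => A y (X y) (Y y)).
Proof.
move=> oU bA sX sY; exact: linear_family_apply oU (bilinear_family_l oU bA sY) sX.
Qed.

Lemma bilinear_family_dird U A X Y y v : open U -> bilinear_family U A ->
  smooth_on U X -> smooth_on U Y -> U y ->
  dird (fun z => A z (X z) (Y z)) y v =
  dird (fun z => A z (X y) (Y y)) y v + A y (dird X y v) (Y y) + A y (X y) (dird Y y v).
Proof.
move=> oU bA sX sY Uy; have [lA rA] := bA.
rewrite (linear_family_dird v oU (bilinear_family_l oU bA sY) sX Uy).
by rewrite (linear_family_dird v oU (rA (X y)) sY Uy) addrAC.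
Qed.

End Bilinear.

Section Trilinear.
Context {W : normedModType R}.
Implicit Types (A : V -> V -> V -> V -> W).

Definition trilinear_family U A :=
  [/\ (forall w, bilinear_family U (fun y u v => A y u v w)),
      (forall v, bilinear_family U (fun y u w => A y u v w)) &
      (forall u, bilinear_family U (fun y v w => A y u v w))].

Lemma trilinear_family_fst U A X : open U -> trilinear_family U A -> smooth_on U X ->
  bilinear_family U (fun y v w => A y (X y) v w).
Proof.
move=> oU [A12 A13 A23] sX; split=> v.
  exact: bilinear_family_r (A12 v) sX.
exact: bilinear_family_r (A13 v) sX.
Qed.

Lemma trilinear_family_apply U A X Y Z : open U -> trilinear_family U A ->
  smooth_on U X -> smooth_on U Y -> smooth_on U Z ->
  smooth_on U (fun y => A y (X y) (Y y) (Z y)).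
Proof.
move=> oU tA sX sY sZ.
exact: bilinear_family_apply oU (trilinear_family_fst oU tA sX) sY sZ.
Qed.

Lemma trilinear_family_dird U A X Y Z y v : open U -> trilinear_family U A ->
  smooth_on U X -> smooth_on U Y -> smooth_on U Z -> U y ->
  dird (fun z => A z (X z) (Y z) (Z z)) y v =
  dird (fun z => A z (X y) (Y y) (Z y)) y v + A y (dird X y v) (Y y) (Z y) +
  A y (X y) (dird Y y v) (Z y) + A y (X y) (Y y) (dird Z y v).
Proof.
move=> oU tA sX sY sZ Uy; have [A12 A13 A23] := tA.
rewrite (bilinear_family_dird v oU (trilinear_family_fst oU tA sX) sY sZ Uy).
have -> : dird (fun z => A z (X z) (Y y) (Z y)) y v =
   dird (fun z => A z (X y) (Y y) (Z y)) y v + A y (dird X y v) (Y y) (Z y) => //.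
by have [h _] := A12 (Z y); exact: linear_family_dird v oU (h (Y y)) sX Uy.
Qed.

End Trilinear.

End Multilinear.

(** * Koszul forms in coordinates *)

Section LinearClosure.
Context {R : realType} {U V W : lmodType R}.

Lemma linear_compf (f : V -> W) (g : U -> V) : linear f -> linear g ->
  linear (fun u => f (g u)).
Proof. by move=> lf lg a u v; rewrite lg lf. Qed.

Lemma linear_addf (f g : U -> V) : linear f -> linear g -> linear (fun u => f u + g u).
Proof. by move=> lf lg a u v; rewrite lf lg scalerDr addrACA. Qed.

Lemma linear_scalef k (f : U -> V) : linear f -> linear (fun u => k *: f u).
Proof. by move=> lf a u v; rewrite lf scalerDr !scalerA mulrC. Qed.

Lemma linear_oppf (f : U -> V) : linear f -> linear (fun u => - f u).
Proof. by move=> lf a u v; rewrite lf opprD scalerN. Qed.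

End LinearClosure.

Section TrilinearIntro.
Context {R : realType} {n : nat} {W : normedModType R}.
Local Notation V := 'rV[R]_n.
Implicit Types (U : set V) (A : V -> V -> V -> V -> W).

Lemma trilinear_family_intro U A :
  (forall y v w, U y -> linear (fun u => A y u v w)) ->
  (forall y u w, U y -> linear (fun v => A y u v w)) ->
  (forall y u v, U y -> linear (fun w => A y u v w)) ->
  (forall u v w, smooth_on U (fun y => A y u v w)) ->
  trilinear_family U A.
Proof.
by move=> l1 l2 l3 s; split=> v1; split=> v2; split=> [y Uy|v3];
  do ?[exact: s]; do ?[exact: l1]; do ?[exact: l2]; do ?[exact: l3].
Qed.

Lemma trilinear_family1 U A y v w : trilinear_family U A -> U y ->
  linear (fun u => A y u v w).
Proof. by move=> [h _ _] Uy; have [/(_ v)[l _] _] := h w; exact: l. Qed.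

Lemma trilinear_family2 U A y u w : trilinear_family U A -> U y ->
  linear (fun v => A y u v w).
Proof. by move=> [h _ _] Uy; have [_ /(_ u)[l _]] := h w; exact: l. Qed.

Lemma trilinear_family3 U A y u v : trilinear_family U A -> U y ->
  linear (fun w => A y u v w).
Proof. by move=> [_ h _] Uy; have [_ /(_ u)[l _]] := h v; exact: l. Qed.

Lemma trilinear_family_smooth U A u v w : trilinear_family U A ->
  smooth_on U (fun y => A y u v w).
Proof. by move=> [h _ _]; have [/(_ v)[_ s] _] := h w; exact: s. Qed.

Lemma bilinear_family1 U (A : V -> V -> V -> W) y v : bilinear_family U A -> U y ->
  linear (fun u => A y u v).
Proof. by move=> [h _] Uy; have [l _] := h v; exact: l. Qed.

Lemma bilinear_family2 U (A : V -> V -> V -> W) y u : bilinear_family U A -> U y ->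
  linear (fun v => A y u v).
Proof. by move=> [_ h] Uy; have [l _] := h u; exact: l. Qed.

End TrilinearIntro.

Section LocalGeometry.
Context {R : realType} {n : nat}.
Local Notation V := 'rV[R]_n.

(* In a chart the Koszul form is K (X, Y, Z) = christoffel (X, Y, Z) + <dY X, Z>,
   and likewise for its almost product version and ap_christoffel. *)
Definition christoffel (G : V -> V -> V -> R^o) (y u v w : V) : R^o :=
  2^-1 * (dird (fun z => G z v w) y u + dird (fun z => G z w u) y v
          - dird (fun z => G z u v) y w).

Definition ap_christoffel (G : V -> V -> V -> R^o) (J : V -> V -> V) (y u v w : V) : R^o :=
  2^-1 * (christoffel G y u v w + christoffel G y u (J y v) (J y w)
          + G y (dird (fun z => J z v) y u) (J y w)).

Variables (U : set V) (G : V -> V -> V -> R^o) (J : V -> V -> V).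
Hypotheses (oU : open U) (symG : forall y u v, G y u v = G y v u).
Hypotheses (bG : bilinear_family U G) (lJ : linear_family U J).

Lemma bilinear_family_dG y v w a b : U y ->
  linear (fun u : V => (dird (fun z => G z v w) y u : R^o)) /\
  linear (fun u : V => (dird (fun z => G z u b) y a : R^o)).
Proof.
move=> Uy; split; first exact: dird_linear.
have [h _] := linear_family_dird_fam oU (bG.1 b) (smooth_on_cst U a).
exact: h.
Qed.

Lemma dG_linear2 y a b : U y -> linear (fun u : V => (dird (fun z => G z b u) y a : R^o)).
Proof.
move=> Uy; have [h _] := linear_family_dird_fam oU (bG.2 b) (smooth_on_cst U a).
exact: h.
Qed.

Lemma metric_smooth u v : smooth_on U (fun z => G z u v).
Proof. by have [_ h] := bG.1 v; exact: h. Qed.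

Lemma christoffel_trilinear : trilinear_family U (christoffel G).
Proof.
apply: trilinear_family_intro => [y v w Uy|y u w Uy|y u v Uy|u v w].
- apply: linear_scalef; apply: linear_addf; last apply: linear_oppf; first apply: linear_addf.
  + exact: dird_linear.
  + exact: dG_linear2.
  + by case: (bilinear_family_dG 0 0 w v Uy).
- apply: linear_scalef; apply: linear_addf; last apply: linear_oppf; first apply: linear_addf.
  + by case: (bilinear_family_dG 0 0 u w Uy).
  + exact: dird_linear.
  + exact: dG_linear2.
- apply: linear_scalef; apply: linear_addf; last apply: linear_oppf; first apply: linear_addf.
  + exact: dG_linear2.
  + by case: (bilinear_family_dG 0 0 v u Uy).
  + exact: dird_linear.
- apply: smooth_on_scale => //; apply: smooth_on_add => //; first apply: smooth_on_add => //.
  + exact: smooth_on_dird (metric_smooth _ _).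
  + exact: smooth_on_dird (metric_smooth _ _).
  + apply: (smooth_on_ext oU _ (smooth_on_scale (-1) oU (smooth_on_dird w (metric_smooth u v)))).
    by move=> y _; rewrite scaleN1r.
Qed.

Lemma J_linear y : U y -> linear (J y).
Proof. by move=> Uy; exact: lJ.1. Qed.

Lemma J_smooth v : smooth_on U (fun z => J z v).
Proof. exact: lJ.2. Qed.

Lemma dJ_linear y a : U y -> linear (fun v => dird (fun z => J z v) y a).
Proof.
by move=> Uy; have [h _] := linear_family_dird_fam oU lJ (smooth_on_cst U a); exact: h.
Qed.

Lemma ap_christoffel_trilinear : trilinear_family U (ap_christoffel G J).
Proof.
have tG := christoffel_trilinear.
apply: trilinear_family_intro => [y v w Uy|y u w Uy|y u v Uy|u v w].
- apply: linear_scalef; apply: linear_addf; first apply: linear_addf.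
  + exact: trilinear_family1 tG Uy.
  + exact: trilinear_family1 tG Uy.
  + apply: (linear_compf (bilinear_family1 _ bG Uy)); exact: dird_linear.
- apply: linear_scalef; apply: linear_addf; first apply: linear_addf.
  + exact: trilinear_family2 tG Uy.
  + exact: (linear_compf (trilinear_family2 _ _ tG Uy) (J_linear Uy)).
  + exact: (linear_compf (bilinear_family1 _ bG Uy) (dJ_linear _ Uy)).
- apply: linear_scalef; apply: linear_addf; first apply: linear_addf.
  + exact: trilinear_family3 tG Uy.
  + exact: (linear_compf (trilinear_family3 _ _ tG Uy) (J_linear Uy)).
  + exact: (linear_compf (bilinear_family2 _ bG Uy) (J_linear Uy)).
- apply: smooth_on_scale => //; apply: smooth_on_add => //; first apply: smooth_on_add => //.
  + exact: trilinear_family_smooth tG.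
  + exact: (trilinear_family_apply oU tG (smooth_on_cst U u) (J_smooth v) (J_smooth w)).
  + exact: (bilinear_family_apply oU bG (smooth_on_dird u (J_smooth v)) (J_smooth w)).
Qed.

Section Fields.
Variables (X Y Z : V -> V).
Hypotheses (sX : smooth_on U X) (sY : smooth_on U Y) (sZ : smooth_on U Z).

Definition local_bracket (X Y : V -> V) y : V := dird Y y (X y) - dird X y (Y y).

Definition local_koszul (X Y Z : V -> V) y : R :=
  2^-1 * (dird (fun z => G z (Y z) (Z z)) y (X y) + dird (fun z => G z (Z z) (X z)) y (Y y)
    - dird (fun z => G z (X z) (Y z)) y (Z y)
    - G y (X y) (local_bracket Y Z y) + G y (Y y) (local_bracket Z X y)
    + G y (Z y) (local_bracket X Y y)).

(** The Leibniz rule yields six terms in which a field is differentiated. The bracket terms cancel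
    all of them except <dY X, Z>, which they double. *)
Lemma local_koszulE y : U y ->
  local_koszul X Y Z y = christoffel G y (X y) (Y y) (Z y) + G y (dird Y y (X y)) (Z y).
Proof.
move=> Uy; rewrite /local_koszul /local_bracket /christoffel.
rewrite (bilinear_family_dird _ oU bG sY sZ Uy) (bilinear_family_dird _ oU bG sZ sX Uy).
rewrite (bilinear_family_dird _ oU bG sX sY Uy).
have G2 u := bilinear_family2 u bG Uy.
rewrite !(linear_sub (G2 _)).
rewrite [G y (dird Y y (X y)) (Z y)]symG [G y (dird Z y (Y y)) (X y)]symG.
rewrite [G y (dird X y (Z y)) (Y y)]symG.
by field.
Qed.

End Fields.

Hypothesis isoJ : forall y u v, U y -> G y (J y u) (J y v) = G y u v.

Definition local_ap_koszul (X Y Z : V -> V) y : R :=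
  2^-1 * (local_koszul X Y Z y + local_koszul X (fun z => J z (Y z)) (fun z => J z (Z z)) y).

(** The derivative of [J Y] is (dJ) Y + J dY. The first summand is the extra term of
    [ap_christoffel]; for the second, the isometry of [J] turns <J dY X, J Z> into <dY X, Z>, so
    that the two halves recombine. *)
Lemma local_ap_koszulE X Y Z y : smooth_on U X -> smooth_on U Y -> smooth_on U Z -> U y ->
  local_ap_koszul X Y Z y =
  ap_christoffel G J y (X y) (Y y) (Z y) + G y (dird Y y (X y)) (Z y).
Proof.
move=> sX sY sZ Uy; rewrite /local_ap_koszul /ap_christoffel.
have sJY := linear_family_apply oU lJ sY.
have sJZ := linear_family_apply oU lJ sZ.
rewrite !local_koszulE// (linear_family_dird _ oU lJ sY Uy).
by rewrite (linear_add (bilinear_family1 _ bG Uy)) isoJ//; field.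
Qed.

(** Metric compatibility. The plain half satisfies it by the formula of [christoffel]; for the half
    twisted by [J], the identity G (J v, J w) = G (v, w) is differentiated in the chart. *)
Lemma ap_christoffel_metric y u v w : U y ->
  dird (fun z => G z v w) y u = ap_christoffel G J y u v w + ap_christoffel G J y u w v.
Proof.
move=> Uy.
have E : dird (fun z => G z v w) y u = dird (fun z => G z (J z v) (J z w)) y u.
  have e z : U z -> G z v w = G z (J z v) (J z w) by move=> Uz; rewrite isoJ.
  rewrite -(open_eq_dird _ oU e Uy)//.
  exact: smooth_on_differentiable (metric_smooth v w) Uy.
move: E; rewrite (bilinear_family_dird _ oU bG (J_smooth v) (J_smooth w) Uy).
rewrite /ap_christoffel /christoffel.
have sd a b c : dird (fun z => G z a b) y c = dird (fun z => G z b a) y c.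
  by congr (dird _ _ _); apply/funext => z; exact: symG.
rewrite (sd w v u) (sd w u v) (sd v u w) (sd (J y w) (J y v) u).
rewrite (sd (J y w) u (J y v)) (sd (J y v) u (J y w)).
rewrite [G y (J y v) _]symG => E.
by rewrite E; field.
Qed.

End LocalGeometry.

(** * Charts, vector fields and metrics on a manifold *)

Section Manifold.
Context {R : realType} {M : charted_space R}.
Hypothesis hM : smooth_manifold M.
Local Notation n := (mdim M).
Local Notation V := 'rV[R]_n.
Implicit Types (p q r x : M) (y v : V).

Local Notation cm p := (cmap (chart_at p)).
Local Notation ci p := (cinv (chart_at p)).
Local Notation Om p := (chart_image (chart_at p)).
Local Notation D p := (cdom (chart_at p)).

Lemma chart_at_chart p : is_chart (chart_at p).
Proof. by have [_ _ /(_ p)[h _] _] := hM. Qed.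

Lemma chart_at_dom p : D p p.
Proof. by have [_ _ /(_ p)[_ h] _] := hM. Qed.

Lemma chart_dom_open p : open (D p).
Proof. by have [] := chart_at_chart p. Qed.

Lemma chart_image_open p : open (Om p).
Proof. by have [] := chart_at_chart p. Qed.

Lemma cinvK p x : D p x -> ci p (cm p x) = x.
Proof. by have [_ _ h _ _] := chart_at_chart p; exact: h. Qed.

Lemma cmap_image p x : D p x -> Om p (cm p x).
Proof. by move=> Dx; exists x. Qed.

Lemma cinv_dom p y : Om p y -> D p (ci p y).
Proof. by move=> [x Dx <-]; rewrite cinvK. Qed.

Lemma cmapK p y : Om p y -> cm p (ci p y) = y.
Proof. by move=> [x Dx <-]; rewrite cinvK. Qed.

Lemma cmap_continuous p x : D p x -> {for x, continuous (cm p)}.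
Proof. by have [_ _ _ h _] := chart_at_chart p; exact: h. Qed.

Lemma cinv_continuous p y : Om p y -> {for y, continuous (ci p)}.
Proof. by have [_ _ _ _ h] := chart_at_chart p; exact: h. Qed.

Definition overlap p q : set V := [set y | Om p y /\ D q (ci p y)].

Lemma in_overlap p q x : D p x -> D q x -> overlap p q (cm p x).
Proof. by move=> Dp Dq; split; [exact: cmap_image|rewrite cinvK]. Qed.

Lemma chart_preimage_open p (A : set M) : open A -> open [set y | Om p y /\ A (ci p y)].
Proof.
move=> oA; rewrite openE => y [Oy Ay]; rewrite /interior/=.
have h1 : nbhs y (Om p) by apply: open_nbhs_nbhs; split => //; exact: chart_image_open.
have h2 : nbhs y (ci p @^-1` A).
  by apply: (cinv_continuous Oy); apply: open_nbhs_nbhs; split.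
exact: (filterI h1 h2).
Qed.

Lemma overlap_open p q : open (overlap p q).
Proof. exact: chart_preimage_open (@chart_dom_open q). Qed.

Lemma chart_image_preimage_open p (A : set V) : open A -> open [set x | D p x /\ A (cm p x)].
Proof.
move=> oA; rewrite openE => x [Dx Ax]; rewrite /interior/=.
have h1 : nbhs x (D p) by apply: open_nbhs_nbhs; split => //; exact: chart_dom_open.
have h2 : nbhs x (cm p @^-1` A).
  by apply: (cmap_continuous Dx); apply: open_nbhs_nbhs; split.
exact: (filterI h1 h2).
Qed.

Definition transition p q : V -> V := cm q \o ci p.

Lemma transition_smooth p q : smooth_on (overlap p q) (transition p q).
Proof.
have [_ _ _ h] := hM; apply: smooth_on_sub (h p q) => y [Oy Dy].
by exists (ci p y); [split=> //; exact: cinv_dom|exact: cmapK].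
Qed.

Lemma transition_overlap p q y : overlap p q y -> overlap q p (transition p q y).
Proof.
move=> [Oy Dy]; split; first exact: cmap_image.
by rewrite /transition/= cinvK//; exact: cinv_dom.
Qed.

Lemma transition_cinv p q y : overlap p q y -> ci q (transition p q y) = ci p y.
Proof. by move=> [Oy Dy]; rewrite /transition/= cinvK. Qed.

Lemma transition_cmap p q x : D p x -> transition p q (cm p x) = cm q x.
Proof. by move=> Dx; rewrite /transition/= cinvK. Qed.

Lemma transition_diff p q x : D p x -> D q x -> differentiable (transition p q) (cm p x).
Proof.
move=> Dp Dq; exact: smooth_on_differentiable (transition_smooth p q) (in_overlap Dp Dq).
Qed.

(* Coordinates in chart q of the tangent vector at x with coordinates v in chart p. *)
Definition coord_change p q x v : V := dird (transition p q) (cm p x) v.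

Lemma tvecE p x v : tvec p x v = coord_change p x x v.
Proof. by rewrite /coord_change -dirdE. Qed.

Lemma tcoordE p x v : tcoord p x v = coord_change x p x v.
Proof. by rewrite /coord_change -dirdE. Qed.

Lemma coord_change_linear p q x : linear (coord_change p q x).
Proof. exact: dird_linear. Qed.

Lemma dird_transition (W : normedModType R) p q x v (U : set V) (h h' : V -> W) :
  D p x -> D q x -> differentiable h (cm q x) -> open U -> U (cm p x) ->
  (forall y, U y -> h (transition p q y) = h' y) ->
  dird h' (cm p x) v = dird h (cm q x) (coord_change p q x v).
Proof.
move=> Dp Dq dh oU Ux e.
have dt := transition_diff Dp Dq.
have dh' : differentiable h (transition p q (cm p x)) by rewrite transition_cmap.
have dc : differentiable (h \o transition p q) (cm p x) by exact: differentiable_comp.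
rewrite (open_eq_dird v oU e Ux dc) -[LHS]dirdE (diff_comp dt dh') /=.
by rewrite !dirdE transition_cmap.
Qed.

Lemma coord_change_comp p q r x v : D p x -> D q x -> D r x ->
  coord_change q r x (coord_change p q x v) = coord_change p r x v.
Proof.
move=> Dp Dq Dr; apply/esym.
apply: (@dird_transition _ p q x v (overlap p q)) => //.
- exact: transition_diff.
- exact: overlap_open.
- exact: in_overlap.
- by move=> y [Oy Dy]; rewrite /transition/= cinvK.
Qed.

Lemma coord_change_id p x v : D p x -> coord_change p p x v = v.
Proof.
move=> Dp; rewrite /coord_change.
have e y : Om p y -> id y = transition p p y by move=> Oy; rewrite /transition/= cmapK.
rewrite (open_eq_dird v (@chart_image_open p) e (cmap_image Dp)) -?dirdE.
  by rewrite diff_val.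
exact: ex_diff.
Qed.

Lemma coord_changeK p q x v : D p x -> D q x ->
  coord_change q p x (coord_change p q x v) = v.
Proof. by move=> Dp Dq; rewrite coord_change_comp// coord_change_id. Qed.

Lemma tcoord_tvec p x v : D p x -> tcoord p x (tvec p x v) = v.
Proof. by move=> Dp; rewrite tvecE tcoordE coord_changeK//; exact: chart_at_dom. Qed.

Lemma tvec_tcoord p x v : D p x -> tvec p x (tcoord p x v) = v.
Proof. by move=> Dp; rewrite tvecE tcoordE coord_changeK//; exact: chart_at_dom. Qed.

Lemma tcoord_id x v : tcoord x x v = v.
Proof. by rewrite tcoordE coord_change_id//; exact: chart_at_dom. Qed.

Lemma tvec_id x v : tvec x x v = v.
Proof. by rewrite tvecE coord_change_id//; exact: chart_at_dom. Qed.

Lemma tvec_linear p x : linear (@tvec R M p x).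
Proof. by move=> a u v; rewrite !tvecE coord_change_linear. Qed.

Lemma tcoord_linear p x : linear (@tcoord R M p x).
Proof. by move=> a u v; rewrite !tcoordE coord_change_linear. Qed.

Section Fields.
Implicit Types X Y Z : vfield M.

Lemma vfield_in_chartE X p x : D p x ->
  vfield_in_chart X p (cm p x) = tcoord p x (X x).
Proof. by move=> Dx; rewrite /vfield_in_chart cinvK. Qed.

Lemma vfield_in_chart_self X x : vfield_in_chart X x (cm x x) = X x.
Proof. by rewrite vfield_in_chartE ?tcoord_id//; exact: chart_at_dom. Qed.

Lemma vfield_in_chart_transition X p q y : overlap p q y ->
  vfield_in_chart X q (transition p q y) = dird (transition p q) y (vfield_in_chart X p y).
Proof.
move=> [Oy Dy]; have Dp := cinv_dom Oy.
rewrite /vfield_in_chart transition_cinv; last by split.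
rewrite !tcoordE -[y in dird _ y _](cmapK Oy) -/(coord_change p q (ci p y) _).
by rewrite coord_change_comp//; exact: chart_at_dom.
Qed.

Lemma vderiveE X (h : M -> R) p x : D p x ->
  differentiable (h \o ci p : V -> R^o) (cm p x) ->
  vderive X h x = dird (h \o ci p : V -> R^o) (cm p x) (vfield_in_chart X p (cm p x)).
Proof.
move=> Dx dh; rewrite /vderive vfield_in_chartE// tcoordE.
have Dxx := chart_at_dom x.
rewrite dirdE; apply: (dird_transition _ Dxx Dx dh (@overlap_open x p)).
- exact: in_overlap.
- by move=> y /transition_cinv /= e1; rewrite /= e1.
Qed.

Lemma smooth_fun_diff (h : M -> R) p x : smooth_fun h -> D p x ->
  differentiable (h \o ci p : V -> R^o) (cm p x).
Proof. by move=> sh Dx; exact: smooth_on_differentiable (sh p) (cmap_image Dx). Qed.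

(** The bracket is defined at each point in that point's own chart. Transported to a common chart,
    each derivative picks up a second derivative of the transition map; these are symmetric in [X]
    and [Y] and cancel in the difference. *)
Lemma lie_bracketE X Y p x : smooth_vfield X -> smooth_vfield Y -> D p x ->
  tcoord p x (lie_bracket X Y x) =
  local_bracket (vfield_in_chart X p) (vfield_in_chart Y p) (cm p x).
Proof.
move=> sX sY Dx; have Dxx := chart_at_dom x.
pose psi := transition x p; pose z0 := cm x x.
have Oz0 : overlap x p z0 by exact: in_overlap.
have oO := @overlap_open x p.
have spsi : smooth_on (overlap x p) psi := transition_smooth x p.
have key Z W : smooth_vfield Z -> smooth_vfield W ->
    dird (vfield_in_chart Z p) (cm p x) (vfield_in_chart W p (cm p x)) =
    dird (fun z => dird psi z (Z x)) z0 (W x)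
    + dird psi z0 (dird (vfield_in_chart Z x) z0 (W x)).
  move=> sZ sW.
  have dZ : differentiable (vfield_in_chart Z p) (cm p x).
    exact: smooth_on_differentiable (sZ p) (cmap_image Dx).
  have e1 z : overlap x p z -> (vfield_in_chart Z p \o transition x p) z =
      dird psi z (vfield_in_chart Z x z).
    exact: vfield_in_chart_transition.
  rewrite vfield_in_chartE// tcoordE.
  rewrite -(dird_transition _ Dxx Dx dZ oO Oz0 e1).
  have sZx : smooth_on (overlap x p) (vfield_in_chart Z x).
    by apply: smooth_on_sub (sZ x) => z [].
  rewrite (linear_family_dird _ oO (linear_family_dird_dir spsi) sZx Oz0).
  by rewrite vfield_in_chart_self.
rewrite /local_bracket (key _ _ sY sX) (key _ _ sX sY) tcoordE.
rewrite opprD addrACA -linear_sub; last exact: dird_linear.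
rewrite -[fun z => dird psi z (Y x)]/(fun z => dird psi z (Y x)).
have -> : dird (fun z => dird psi z (Y x)) z0 (X x) = dird (fun z => dird psi z (X x)) z0 (Y x).
  rewrite -!dirdE; have := diff_symmetric_row (Y x) (X x) oO spsi Oz0.
  by rewrite [dird]unlock; exact.
rewrite subrr add0r /coord_change; congr (dird _ _ _).
by rewrite /lie_bracket; congr (_ - _); exact: dirdE.
Qed.

End Fields.
End Manifold.

Section FieldsOnManifold.
Context {R : realType} {M : charted_space R}.
Hypothesis hM : smooth_manifold M.
Local Notation n := (mdim M).
Local Notation V := 'rV[R]_n.
Implicit Types (p q r x : M) (y v : V) (X Y Z : vfield M).

Local Notation cm p := (cmap (chart_at p)).
Local Notation ci p := (cinv (chart_at p)).
Local Notation Om p := (chart_image (chart_at p)).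
Local Notation D p := (cdom (chart_at p)).

Lemma smooth_vfield_combination (h : M -> R) Y Z : smooth_fun h ->
  smooth_vfield Y -> smooth_vfield Z -> smooth_vfield (fun q => h q *: Y q + Z q).
Proof.
move=> sh sY sZ p; have oO := chart_image_open hM (p := p).
apply: (smooth_on_ext oO (f := fun y => (h \o ci p) y *: vfield_in_chart Y p y
   + vfield_in_chart Z p y)) => [y Oy|].
  by rewrite /vfield_in_chart tcoord_linear.
apply: smooth_on_add => //; exact: smooth_on_scalev (sh p) (sY p).
Qed.

(** A closed ball in coordinates is compact, so its image is compact and, [M] being Hausdorff,
    closed in all of [M] and not merely in the chart. This is what allows a field supported there to
    be extended by zero. *)
Lemma closed_ball_chart_closed p (r : R) : 0 < r ->
  (forall y, `|cm p p - y| <= r -> Om p y) ->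
  closed [set x | D p x /\ `|cm p p - cm p x| <= r].
Proof.
move=> r0 hr.
have cb : compact (closed_ball_ (fun z => `|z|) (cm p p) r).
  apply: bounded_closed_compact; last exact: closed_closed_ball_.
  exists (`|cm p p| + r); split; first exact: num_real.
  move=> m hm y /= yr; apply: le_trans (ltW hm).
  by rewrite -[y in `|y|](subKr (cm p p)); apply: (le_trans (ler_normB _ _)); rewrite lerD2l.
have [hausM _ _ _] := hM.
apply: (compact_closed hausM).
rewrite (_ : [set x | _] = ci p @` closed_ball_ (fun z => `|z|) (cm p p) r).
  apply: continuous_compact => //; apply: continuous_in_subspaceT => y.
  by rewrite inE => /hr; exact: cinv_continuous.
apply/seteqP; split=> [x [Dx xr]|_ [y yr <-]].
  by exists (cm p x) => //; exact: cinvK.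
by split; [exact: (cinv_dom hM (hr _ yr))|rewrite (cmapK hM (hr _ yr))].
Qed.

(** A constant coordinate field times a bump function supported in the chart becomes a global field
    that is still constant near [p]. Global fields are required because forms are tested only on
    them. *)
Lemma vfield_extension p : exists (N : set V) (E : V -> vfield M),
  [/\ open N, N (cm p p), N `<=` Om p,
      forall v, smooth_vfield (E v) &
      forall v y, N y -> vfield_in_chart (E v) p y = v].
Proof.
have Oy0 : Om p (cm p p) by exact/cmap_image/chart_at_dom.
have [r r0 hr] : exists2 r : R, 0 < r & forall y, `|cm p p - y| <= r -> Om p y.
  have h : nbhs (cm p p) (Om p).
    by apply: open_nbhs_nbhs; split=> //; exact: chart_image_open.
  move/nbhs_normP: h => [e /= e0 he]; exists (e / 2); first by rewrite divr_gt0.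
  move=> y yr; apply: he; rewrite /ball_/=; apply: (le_lt_trans yr).
  by rewrite ltr_pdivrMr// ltr_pMr// ltr1n.
have [b [sb b1 bsupp]] := bump_exists (cm p p) r0.
pose K := [set x | D p x /\ `|cm p p - cm p x| <= r].
have cK : closed K by exact: closed_ball_chart_closed.
pose E v : vfield M := fun x => if `[< D p x >] then b (cm p x) *: tvec p x v else 0.
move: b1; rewrite /prop_near1 nbhsE => -[N' [oN' N'y0] hN'].
exists (N' `&` Om p), E; split.
- by apply: openI => //; exact: chart_image_open.
- by [].
- by move=> y [].
- move=> v q; apply: smooth_on_cover => y Oy.
  have [Dx|nDx] := pselect (D p (ci q y)).
    exists (overlap q p); first by split.
    have oO := @overlap_open _ _ hM q p; have oO' := @overlap_open _ _ hM p q.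
    have st := transition_smooth hM q p.
    apply: (smooth_on_ext oO (f := fun z => (b \o transition q p) z *:
       ((fun z' => dird (transition p q) z' v) \o transition q p) z)).
      move=> z [Oz Dz]; rewrite /vfield_in_chart /E asboolT//.
      rewrite (linear_scale _ _ (tcoord_linear _ _)); congr (_ *: _).
      rewrite tvecE// tcoordE// coord_change_comp//; try exact: chart_at_dom.
      exact: (cinv_dom hM Oz).
    apply: smooth_on_scalev => //.
      exact: (smooth_on_comp oO openT _ st sb).
    apply: (smooth_on_comp oO oO' _ st (smooth_on_dird _ (transition_smooth hM p q))).
    by move=> z; exact: transition_overlap.
  (* The support lies in the closed set [K], which a point outside the chart domain avoids together
     with a neighbourhood; there the field is zero. *)
  exists [set z | Om q z /\ (~` K) (ci q z)]; first by split=> // -[].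
  have oN : open [set z | Om q z /\ (~` K) (ci q z)].
    by apply: (chart_preimage_open hM); exact: closed_openC.
  apply: (smooth_on_ext oN (f := fun=> 0)) => [z [Oz Kz]|]; last exact: smooth_on_cst.
  rewrite /vfield_in_chart /E; case: asboolP => Dz; last first.
    by rewrite linear_zero//; exact: tcoord_linear.
  have -> : b (cm p (ci q z)) = 0.
    apply/eqP; apply: contra_notT Kz => /bsupp h; split=> //.
    by rewrite distrC.
  by rewrite scale0r linear_zero//; exact: tcoord_linear.
- move=> v y [N'y Oy]; rewrite /vfield_in_chart /E asboolT; last exact: (cinv_dom hM Oy).
  by rewrite (cmapK hM Oy) hN'// scale1r tcoord_tvec//; exact: (cinv_dom hM Oy).
Qed.

Lemma vfield_through p v : exists2 X, smooth_vfield X & X p = v.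
Proof.
have [N [E [oN Np NO sE hE]]] := vfield_extension p.
exists (E v) => //; rewrite -[LHS](vfield_in_chart_self hM); exact: hE.
Qed.

Section Forms.
Variable g : tensor02 M.

(** A form that is pointwise of the shape <u, .> is automatically linear over functions, so only
    smoothness of its values remains to be checked. *)
Lemma A_bullet_intro (w : one_form M) : singular_metric g ->
  (forall Y, smooth_vfield Y -> smooth_fun (w Y)) ->
  (forall p, exists u, represents g p u w) -> A_bullet g w.
Proof.
move=> [_ lg _] sw rw; split=> //; split=> // h Y Z sh sY sZ p.
have [u hu] := rw p.
rewrite hu; last exact: smooth_vfield_combination.
by rewrite hu// hu// lg.
Qed.

(** [xget] may return the value for another pair of representatives. It is the same value: every
    tangent vector is the value of a smooth field, so two representatives of a form pair equally
    with every vector. *)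
Lemma copairingE (w t : one_form M) p u v : singular_metric g ->
  represents g p u w -> represents g p v t -> copairing g w t p = g p u v.
Proof.
move=> [sg lg _] hu hv; rewrite /copairing; case: xgetP => [r -> [u' [v' [hu' hv' ->]]]|h].
  have -> : g p u' v' = g p u v'.
    have [X sX Xp] := vfield_through p v'.
    by rewrite -Xp -hu'// hu.
  rewrite sg [RHS]sg.
  have [X sX Xp] := vfield_through p u.
  by rewrite -Xp -hv'// hv.
by have := h (g p u v); case; exists u, v.
Qed.

End Forms.

End FieldsOnManifold.

Section LocalTensors.
Context {R : realType} {M : charted_space R}.
Local Notation V := 'rV[R]_(mdim M).

Definition local_metric (g : tensor02 M) (p : M) (y u v : V) : R^o :=
  let q := cinv (chart_at p) y in g q (tvec p q u) (tvec p q v).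

Definition local_tensor (J : tensor11 M) (p : M) (y v : V) : V :=
  let q := cinv (chart_at p) y in tcoord p q (J q (tvec p q v)).

End LocalTensors.

Section MetricInCharts.
Context {R : realType} {M : charted_space R}.
Hypothesis hM : smooth_manifold M.
Local Notation n := (mdim M).
Local Notation V := 'rV[R]_n.
Implicit Types (p q r x : M) (y u v w : V) (X Y Z : vfield M).

Local Notation cm p := (cmap (chart_at p)).
Local Notation ci p := (cinv (chart_at p)).
Local Notation Om p := (chart_image (chart_at p)).
Local Notation D p := (cdom (chart_at p)).

Variable g : tensor02 M.
Hypothesis hg : singular_metric g.
Local Notation G := (local_metric g).

Lemma local_metric_sym p y u v : G p y u v = G p y v u.
Proof. by have [sg _ _] := hg; exact: sg. Qed.

Lemma local_metric_bilinear p : bilinear_family (Om p) (G p).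
Proof.
have [sg lg smg] := hg.
have l2 y u : linear (G p y u).
  by move=> a v w; rewrite /local_metric tvec_linear lg.
split=> v; split=> [y _|u]; [|exact: smg|exact: l2|exact: smg].
move=> a u w; rewrite ![G p y _ v]local_metric_sym; exact: l2.
Qed.

Lemma local_metricE p x u v : D p x ->
  g x u v = G p (cm p x) (tcoord p x u) (tcoord p x v).
Proof. by move=> Dx; rewrite /local_metric (cinvK hM Dx) !tvec_tcoord. Qed.

Lemma local_metric_self p u v : G p (cm p p) u v = g p u v.
Proof.
by rewrite /local_metric (cinvK hM (chart_at_dom hM p)) !tvec_id.
Qed.

Lemma inner_in_chart X Y p y : Om p y ->
  inner g X Y (ci p y) = G p y (vfield_in_chart X p y) (vfield_in_chart Y p y).
Proof.
move=> Oy; rewrite /inner /local_metric /vfield_in_chart !tvec_tcoord//;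
  exact: (cinv_dom hM Oy).
Qed.

Lemma inner_smooth X Y : smooth_vfield X -> smooth_vfield Y -> smooth_fun (inner g X Y).
Proof.
move=> sX sY p; have oO := chart_image_open hM (p := p).
apply: (smooth_on_ext oO _ (bilinear_family_apply oO (local_metric_bilinear p) (sX p) (sY p))).
by move=> y Oy; rewrite -inner_in_chart.
Qed.

Lemma vderive_inner X Y Z p x : smooth_vfield X -> smooth_vfield Y -> D p x ->
  vderive Z (inner g X Y) x =
  dird (fun y => G p y (vfield_in_chart X p y) (vfield_in_chart Y p y)) (cm p x)
    (vfield_in_chart Z p (cm p x)).
Proof.
move=> sX sY Dx; have oO := chart_image_open hM (p := p).
rewrite (vderiveE hM _ Dx (smooth_fun_diff (inner_smooth sX sY) Dx)).
apply: (open_eq_dird _ oO _ (cmap_image Dx)).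
  by move=> y Oy; rewrite -inner_in_chart.
apply: smooth_on_differentiable (cmap_image Dx).
exact: bilinear_family_apply oO (local_metric_bilinear p) (sX p) (sY p).
Qed.

Lemma koszul_in_chart X Y Z p x : smooth_vfield X -> smooth_vfield Y -> smooth_vfield Z ->
  D p x -> koszul g X Y Z x =
  local_koszul (G p) (vfield_in_chart X p) (vfield_in_chart Y p) (vfield_in_chart Z p) (cm p x).
Proof.
move=> sX sY sZ Dx; rewrite /koszul /local_koszul.
rewrite (vderive_inner _ sY sZ Dx) (vderive_inner _ sZ sX Dx) (vderive_inner _ sX sY Dx).
rewrite /inner !(local_metricE _ _ Dx).
rewrite (lie_bracketE hM sY sZ Dx) (lie_bracketE hM sZ sX Dx) (lie_bracketE hM sX sY Dx).
by rewrite !(vfield_in_chartE hM _ Dx).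
Qed.

Lemma koszulE X Y Z p x : smooth_vfield X -> smooth_vfield Y -> smooth_vfield Z ->
  D p x -> koszul g X Y Z x =
  christoffel (G p) (cm p x) (vfield_in_chart X p (cm p x)) (vfield_in_chart Y p (cm p x))
    (vfield_in_chart Z p (cm p x)) +
  G p (cm p x) (dird (vfield_in_chart Y p) (cm p x) (vfield_in_chart X p (cm p x)))
    (vfield_in_chart Z p (cm p x)).
Proof.
move=> sX sY sZ Dx; have oO := chart_image_open hM (p := p).
rewrite (koszul_in_chart sX sY sZ Dx).
exact: (local_koszulE oO (local_metric_sym p) (local_metric_bilinear p) (sX p) (sY p) (sZ p)
  (cmap_image Dx)).
Qed.

Lemma local_form_smooth p X Y Z (A : V -> V -> V -> V -> R^o) : trilinear_family (Om p) A ->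
  smooth_vfield X -> smooth_vfield Y -> smooth_vfield Z ->
  smooth_on (Om p) (fun y => A y (vfield_in_chart X p y) (vfield_in_chart Y p y)
      (vfield_in_chart Z p y) +
    G p y (dird (vfield_in_chart Y p) y (vfield_in_chart X p y)) (vfield_in_chart Z p y)).
Proof.
move=> tA sX sY sZ; have oO := chart_image_open hM (p := p).
apply: smooth_on_add => //; first exact: trilinear_family_apply oO tA (sX p) (sY p) (sZ p).
apply: (bilinear_family_apply oO (local_metric_bilinear p) _ (sZ p)).
exact: (smooth_on_dird_along oO (sY p) (sX p)).
Qed.

Lemma koszul_smooth X Y Z : smooth_vfield X -> smooth_vfield Y -> smooth_vfield Z ->
  smooth_fun (koszul g X Y Z).
Proof.
move=> sX sY sZ p; have oO := chart_image_open hM (p := p).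
have tG := christoffel_trilinear oO (local_metric_bilinear p).
apply: (smooth_on_ext oO _ (local_form_smooth tG sX sY sZ)) => y Oy.
have Dy := cinv_dom hM Oy.
by rewrite /= (koszulE sX sY sZ Dy) (cmapK hM Oy).
Qed.

Variable J : tensor11 M.
Hypothesis hJ : almost_product_structure g J.
Local Notation Jl := (local_tensor J).

Lemma local_tensor_linear p : linear_family (Om p) (Jl p).
Proof.
have [lJ sJ _ _] := hJ; split=> [y _ a u v|v]; last exact: sJ.
by rewrite /local_tensor tvec_linear lJ tcoord_linear.
Qed.

Lemma local_tensorK p y v : Om p y -> Jl p y (Jl p y v) = v.
Proof.
move=> Oy; have Dy := cinv_dom hM Oy; have [_ _ JJ _] := hJ.
by rewrite /local_tensor (tvec_tcoord hM) // JJ tcoord_tvec.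
Qed.

Lemma local_tensor_iso p y u v : Om p y -> G p y (Jl p y u) (Jl p y v) = G p y u v.
Proof.
move=> Oy; have Dy := cinv_dom hM Oy; have [_ _ _ iJ] := hJ.
by rewrite /local_metric /local_tensor !(tvec_tcoord hM) // iJ.
Qed.

Lemma tapply_in_chart X p y : Om p y ->
  vfield_in_chart (tapply J X) p y = Jl p y (vfield_in_chart X p y).
Proof.
move=> Oy; have Dy := cinv_dom hM Oy.
by rewrite /local_tensor /vfield_in_chart /tapply (tvec_tcoord hM).
Qed.

Lemma tapply_smooth X : smooth_vfield X -> smooth_vfield (tapply J X).
Proof.
move=> sX p; have oO := chart_image_open hM (p := p).
apply: (smooth_on_ext oO _ (linear_family_apply oO (local_tensor_linear p) (sX p))).
by move=> y Oy; rewrite tapply_in_chart.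
Qed.

(** The chart expression of [tapply J Y] matches [Jl] applied to that of [Y] only on the chart
    image; the explicit formula, made of values and first derivatives at a point of this open set,
    does not see the rest. *)
Lemma local_koszul_ext p (X Y Z X' Y' Z' : V -> V) y : Om p y ->
  smooth_on (Om p) X -> smooth_on (Om p) Y -> smooth_on (Om p) Z ->
  (forall z, Om p z -> X z = X' z) -> (forall z, Om p z -> Y z = Y' z) ->
  (forall z, Om p z -> Z z = Z' z) ->
  local_koszul (G p) X Y Z y = local_koszul (G p) X' Y' Z' y.
Proof.
move=> Oy sX sY sZ eX eY eZ; have oO := chart_image_open hM (p := p).
have sX' := smooth_on_ext oO eX sX; have sY' := smooth_on_ext oO eY sY.
have sZ' := smooth_on_ext oO eZ sZ.
have sG := local_metric_sym p; have bG := local_metric_bilinear p.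
rewrite (local_koszulE oO sG bG sX sY sZ Oy) (local_koszulE oO sG bG sX' sY' sZ' Oy).
rewrite -(eX _ Oy) -(eY _ Oy) -(eZ _ Oy) -(open_eq_dird (X y) oO eY Oy)//.
exact: smooth_on_differentiable sY Oy.
Qed.

Lemma ap_koszulE X Y Z p x : smooth_vfield X -> smooth_vfield Y -> smooth_vfield Z ->
  D p x -> ap_koszul g J X Y Z x =
  ap_christoffel (G p) (Jl p) (cm p x) (vfield_in_chart X p (cm p x))
    (vfield_in_chart Y p (cm p x)) (vfield_in_chart Z p (cm p x)) +
  G p (cm p x) (dird (vfield_in_chart Y p) (cm p x) (vfield_in_chart X p (cm p x)))
    (vfield_in_chart Z p (cm p x)).
Proof.
move=> sX sY sZ Dx; have oO := chart_image_open hM (p := p).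
have sG := local_metric_sym p; have bG := local_metric_bilinear p.
have Ox := cmap_image Dx.
rewrite -(local_ap_koszulE oO sG bG (local_tensor_linear p)
  (@local_tensor_iso p) (sX p) (sY p) (sZ p) Ox).
rewrite /ap_koszul /local_ap_koszul (koszul_in_chart sX sY sZ Dx).
rewrite (koszul_in_chart sX (tapply_smooth sY) (tapply_smooth sZ) Dx).
congr (_ * (_ + _)).
by apply: local_koszul_ext => //; do ?[exact: sX|exact: tapply_smooth];
  move=> z Oz; rewrite tapply_in_chart.
Qed.

Lemma ap_koszul_smooth X Y Z : smooth_vfield X -> smooth_vfield Y -> smooth_vfield Z ->
  smooth_fun (ap_koszul g J X Y Z).
Proof.
move=> sX sY sZ p; have oO := chart_image_open hM (p := p).
have tG := ap_christoffel_trilinear oO (local_metric_bilinear p) (local_tensor_linear p).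
apply: (smooth_on_ext oO _ (local_form_smooth tG sX sY sZ)) => y Oy.
have Dy := cinv_dom hM Oy.
by rewrite /= (ap_koszulE sX sY sZ Dy) (cmapK hM Oy).
Qed.

End MetricInCharts.

(** * Signatures *)

Section PosIndex.
Context {R : realType}.

Definition positive_on n (b : 'rV[R]_n -> 'rV[R]_n -> R) m (V : 'M[R]_(m, n)) :=
  forall v : 'rV[R]_n, (v <= V)%MS -> v != 0 -> 0 < b v v.

Lemma rank_le_pos_index n (b : 'rV[R]_n -> 'rV[R]_n -> R) m (V : 'M[R]_(m, n)) :
  positive_on b V -> (\rank V <= pos_index b)%N.
Proof.
move=> pV; have rn : (\rank V < n.+1)%N by rewrite ltnS rank_leq_col.
apply: (@leq_bigmax_cond _ _ (fun k : 'I_n.+1 => nat_of_ord k) (Ordinal rn)).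
apply/asboolP; exists <<V>>%MS; split; first by rewrite mxrank_gen.
by move=> v; rewrite genmxE; exact: pV.
Qed.

Lemma pos_index_witness n (b : 'rV[R]_n -> 'rV[R]_n -> R) :
  exists2 V : 'M[R]_n, \rank V = pos_index b & positive_on b V.
Proof.
pose P (k : 'I_n.+1) := `[< exists V : 'M[R]_n, \rank V = k /\ positive_on b V >].
have P0 : P ord0.
  apply/asboolP; exists 0; split; first by rewrite mxrank0.
  by move=> v; rewrite submx0 => ->.
have [|k Pk e] := @eq_bigmax_cond _ P (fun k : 'I_n.+1 => nat_of_ord k).
  by apply/card_gt0P; exists ord0.
by move/asboolP: Pk => [V [rV pV]]; exists V => //; rewrite rV /pos_index -e.
Qed.

Lemma pos_index_le n (b : 'rV[R]_n -> 'rV[R]_n -> R) : (pos_index b <= n)%N.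
Proof. by have [V <- _] := pos_index_witness b; exact: rank_leq_col. Qed.

(** A vector of a positive subspace killed by [L] would have square [b' 0 0 = 0], so [L] is
    injective there and the image is a positive subspace of the same rank. *)
Lemma pos_index_transfer n m (b : 'rV[R]_n -> 'rV[R]_n -> R)
    (b' : 'rV[R]_m -> 'rV[R]_m -> R) (L : 'rV[R]_n -> 'rV[R]_m) k (V : 'M[R]_(k, n)) :
  linear L -> b' 0 0 = 0 -> (forall v, b v v = b' (L v) (L v)) ->
  positive_on b V -> (\rank V <= pos_index b')%N.
Proof.
move=> lL b0 e pV.
pose LL : {linear _ -> _} := HB.pack L (GRing.isLinear.Build _ _ _ _ _ lL).
pose A := lin1_mx LL.
have LA v : L v = v *m A by rewrite mul_rV_lin1.
have cap0 : \rank (V :&: kermx A)%MS = 0%N.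
  apply/eqP; rewrite mxrank_eq0; apply/rowV0P => v; rewrite sub_capmx => /andP[vV].
  rewrite sub_kermx => /eqP vA; apply/eqP; apply: contraT => v0.
  by have := pV v vV v0; rewrite e LA vA b0 ltxx.
have <- : \rank (V *m A) = \rank V by rewrite -[RHS](mxrank_mul_ker V A) cap0 addn0.
apply: rank_le_pos_index => _ /submxP[w ->]; rewrite mulmxA -LA => wV0.
rewrite -e; apply: pV; first exact: submxMl.
by apply: contraNneq wV0 => ->; rewrite linear_zero.
Qed.

Lemma pos_index_scale n (b : 'rV[R]_n -> 'rV[R]_n -> R) (c : R) : 0 < c ->
  pos_index (fun u v => c * b u v) = pos_index b.
Proof.
move=> c0; apply/eqP; rewrite eqn_leq; apply/andP; split.
  have [V <- pV] := pos_index_witness (fun u v => c * b u v).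
  by apply: rank_le_pos_index => v vV v0; rewrite -(pmulr_rgt0 _ c0); exact: pV.
have [V <- pV] := pos_index_witness b.
by apply: rank_le_pos_index => v vV v0; rewrite pmulr_rgt0//; exact: pV.
Qed.

(** A vector with positive square is nonzero and, by homogeneity, spans a positive line. *)
Lemma pos_index_eq0 n (b : 'rV[R]_n -> 'rV[R]_n -> R) v :
  (forall a, b (a *: v) (a *: v) = a ^+ 2 * b v v) -> pos_index b = 0%N -> b v v <= 0.
Proof.
move=> hb pb0; rewrite leNgt; apply/negP => bv.
have v0 : v != 0.
  apply: contraTneq bv => v0; have := hb 0; rewrite scale0r -v0 => ->.
  by rewrite expr0n mul0r ltxx.
have : (\rank v <= pos_index b)%N.
  apply: rank_le_pos_index => w /sub_rVP[a ->] av0; rewrite hb mulr_gt0//.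
  by rewrite exprn_even_gt0//=; apply: contraNneq av0 => ->; rewrite scale0r.
by rewrite pb0 rank_rV v0.
Qed.

Section Symmetric.
Context {n : nat} (b : 'rV[R]_n -> 'rV[R]_n -> R^o).
Hypotheses (sb : forall u v, b u v = b v u) (lb : forall u, linear (b u)).

(* The orthogonal of a maximal positive subspace. *)
Lemma nonpositive_complement :
  exists2 N : 'M[R]_n, (n <= \rank N + pos_index b)%N &
    forall v : 'rV[R]_n, (v <= N)%MS -> b v v <= 0.
Proof.
have [V rV pV] := pos_index_witness b.
(* Right multiplication by [S] pairs a vector with the rows of [V], so [kermx S] is the orthogonal
   of [V]. Since [S] factors through the transpose of [V], its rank is at most that of [V]. *)
pose S : 'M[R]_n := \matrix_(i, j) b 'e_i (row j V).
have bS u j : (u *m S) 0 j = b u (row j V).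
  rewrite mxE sb {2}(rV_sum u) linear_sum_prop//; apply: eq_bigr => i _.
  by rewrite mxE linear_scale// sb.
have bV u w : u *m S = 0 -> (w <= V)%MS -> b u w = 0.
  move=> uS /submxP[a ->]; rewrite mulmx_sum_row linear_sum_prop// big1// => j _.
  by rewrite linear_scale// -bS uS mxE scaler0.
have linl u : linear (fun w => b w u : R^o) by move=> a v w; rewrite ![b _ u]sb lb.
have rS : (\rank S <= \rank V)%N.
  pose T : 'M[R]_n := \matrix_(i, j) b 'e_i 'e_j.
  have -> : S = T *m V^T.
    apply/matrixP => i j; rewrite !mxE (rV_sum (row j V)) linear_sum_prop//.
    by apply: eq_bigr => l _; rewrite linear_scale// !mxE mulrC.
  by apply: leq_trans (mxrankM_maxr _ _) _; rewrite mxrank_tr.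
exists (kermx S) => [|v]; first by rewrite mxrank_ker -rV addnC -leq_subLR leq_sub2l.
rewrite sub_kermx => /eqP vS; rewrite leNgt; apply/negP => bv.
have vV : ~~ (v <= V)%MS by apply: contraTN bv => /(bV v v vS) ->; rewrite ltxx.
(* A vector orthogonal to [V] with positive square would make [V + v] positive, against the
   maximality of [\rank V]. *)
have : (\rank (V + v)%MS <= pos_index b)%N.
  apply: rank_le_pos_index => w /sub_addsmxP[[a c]] /= -> w0.
  set x := a *m V in w0 *; have xV : (x <= V)%MS by exact: submxMl.
  rewrite [c]mx11_scalar mul_scalar_mx in w0 *; set t := c 0 0 in w0 *.
  have -> : b (x + t *: v) (x + t *: v) = b x x + t ^+ 2 * b v v.
    rewrite linear_add// !(linear_add (linl _)) !(linear_scale _ _ (lb _)).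
    rewrite !(linear_scale _ _ (linl _)) [b x v]sb !(bV v x vS xV) !scaler0 addr0 add0r.
    by rewrite expr2 -mulrA.
  have [t0|t0] := eqVneq t 0.
    by rewrite t0 expr0n mul0r addr0; apply: pV => //; move: w0; rewrite t0 scale0r addr0.
  apply: ltr_wpDl; last by rewrite mulr_gt0// exprn_even_gt0.
  have [->|x0] := eqVneq x 0; first by rewrite linear_zero.
  exact/ltW/pV.
have : (V < V + v)%MS.
  by rewrite /ltmx addsmxSl addsmx_sub submx_refl.
rewrite ltmxErank => /andP[_]; rewrite rV => h1 h2.
by move: (leq_trans h1 h2); rewrite ltnn.
Qed.

End Symmetric.

Section DirectSum.
Context {n1 n2 : nat} (b1 : 'rV[R]_n1 -> 'rV[R]_n1 -> R^o) (b2 : 'rV[R]_n2 -> 'rV[R]_n2 -> R^o).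
Hypotheses (sb1 : forall u v, b1 u v = b1 v u) (lb1 : forall u, linear (b1 u)).
Hypotheses (sb2 : forall u v, b2 u v = b2 v u) (lb2 : forall u, linear (b2 u)).

Definition sum_form (u v : 'rV[R]_(n1 + n2)) : R :=
  b1 (lsubmx u) (lsubmx v) + b2 (rsubmx u) (rsubmx v).

Lemma sub_block_diag (V1 : 'M[R]_n1) (V2 : 'M[R]_n2) (v : 'rV[R]_(n1 + n2)) :
  (v <= block_mx V1 0 0 V2)%MS -> (lsubmx v <= V1)%MS /\ (rsubmx v <= V2)%MS.
Proof.
move=> /submxP[w ->]; rewrite -[w]hsubmxK mul_row_block !mulmx0 addr0 add0r.
by rewrite row_mxKl row_mxKr !submxMl.
Qed.

(** A block sum of positive subspaces is positive, which gives one inequality. For the other, a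
    positive subspace meets the block sum of the two nonpositive complements only in zero, and
    counting dimensions bounds its rank. *)
Lemma pos_index_sum : pos_index sum_form = (pos_index b1 + pos_index b2)%N.
Proof.
apply/eqP; rewrite eqn_leq; apply/andP; split; last first.
  have [V1 r1 p1] := pos_index_witness b1; have [V2 r2 p2] := pos_index_witness b2.
  rewrite -r1 -r2 -rank_diag_block_mx; apply: rank_le_pos_index => v /sub_block_diag[h1 h2] v0.
  rewrite /sum_form.
  have ge1 : 0 <= b1 (lsubmx v) (lsubmx v).
    have [->|x0] := eqVneq (lsubmx v) 0; first by rewrite linear_zero.
    exact/ltW/p1.
  have [r0|r0] := eqVneq (rsubmx v) 0.
    rewrite r0 [b2 0 0]linear_zero// addr0; apply: p1 => //.
    by apply: contraNneq v0 => l0; rewrite -[v]hsubmxK l0 r0 row_mx0.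
  by apply: ltr_wpDl => //; exact: p2.
have [W rW pW] := pos_index_witness sum_form.
have [N1 r1 p1] := nonpositive_complement sb1 lb1.
have [N2 r2 p2] := nonpositive_complement sb2 lb2.
pose N := block_mx N1 0 0 N2.
have cap0 : \rank (W :&: N)%MS = 0%N.
  apply/eqP; rewrite mxrank_eq0; apply/rowV0P => v; rewrite sub_capmx => /andP[vW vN].
  apply/eqP; apply: contraT => v0; have := pW v vW v0.
  have [h1 h2] := sub_block_diag vN.
  by rewrite ltNge /sum_form; have := lerD (p1 _ h1) (p2 _ h2); rewrite addr0 => ->.
have := mxrank_sum_cap W N; rewrite cap0 addn0 => e.
have := rank_leq_col (W + N)%MS; rewrite e rW rank_diag_block_mx => h.
rewrite -(leq_add2r (\rank N1 + \rank N2)); apply: (leq_trans h).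
by rewrite addnACA [(pos_index b1 + _)%N]addnC [(pos_index b2 + _)%N]addnC leq_add.
Qed.

End DirectSum.
End PosIndex.

(** * Positivity on a fixed subspace is an open condition *)

Section PositivityNear.
Context {R : realType} {n : nat}.
Local Notation V := 'rV[R]_n.

Lemma unit_sphere_compact k : compact [set a : 'rV[R]_k | `|a| = 1].
Proof.
apply: bounded_closed_compact.
  exists 1; split; first exact: num_real.
  by move=> m hm a /= ->; exact: ltW.
rewrite (_ : [set a | _] = (fun a : 'rV[R]_k => `|a|) @^-1` [set 1])//.
apply: (preimage_closed _ (@closed_eq _ 1)) => a _.
exact: norm_continuous.
Qed.

Lemma continuous_sum_at (I : Type) (s : seq I) (F : I -> V -> R^o) (y0 : V) :
  (forall i, {for y0, continuous (F i)}) ->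
  {for y0, continuous (fun y => \sum_(i <- s) F i y : R^o)}.
Proof.
move=> cF; elim: s => [|i s IH].
  rewrite (_ : (fun y => _) = cst (0 : R^o)); first exact: cst_continuous.
  by apply/funext => y; rewrite big_nil.
rewrite (_ : (fun y => _) = (F i \+ (fun y => \sum_(i <- s) F i y))).
  by apply: continuousD; [exact: cF|exact: IH].
by apply/funext => y; rewrite big_cons.
Qed.

Lemma quadratic_sum (k : nat) (b : V -> V -> R^o) (B : 'M[R]_(k, n)) (a : 'rV[R]_k) :
  (forall v, linear (fun u => b u v : R^o)) -> (forall u, linear (b u)) ->
  b (a *m B) (a *m B) = \sum_i \sum_j a 0 i * a 0 j * b (row i B) (row j B).
Proof.
move=> l1 l2; rewrite {1}mulmx_sum_row (linear_sum_prop _ _ (l1 _)).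
apply: eq_bigr => i _; rewrite (linear_scale _ _ (l1 _)).
rewrite mulmx_sum_row (linear_sum_prop _ _ (l2 _)) scaler_sumr; apply: eq_bigr => j _.
by rewrite (linear_scale _ _ (l2 _)) scalerA.
Qed.

(** On the compact unit sphere of coordinates in a basis of [W] the quadratic form of [G y0] has a
    positive minimum. For [y] near [y0] the form changes by less than this minimum on the sphere,
    and homogeneity extends positivity to [W]. *)
Lemma positive_on_near (U : set V) (G : V -> V -> V -> R^o) (y0 : V) k (W : 'M[R]_(k, n)) :
  open U -> bilinear_family U G -> U y0 -> positive_on (G y0) W ->
  \forall y \near y0, positive_on (G y) W.
Proof.
move=> oU bG Uy0 pW.
have l1 y v : U y -> linear (fun u => G y u v : R^o) by move=> Uy; exact: bilinear_family1 bG Uy.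
have l2 y u : U y -> linear (G y u) by move=> Uy; exact: bilinear_family2 bG Uy.
pose B := row_base W; pose r := \rank W.
have rowE v : (v <= W)%MS -> v != 0 -> exists2 a : 'rV[R]_r, a != 0 & v = a *m B.
  move=> vW v0; have /submxP[a e] : (v <= B)%MS by rewrite eq_row_base.
  by exists a => //; apply: contraNneq v0 => a0; rewrite e a0 mul0mx.
have BW (a : 'rV[R]_r) : (a *m B <= W)%MS.
  by rewrite (submx_trans (submxMl _ _))// eq_row_base.
have Binj (a : 'rV[R]_r) : a != 0 -> a *m B != 0.
  by rewrite (mulmx_free_eq0 _ (row_base_free W)).
(* In rank zero the sphere is empty and the extreme value theorem has nothing to act on. *)
have [r0|rpos] := posnP r.
  have : \forall y \near y0, U y by apply: open_nbhs_nbhs.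
  apply: filterS => y Uy v vW.
  by have := mxrankS vW; rewrite -/r r0 leqn0 mxrank_eq0 => ->.
pose S := [set a : 'rV[R]_r | `|a| = 1].
have S0 : S !=set0.
  pose i0 : 'I_r := Ordinal rpos; pose e : 'rV[R]_r := 'e_i0.
  have e0 : `|e| != 0.
    by rewrite normr_eq0; apply/eqP => /rowP /(_ i0); rewrite !mxE !eqxx => /eqP; rewrite oner_eq0.
  by exists (`|e|^-1 *: e); rewrite /S/= normrZ normfV normr_id mulVf.
pose q (a : 'rV[R]_r) : R := G y0 (a *m B) (a *m B).
have qE a : q a = \sum_i \sum_j a 0 i * a 0 j * G y0 (row i B) (row j B).
  by apply: quadratic_sum => ?; [exact: l1|exact: l2].
have cq : continuous q.
  have sq : smooth_on setT (q : 'rV[R]_r -> R^o).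
    apply: (smooth_on_ext openT (f := fun a : 'rV[R]_r =>
      \sum_i \sum_j a 0 i * a 0 j * G y0 (row i B) (row j B) : R^o)) => [a _|].
      by rewrite qE.
    have sc j : smooth_on setT (fun a : 'rV[R]_r => a 0 j : R^o).
      exact: (linear_smooth_on (@coord_linear R r j) (@coord_cont R r j)).
    apply: smooth_on_sum => [|i _]; first exact: openT.
    apply: smooth_on_sum => [|j _]; first exact: openT.
    apply: (smooth_on_mul openT); last exact: smooth_on_cst.
    exact: (smooth_on_mul openT (sc i) (sc j)).
  by move=> a; exact: smooth_on_continuous sq _.
have [c cS cmin] : exists2 c, c \in S & forall t, t \in S -> q c <= q t.
  apply: (EVT_min_rV S0 (@unit_sphere_compact r)).
  exact: continuous_subspaceT.
have nz a : S a -> a != 0.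
  by rewrite /S/= => a1; rewrite -normr_eq0 a1 oner_neq0.
have qc0 : 0 < q c by apply: pW; [exact: BW|apply/Binj/nz; rewrite inE in cS].
pose del y : R^o := \sum_i \sum_j `|G y (row i B) (row j B) - G y0 (row i B) (row j B)|.
(* On the unit sphere, [`|G y (t, t) - G y0 (t, t)| <= del y]. *)
have : \forall y \near y0, del y < q c.
  have cd : {for y0, continuous del}.
    have cG i j : {for y0, continuous (fun y : V => `|G y (row i B) (row j B) -
         G y0 (row i B) (row j B)| : R^o)}.
      apply: (@continuous_comp _ _ _ _ (fun t : R^o => `|t|)); last exact: norm_continuous.
      apply: continuousB; last exact: cst_continuous.
      by have [_ s] := bG.1 (row j B); exact: smooth_on_continuous (s _) Uy0.
    by apply: continuous_sum_at => i; exact: continuous_sum_at.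
  have d0 : del y0 < q c.
    by rewrite /del big1// => i _; rewrite big1// => j _; rewrite subrr normr0.
  by apply: (cd [set z : R | z < q c]); apply: open_nbhs_nbhs; split => //; exact: open_lt.
have : \forall y \near y0, U y by apply: open_nbhs_nbhs.
apply: filterS2 => y Uy dy v vW v0.
have [a a0 ->] := rowE v vW v0.
have na0 : `|a| != 0 by rewrite normr_eq0.
have -> : a = `|a| *: (`|a|^-1 *: a) by rewrite scalerA divff// scale1r.
set t := _ *: a.
have St : S t by rewrite /S/= /t normrZ normfV normr_id mulVf.
rewrite -scalemxAl (linear_scale _ _ (l2 _ _ Uy)) (linear_scale _ _ (l1 _ _ Uy)).
rewrite pmulr_rgt0 ?normr_gt0// pmulr_rgt0 ?normr_gt0//.
have h : `|G y (t *m B) (t *m B) - q t| <= del y.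
  rewrite qE quadratic_sum; [|by move=> ?; exact: l1|by move=> ?; exact: l2].
  rewrite -sumrB; apply: (le_trans (ler_norm_sum _ _ _)); apply: ler_sum => i _.
  rewrite -sumrB; apply: (le_trans (ler_norm_sum _ _ _)); apply: ler_sum => j _.
  rewrite -mulrBr normrM ler_piMl// normrM.
  have t1 l : `|t 0 l| <= 1.
    rewrite -[X in _ <= X]St [leRHS]/Num.Def.normr/= mx_normrE.
    exact: (le_bigmax _ (fun ij : 'I_1 * 'I_r => `|t ij.1 ij.2|) (0, l)).
  by rewrite mulr_ile1.
have : q c <= q t by apply: cmin; rewrite inE.
move: h; rewrite ler_norml => /andP[h _] h2.
rewrite -(ltrD2r (- q t)) sub0r; apply: lt_le_trans h; rewrite ltrN2.
exact: lt_le_trans h2.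
Qed.

End PositivityNear.

(** * Semicontinuity of the indices and density of the constant signature region *)

Section ConstantSignature.
Context {R : realType} {M : charted_space R}.
Hypothesis hM : smooth_manifold M.

(** A maximal positive subspace at [p], read in the chart of [p], stays positive at nearby points;
    [tvec] carries it to the tangent space at [q]. *)
Lemma pos_index_semicontinuous (g : tensor02 M) (p : M) : singular_metric g ->
  \forall q \near p, (pos_index (g p) <= pos_index (g q))%N.
Proof.
move=> hg; have [W rW pW] := pos_index_witness (g p).
have Dp := chart_at_dom hM p; have Op := cmap_image Dp.
have oO := chart_image_open hM (p := p).
have bG := local_metric_bilinear hg p.
have pW' : positive_on (local_metric g p (cmap (chart_at p) p)) W.
  by move=> v vW v0; rewrite local_metric_self//; exact: pW.
have h1 : \forall q \near p, positive_on (local_metric g p (cmap (chart_at p) q)) W.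
  exact: (cmap_continuous hM Dp (positive_on_near oO bG Op pW')).
have h2 : \forall q \near p, cdom (chart_at p) q.
  by apply: open_nbhs_nbhs; split=> //; exact: chart_dom_open.
near=> q; rewrite -rW.
have Dq : cdom (chart_at p) q by near: q.
have pq : positive_on (local_metric g p (cmap (chart_at p) q)) W by near: q.
apply: (pos_index_transfer (L := tvec p q) _ _ _ pq).
- exact: tvec_linear.
- by have [_ lg _] := hg; rewrite linear_zero//; exact: lg.
- by move=> v; rewrite /local_metric (cinvK hM Dq).
Unshelve. all: by end_near. Qed.

Lemma singular_metric_opp (g : tensor02 M) : singular_metric g ->
  singular_metric (fun p u v => - g p u v).
Proof.
move=> [sg lg smg]; split=> [p u v|p u|p u v].
- by rewrite sg.
- exact: linear_oppf.
- have oO := chart_image_open hM (p := p).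
  apply: (smooth_on_ext oO _ (smooth_on_scale (-1) oO (smg p u v))) => y Oy.
  by rewrite scaleN1r.
Qed.

Lemma constant_signature_dense (g : tensor02 M) (A : set M) (x : M) : singular_metric g ->
  open A -> A x -> exists2 p, A p & constant_signature_region g p.
Proof.
move=> hg oA Ax; pose s q := (pos_index (g q) + pos_index (fun u v => - g q u v))%N.
pose P k := `[< exists2 q, A q & s q = k >].
have exP : exists k, P k by exists (s x); apply/asboolP; exists x.
have boundP k : P k -> (k <= mdim M + mdim M)%N.
  by move=> /asboolP[q _ <-]; rewrite leq_add ?pos_index_le.
have [k /asboolP[p Ap <-] kmax] := ex_maxnP exP boundP.
exists p => //; rewrite /constant_signature_region/=.
have h1 := pos_index_semicontinuous p hg.
have h2 := pos_index_semicontinuous p (singular_metric_opp hg).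
have h3 : \forall q \near p, A q by apply: open_nbhs_nbhs.
near=> q; rewrite /form_signature.
have e1 : (pos_index (g p) <= pos_index (g q))%N by near: q.
have e2 : (pos_index (fun u v => (- g p u v)%R) <= pos_index (fun u v => (- g q u v)%R))%N by near: q.
have e3 : (s q <= s p)%N.
  by apply: kmax; apply/asboolP; exists q => //; near: q.
by congr (_, _); rewrite /s in e3; lia.
Unshelve. all: by end_near. Qed.

End ConstantSignature.

(** * The covariant derivative of forms in coordinates *)

Section LocalFlat.
Context {R : realType} {n : nat}.
Local Notation V := 'rV[R]_n.

Definition local_flat (G : V -> V -> V -> R^o) (J : V -> V -> V) (X Y : V -> V) (y v : V) : R^o :=
  ap_christoffel G J y (X y) (Y y) v + G y (dird Y y (X y)) v.

(** Multilinear extension of coefficients, with [i], [j], [k], [l] for [z], [w], [x], [v]. The sum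
    over [j] is innermost so that, for fixed [i], [k], [l], a 1-form in [w] remains, the unit for
    which representability is proved. *)
Definition quad_sum (c : 'I_n -> 'I_n -> 'I_n -> 'I_n -> R) (z w x v : V) : R^o :=
  \sum_i \sum_k \sum_l (z 0 i * x 0 k * v 0 l) * \sum_j w 0 j * c i j k l.

Lemma trilinear_expand (f : V -> V -> V -> R^o) z x v :
  (forall x v, linear (fun z => f z x v)) -> (forall z v, linear (fun x => f z x v)) ->
  (forall z x, linear (f z x)) ->
  f z x v = \sum_i \sum_k \sum_l (z 0 i * x 0 k * v 0 l) * f 'e_i 'e_k 'e_l.
Proof.
move=> l1 l2 l3; rewrite [LHS](linear_sum_delta z (l1 _ _)); apply: eq_bigr => i _.
rewrite (linear_sum_delta x (l2 _ _)) scaler_sumr; apply: eq_bigr => k _.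
rewrite (linear_sum_delta v (l3 _ _)) !scaler_sumr; apply: eq_bigr => l _.
by rewrite !scalerA.
Qed.

Lemma quad_sumE c (f : V -> V -> V -> V -> R^o) z w x v :
  (forall w x v, linear (fun z => f z w x v)) -> (forall z x v, linear (fun w => f z w x v)) ->
  (forall z w v, linear (fun x => f z w x v)) -> (forall z w x, linear (f z w x)) ->
  (forall i j k l, c i j k l = f 'e_i 'e_j 'e_k 'e_l) ->
  quad_sum c z w x v = f z w x v.
Proof.
move=> l1 l2 l3 l4 e.
rewrite (@trilinear_expand (fun z x v => f z w x v) z x v) //.
apply: eq_bigr => i _; apply: eq_bigr => k _; apply: eq_bigr => l _; congr (_ * _).
rewrite [RHS](linear_sum_delta w (l2 _ _ _)); apply: eq_bigr => j _.
by rewrite e.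
Qed.

Lemma quad_sum_linear c z x v : linear (fun w => quad_sum c z w x v).
Proof.
move=> a w w'; rewrite /quad_sum scaler_sumr -big_split; apply: eq_bigr => i _ /=.
rewrite scaler_sumr -big_split; apply: eq_bigr => k _ /=.
rewrite scaler_sumr -big_split; apply: eq_bigr => l _ /=.
set t := _ * _ * _; rewrite /GRing.scale/= mulrCA -mulrDr; congr (_ * _).
rewrite mulr_sumr -big_split; apply: eq_bigr => j _ /=.
by rewrite !mxE mulrDl mulrA.
Qed.

Definition representable (b : V -> V -> R^o) (phi : V -> R) := exists r, forall w, phi w = b r w.

Section Representable.
Variable b : V -> V -> R^o.
Hypothesis lb : forall w, linear (fun u => b u w : R^o).

Lemma representable_ext phi psi : (forall w, phi w = psi w) -> representable b phi ->
  representable b psi.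
Proof. by move=> e [r hr]; exists r => w; rewrite -e. Qed.

Lemma representable_metric r : representable b (b r).
Proof. by exists r. Qed.

Lemma representable0 : representable b (fun=> 0).
Proof. by exists 0 => w; rewrite (linear_zero (lb w)). Qed.

Lemma representableD phi psi : representable b phi -> representable b psi ->
  representable b (fun w => phi w + psi w).
Proof. by move=> [r hr] [s hs]; exists (r + s) => w; rewrite (linear_add (lb w)) hr hs. Qed.

Lemma representableZ a phi : representable b phi -> representable b (fun w => a * phi w).
Proof. by move=> [r hr]; exists (a *: r) => w; rewrite (linear_scale _ _ (lb w)) hr. Qed.

Lemma representable_sum (I : Type) (s : seq I) (phi : I -> V -> R) :
  (forall i, representable b (phi i)) -> representable b (fun w => \sum_(i <- s) phi i w).
Proof.
move=> h; elim: s => [|i s IH].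
  by apply: representable_ext representable0 => w; rewrite big_nil.
by apply: representable_ext (representableD (h i) IH) => w; rewrite big_cons.
Qed.

End Representable.
End LocalFlat.

Section NablaForm.
Context {R : realType} {M : charted_space R}.
Hypothesis hM : smooth_manifold M.
Local Notation n := (mdim M).
Local Notation V := 'rV[R]_n.
Implicit Types (p q x : M) (y u v w : V) (X Y Z W : vfield M).

Local Notation cm p := (cmap (chart_at p)).
Local Notation ci p := (cinv (chart_at p)).
Local Notation Om p := (chart_image (chart_at p)).
Local Notation D p := (cdom (chart_at p)).

Variables (g : tensor02 M) (J : tensor11 M).
Hypotheses (hg : singular_metric g) (hJ : almost_product_structure g J).
Local Notation G := (local_metric g).
Local Notation Jl := (local_tensor J).
Local Notation Gt p := (ap_christoffel (G p) (Jl p)).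
Local Notation flat p X Y := (local_flat (G p) (Jl p) (vfield_in_chart X p) (vfield_in_chart Y p)).

Lemma local_metric_linear1 p y v : Om p y -> linear (fun u => G p y u v : R^o).
Proof. by move=> Oy; exact: bilinear_family1 (local_metric_bilinear hg p) Oy. Qed.

Lemma local_metric_linear2 p y u : Om p y -> linear (G p y u).
Proof. by move=> Oy; exact: bilinear_family2 (local_metric_bilinear hg p) Oy. Qed.

Lemma ap_christoffel_in_chart p : trilinear_family (Om p) (Gt p).
Proof.
exact: (ap_christoffel_trilinear (chart_image_open hM (p := p)) (local_metric_bilinear hg p)
  (local_tensor_linear hJ p)).
Qed.

Lemma local_flat_linear p X Y : smooth_vfield X -> smooth_vfield Y ->
  linear_family (Om p) (flat p X Y).
Proof.
move=> sX sY; have oO := chart_image_open hM (p := p); have tG := ap_christoffel_in_chart p.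
have sdY := smooth_on_dird_along oO (sY p) (sX p).
split=> [y Oy|v].
  apply: linear_addf; first exact: trilinear_family3 tG Oy.
  exact: local_metric_linear2.
apply: smooth_on_add => //.
  exact: trilinear_family_apply oO tG (sX p) (sY p) (smooth_on_cst _ v).
exact: bilinear_family_apply oO (local_metric_bilinear hg p) sdY (smooth_on_cst _ v).
Qed.

Lemma nabla_flatE X Y W p x : smooth_vfield X -> smooth_vfield Y -> smooth_vfield W ->
  D p x -> nabla_flat g J X Y W x = flat p X Y (cm p x) (vfield_in_chart W p (cm p x)).
Proof. by move=> sX sY sW Dx; exact: (ap_koszulE hM hg hJ sX sY sW Dx). Qed.

Lemma represents_nabla_flat X Y p x r : smooth_vfield X -> smooth_vfield Y -> D p x ->
  (forall v, flat p X Y (cm p x) v = G p (cm p x) r v) ->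
  represents g x (tvec p x r) (nabla_flat g J X Y).
Proof.
move=> sX sY Dx hr W sW; rewrite (nabla_flatE sX sY sW Dx) hr.
by rewrite (local_metricE hM g _ _ Dx) (tcoord_tvec hM)// (vfield_in_chartE hM).
Qed.

Lemma nabla_flat_represents X Y p x : smooth_vfield X -> smooth_vfield Y -> D p x ->
  (exists u, represents g x u (nabla_flat g J X Y)) ->
  representable (G p (cm p x)) (flat p X Y (cm p x)).
Proof.
move=> sX sY Dx [u hu]; exists (tcoord p x u) => v.
have [W sW Wx] := vfield_through hM x (tvec p x v).
have := hu W sW; rewrite (nabla_flatE sX sY sW Dx) (local_metricE hM g _ _ Dx).
by rewrite (vfield_in_chartE hM)// Wx (tcoord_tvec hM).
Qed.

(* The derivative of W enters both terms of nabla_form and cancels, so that the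
   expression is tensorial in W. *)
Lemma nabla_formE X Y Z W p x r s :
  smooth_vfield X -> smooth_vfield Y -> smooth_vfield Z -> smooth_vfield W -> D p x ->
  (forall v, Gt p (cm p x) (vfield_in_chart Z p (cm p x)) (vfield_in_chart W p (cm p x)) v
     = G p (cm p x) r v) ->
  (forall v, flat p X Y (cm p x) v = G p (cm p x) s v) ->
  nabla_form g J Z (nabla_flat g J X Y) W x =
  dird (fun y => flat p X Y y (vfield_in_chart W p (cm p x))) (cm p x)
    (vfield_in_chart Z p (cm p x)) - G p (cm p x) r s.
Proof.
move=> sX sY sZ sW Dx hr hs; have oO := chart_image_open hM (p := p).
have Ox := cmap_image Dx.
rewrite /nabla_form.
set r' := r + dird (vfield_in_chart W p) (cm p x) (vfield_in_chart Z p (cm p x)).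
have hr' v : flat p Z W (cm p x) v = G p (cm p x) r' v.
  by rewrite /local_flat hr (linear_add (local_metric_linear1 _ Ox)).
rewrite (copairingE hM hg (represents_nabla_flat sZ sW Dx hr')
  (represents_nabla_flat sX sY Dx hs)).
rewrite (local_metricE hM g _ _ Dx) !(tcoord_tvec hM)//.
have sL := ap_koszul_smooth hM hg hJ sX sY sW.
rewrite (vderiveE hM _ Dx (smooth_fun_diff sL Dx)).
have lL := local_flat_linear p sX sY.
have e y : Om p y -> flat p X Y y (vfield_in_chart W p y) = (ap_koszul g J X Y W \o ci p) y.
  move=> Oy; have Dy := cinv_dom hM Oy.
  by rewrite /= -[ap_koszul g J X Y W _]/(nabla_flat g J X Y W _) (nabla_flatE sX sY sW Dy)
    (cmapK hM Oy).
rewrite (open_eq_dird _ oO e Ox); last first.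
  exact: smooth_on_differentiable (linear_family_apply oO lL (sW p)) Ox.
rewrite (linear_family_dird _ oO lL (sW p) Ox) hs /r'.
rewrite (linear_add (local_metric_linear1 _ Ox)).
by rewrite [G p _ s _](local_metric_sym hg) [X in _ - X]addrC addrKA.
Qed.

End NablaForm.

(** * Semi-regularity expressed by smooth coefficients in a chart *)

Section SemiRegularLocal.
Context {R : realType} {M : charted_space R}.
Local Notation n := (mdim M).
Local Notation V := 'rV[R]_n.
Variables (g : tensor02 M) (J : tensor11 M).
Hypothesis hF : almost_product_semi_regular g J.
Implicit Types (p : M) (y z u v w x : V).

Local Notation cm p := (cmap (chart_at p)).
Local Notation ci p := (cinv (chart_at p)).
Local Notation Om p := (chart_image (chart_at p)).
Local Notation D p := (cdom (chart_at p)).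
Local Notation G := (local_metric g).
Local Notation Jl := (local_tensor J).
Local Notation Gt p := (ap_christoffel (G p) (Jl p)).
Local Notation flat p X Y := (local_flat (G p) (Jl p) (vfield_in_chart X p) (vfield_in_chart Y p)).

(* The c i j k l extend <<Gt (e_i, e_j, .), Gt (e_k, e_l, .)>> smoothly through the
   points where the signature jumps. *)
Lemma semi_regular_local p : exists (N : set V) (c : 'I_n -> 'I_n -> 'I_n -> 'I_n -> V -> R^o),
  [/\ open N, N (cm p p), N `<=` Om p &
  [/\ forall i j k l, smooth_on N (c i j k l),
      forall y u v, N y -> representable (G p y) (Gt p y u v),
      forall y z w x v r s, N y -> constant_signature_region g (ci p y) ->
        (forall a, Gt p y z w a = G p y r a) -> (forall a, Gt p y x v a = G p y s a) ->
        quad_sum (fun i j k l => c i j k l y) z w x v = G p y r s &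
      forall y z x v, N y -> representable (G p y) (fun w =>
        dird (fun y' => Gt p y' x v w) y z - quad_sum (fun i j k l => c i j k l y) z w x v)]].
Proof.
have [[hM hg hJ] _ hA hN] := hF.
have oO := chart_image_open hM (p := p).
have tG := ap_christoffel_in_chart hM hg hJ p.
have [A12 A13 A23] := tG.
have [N [E [oN Np NO sE hE]]] := vfield_extension hM p.
(* The fields [E v] have constant coordinates on [N], so their derivatives vanish there and [flat]
   reduces to [Gt]. *)
have dE v y u : N y -> dird (vfield_in_chart (E v) p) y u = 0.
  move=> Ny; rewrite (open_eq_dird _ oN (f := fun=> v) _ Ny) ?dird_cst//.
  by move=> z Nz; rewrite hE.
have flatE x v y w : N y -> flat p (E x) (E v) y w = Gt p y x v w.
  move=> Ny; rewrite /local_flat dE// !hE//.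
  by rewrite (linear_zero (local_metric_linear1 hg _ (NO _ Ny))) addr0.
have cmK y : N y -> cm p (ci p y) = y by move=> Ny; exact: (cmapK hM (NO _ Ny)).
have ciD y : N y -> D p (ci p y) by move=> Ny; exact: (cinv_dom hM (NO _ Ny)).
have repG y u v : N y -> representable (G p y) (Gt p y u v).
  move=> Ny; have [_ /(_ (ci p y)) ru] := hA _ _ (sE u) (sE v).
  have := nabla_flat_represents hM hg hJ (sE u) (sE v) (ciD _ Ny) ru.
  rewrite cmK//; apply: representable_ext => w; exact: flatE.
(* The existence of extended derivatives is invoked only for the finitely many fields extending
   basis vectors; multilinearity supplies the rest. *)
have choose_e i k l := cid2 (hN (E 'e_k) (E 'e_l) (E 'e_i) (sE _) (sE _) (sE _)).
pose e i k l := s2val (choose_e i k l).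
have eA i k l : A_bullet g (e i k l) := s2valP (choose_e i k l).
have eE i k l : forall Y, smooth_vfield Y -> forall q, constant_signature_region g q ->
    e i k l Y q = nabla_form g J (E 'e_i) (nabla_flat g J (E 'e_k) (E 'e_l)) Y q.
  exact: s2valP' (choose_e i k l).
pose DG x v w y z := dird (fun y' => Gt p y' x v w) y z.
(* On the constant signature region the covariant derivative is the derivative of [Gt] minus the
   pairing. Solving for the pairing, with the covariant derivative replaced by its extension [e],
   gives coefficients that are smooth on all of [N]. *)
pose c i j k l y : R^o := DG 'e_k 'e_l 'e_j y 'e_i - e i k l (E 'e_j) (ci p y).
have lG1 y v w : N y -> linear (fun u => Gt p y u v w).
  by move=> /NO; exact: trilinear_family1 tG.
have lG2 y u w : N y -> linear (fun v => Gt p y u v w).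
  by move=> /NO; exact: trilinear_family2 tG.
have lGm1 y v : N y -> linear (fun u => G p y u v : R^o).
  by move=> /NO Oy; exact: local_metric_linear1.
exists N, c; split=> //; split=> //.
- move=> i j k l; apply: smooth_on_add => //.
    apply: smooth_on_sub NO _; apply: smooth_on_dird.
    exact: trilinear_family_smooth tG.
  have [[se _] _] := eA i k l.
  apply: (smooth_on_ext oN _ (smooth_on_scale (-1) oN (smooth_on_sub NO (se _ (sE 'e_j) p)))).
  by move=> y Ny; rewrite scaleN1r.
- move=> y z w x v r s Ny Ry hr hs.
  have [rho hrho] : {rho : V -> V -> V | forall u v a, Gt p y u v a = G p y (rho u v) a}.
    have h u v' := cid (repG y u v' Ny).
    by exists (fun u v => sval (h u v)) => u v'; exact: svalP (h u v').
  have symG a b : G p y a b = G p y b a by exact: local_metric_sym.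
  have cE i j k l : c i j k l y = G p y (rho 'e_i 'e_j) (rho 'e_k 'e_l).
    rewrite /c eE//.
    have hs' a : flat p (E 'e_k) (E 'e_l) (cm p (ci p y)) a = G p (cm p (ci p y)) (rho 'e_k 'e_l) a.
      by rewrite cmK// flatE// hrho.
    have hr' a : Gt p (cm p (ci p y)) (vfield_in_chart (E 'e_i) p (cm p (ci p y)))
        (vfield_in_chart (E 'e_j) p (cm p (ci p y))) a = G p (cm p (ci p y)) (rho 'e_i 'e_j) a.
      by rewrite cmK// !hE// hrho.
    rewrite (nabla_formE hM hg hJ (sE _) (sE _) (sE _) (sE _) (ciD _ Ny) hr' hs').
    rewrite cmK// !hE// /DG.
    have ef y' : N y' -> Gt p y' 'e_k 'e_l 'e_j = flat p (E 'e_k) (E 'e_l) y' 'e_j.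
      by move=> Ny'; rewrite flatE.
    rewrite [X in _ - (X - _)](open_eq_dird _ oN ef Ny); first by rewrite opprB addrC subrK.
    exact: smooth_on_differentiable (trilinear_family_smooth _ _ _ tG) (NO _ Ny).
  (* The representatives [rho] are arbitrary choices and need not be linear; linearity of their
     pairing in each argument is recovered by rewriting it as [Gt]. *)
  rewrite (@quad_sumE _ _ _ (fun z w x v => G p y (rho z w) (rho x v))) //.
  + rewrite -hrho hr symG -hrho hs; exact: symG.
  + by move=> w' x' v' a u1 u2; rewrite -!hrho; exact: lG1.
  + by move=> w' x' v' a u1 u2; rewrite -!hrho; exact: lG2.
  + by move=> w' x' v' a u1 u2; rewrite ![G p y (rho w' x') _]symG -!hrho; exact: lG1.
  + by move=> w' x' v' a u1 u2; rewrite ![G p y (rho w' x') _]symG -!hrho; exact: lG2.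
- move=> y z x v Ny; have Oy := NO _ Ny.
  pose phi i k l w : R := DG 'e_k 'e_l w y 'e_i - \sum_j w 0 j * c i j k l y.
  have DG1 x' v' w : linear (fun z => DG x' v' w y z : R^o) by exact: dird_linear.
  have DG2 z' v' w : linear (fun x => DG x v' w y z' : R^o).
    have [h _] := linear_family_dird_fam oO ((A12 w).1 v') (smooth_on_cst (Om p) z').
    exact: h.
  have DG3 z' x' w : linear (fun v => DG x' v w y z' : R^o).
    have [h _] := linear_family_dird_fam oO ((A12 w).2 x') (smooth_on_cst (Om p) z').
    exact: h.
  have DG4 z' x' v' : linear (fun w => DG x' v' w y z' : R^o).
    have [h _] := linear_family_dird_fam oO ((A13 v').2 x') (smooth_on_cst (Om p) z').
    exact: h.
  (* Subtracting [c] from the derivative of [Gt] leaves exactly [e], so the vector representing [e]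
     at this point also represents [phi i k l]. *)
  have rphi i k l : representable (G p y) (phi i k l).
    have [_ /(_ (ci p y)) [u hu]] := eA i k l.
    exists (tcoord p (ci p y) u) => w.
    have hj j : e i k l (E 'e_j) (ci p y) = G p y (tcoord p (ci p y) u) 'e_j.
      rewrite hu// (local_metricE hM g _ _ (ciD _ Ny)) cmK//.
      by rewrite -(vfield_in_chartE hM _ (ciD _ Ny)) cmK// hE.
    rewrite [RHS](linear_sum_delta w (local_metric_linear2 hg _ Oy)).
    rewrite /phi (linear_sum_delta w (DG4 _ _ _)) -sumrB; apply: eq_bigr => j _.
    by rewrite /c -hj /GRing.scale/= -mulrBr opprB addrC subrK.
  apply: (@representable_ext _ _ _ (fun w => \sum_i \sum_k \sum_l
    (z 0 i * x 0 k * v 0 l) * phi i k l w)).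
    move=> w; rewrite [X in _ = X - _](@trilinear_expand _ _ (fun z x v => DG x v w y z) z x v)//.
    rewrite /quad_sum -sumrB; apply: eq_bigr => i _.
    rewrite -sumrB; apply: eq_bigr => k _; rewrite -sumrB; apply: eq_bigr => l _.
    by rewrite -mulrBr.
  apply: representable_sum => [w|i]; first exact: lGm1.
  apply: representable_sum => [w|k]; first exact: lGm1.
  apply: representable_sum => [w|l]; first exact: lGm1.
  by apply: representableZ => [w|]; [exact: lGm1|exact: rphi].
Qed.

End SemiRegularLocal.

(** * Products *)

Section ProductTopology.
Context {S T : topologicalType}.

Lemma prod_open (A : set S) (B : set T) : open A -> open B -> open (A `*` B).
Proof.
move=> oA oB; rewrite openE => -[x y] [/= Ax By].
by exists (A, B) => //=; split; apply: open_nbhs_nbhs.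
Qed.

Lemma prod_hausdorff : hausdorff_space S -> hausdorff_space T ->
  hausdorff_space (S * T)%type.
Proof.
move=> hS hT [p1 p2] [q1 q2] clu; congr (_, _).
  apply: hS => A B nA nB; have [||[x y] [/= [Ax _] [Bx _]]] := clu (A `*` setT) (B `*` setT).
  - by exists (A, setT) => //=; split=> //; exact: filterT.
  - by exists (B, setT) => //=; split=> //; exact: filterT.
  - by exists x.
apply: hT => A B nA nB; have [||[x y] [/= [_ Ay] [_ By]]] := clu (setT `*` A) (setT `*` B).
- by exists (setT, A) => //=; split=> //; exact: filterT.
- by exists (setT, B) => //=; split=> //; exact: filterT.
- by exists y.
Qed.

Lemma prod_second_countable : @second_countable S -> @second_countable T ->
  @second_countable (S * T)%type.
Proof.
move=> [B1 c1 [op1 b1]] [B2 c2 [op2 b2]].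
exists ((fun p : set S * set T => p.1 `*` p.2) @` (B1 `*` B2)).
  apply: sub_countable (countableX c1 c2); exact: card_image_le.
split=> [_ [[A C] [/= /op1 oA /op2 oC] <-]|[x y] W [[A C] [/= nA nC] sW]].
  exact: prod_open.
have [A' [B1A A'x] A'A] := b1 x _ nA; have [C' [B2C C'y] C'C] := b2 y _ nC.
exists (A' `*` C'); first by split=> //; exists (A', C').
by move=> [a c] [/= /A'A Aa /C'C Cc]; apply: sW.
Qed.

End ProductTopology.

Section SplitCalculus.
Context {R : realType} {n1 n2 : nat}.
Local Notation V := 'rV[R]_(n1 + n2).

Lemma lsubmx_linear : linear (lsubmx : V -> 'rV[R]_n1).
Proof. exact: linearP. Qed.

Lemma rsubmx_linear : linear (rsubmx : V -> 'rV[R]_n2).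
Proof. exact: linearP. Qed.

Lemma row_mx_linear_l : linear (fun u : 'rV[R]_n1 => row_mx u (0 : 'rV[R]_n2)).
Proof. by move=> a u v; rewrite scale_row_mx add_row_mx scaler0 addr0. Qed.

Lemma row_mx_linear_r : linear (fun u : 'rV[R]_n2 => row_mx (0 : 'rV[R]_n1) u).
Proof. by move=> a u v; rewrite scale_row_mx add_row_mx scaler0 addr0. Qed.

Lemma row_mx_split (u : 'rV[R]_n1) (v : 'rV[R]_n2) : row_mx u v = row_mx u 0 + row_mx 0 v.
Proof. by rewrite add_row_mx addr0 add0r. Qed.

Definition prod_set (U1 : set 'rV[R]_n1) (U2 : set 'rV[R]_n2) : set V :=
  [set y | U1 (lsubmx y) /\ U2 (rsubmx y)].

Lemma prod_set_open U1 U2 : open U1 -> open U2 -> open (prod_set U1 U2).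
Proof.
move=> o1 o2; apply: openI; apply: open_comp => // y _.
  exact: linear_rV_continuous lsubmx_linear _.
exact: linear_rV_continuous rsubmx_linear _.
Qed.

Section Components.
Context {W : normedModType R}.

Lemma smooth_on_lsub (U1 : set 'rV[R]_n1) U2 (h : 'rV[R]_n1 -> W) : open U1 -> open U2 ->
  smooth_on U1 h -> smooth_on (prod_set U1 U2) (fun y => h (lsubmx y)).
Proof.
move=> o1 o2 sh; apply: (smooth_on_comp (prod_set_open o1 o2) o1 _ _ sh); first by move=> y [].
exact: (linear_smooth_on lsubmx_linear (linear_rV_continuous lsubmx_linear)).
Qed.

Lemma smooth_on_rsub U1 (U2 : set 'rV[R]_n2) (h : 'rV[R]_n2 -> W) : open U1 -> open U2 ->
  smooth_on U2 h -> smooth_on (prod_set U1 U2) (fun y => h (rsubmx y)).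
Proof.
move=> o1 o2 sh; apply: (smooth_on_comp (prod_set_open o1 o2) o2 _ _ sh); first by move=> y [].
exact: (linear_smooth_on rsubmx_linear (linear_rV_continuous rsubmx_linear)).
Qed.

Lemma dird_linear_comp (V' V'' : normedModType R) (L : V' -> V'') (h : V'' -> W) y v :
  linear L -> continuous L -> differentiable h (L y) ->
  dird (fun z => h (L z)) y v = dird h (L y) (L v).
Proof.
move=> lL cL dh; have dL := linear_is_diff lL cL y.
rewrite -!dirdE; have -> := diff_comp (@ex_diff _ _ _ _ _ _ _ dL) dh.
by rewrite /= diff_val.
Qed.

Lemma dird_lsub (h : 'rV[R]_n1 -> W) (y v : V) : differentiable h (lsubmx y) ->
  dird (fun z : V => h (lsubmx z)) y v = dird h (lsubmx y) (lsubmx v).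
Proof.
exact: dird_linear_comp lsubmx_linear (linear_rV_continuous lsubmx_linear).
Qed.

Lemma dird_rsub (h : 'rV[R]_n2 -> W) (y v : V) : differentiable h (rsubmx y) ->
  dird (fun z : V => h (rsubmx z)) y v = dird h (rsubmx y) (rsubmx v).
Proof.
exact: dird_linear_comp rsubmx_linear (linear_rV_continuous rsubmx_linear).
Qed.

End Components.

Lemma smooth_on_row_mx (W : normedModType R) (U : set W) (a : W -> 'rV[R]_n1) (b : W -> 'rV[R]_n2) :
  open U -> smooth_on U a -> smooth_on U b -> smooth_on U (fun y => row_mx (a y) (b y)).
Proof.
move=> oU sa sb; under eq_fun do rewrite row_mx_split.
apply: smooth_on_add => //.
  exact: (smooth_on_linear_comp row_mx_linear_l (linear_rV_continuous row_mx_linear_l)).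
exact: (smooth_on_linear_comp row_mx_linear_r (linear_rV_continuous row_mx_linear_r)).
Qed.

Lemma is_diff_row_mx (W : normedModType R) (a : W -> 'rV[R]_n1) (b : W -> 'rV[R]_n2) y :
  differentiable a y -> differentiable b y ->
  differentiable (fun z => row_mx (a z) (b z)) y /\
  forall v, dird (fun z => row_mx (a z) (b z)) y v = row_mx (dird a y v) (dird b y v).
Proof.
move=> da db.
have hl := is_diff_linear_comp row_mx_linear_l (linear_rV_continuous row_mx_linear_l) da.
have hr := is_diff_linear_comp row_mx_linear_r (linear_rV_continuous row_mx_linear_r) db.
have [d e] := is_diffD hl hr.
have E : (fun z => row_mx (a z) (b z)) =
    ((fun u => row_mx u 0) \o a) + ((fun u => row_mx 0 u) \o b).
  by apply/funext => z; rewrite row_mx_split.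
by rewrite E; split=> // v; rewrite -dirdE e !fctE /= !dirdE [RHS]row_mx_split.
Qed.

Lemma row_mx_continuous (S : topologicalType) (a : S -> 'rV[R]_n1) (b : S -> 'rV[R]_n2) x :
  {for x, continuous a} -> {for x, continuous b} ->
  {for x, continuous (fun z => row_mx (a z) (b z) : V)}.
Proof.
move=> ca cb; rewrite (_ : (fun z => _) =
    ((fun u => row_mx u 0) \o a) \+ ((fun u => row_mx 0 u) \o b)); last first.
  by apply/funext => z; rewrite row_mx_split.
apply: continuousD; apply: continuous_comp => //.
  exact: linear_rV_continuous row_mx_linear_l _.
exact: linear_rV_continuous row_mx_linear_r _.
Qed.

End SplitCalculus.

(** * Koszul forms of a warped product *)

Section Congruence.
Context {R : realType} {n : nat}.
Local Notation V := 'rV[R]_n.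

Lemma christoffel_ext (U : set V) (G G' : V -> V -> V -> R^o) y u v w : open U ->
  (forall z a b, U z -> G z a b = G' z a b) -> (forall a b, smooth_on U (fun z => G z a b)) ->
  U y -> christoffel G y u v w = christoffel G' y u v w.
Proof.
move=> oU e sG Uy; have d a b := smooth_on_differentiable (sG a b) Uy.
have ed a b c : dird (fun z => G' z a b) y c = dird (fun z => G z a b) y c.
  by apply: (open_eq_dird _ oU _ Uy) => // z; exact: e.
by rewrite /christoffel !ed.
Qed.

(** The block expressions agree with the chart expressions of the warped metric and of its product
    structure only on the chart image; as derivatives enter, agreement on an open set is what can be
    used. *)
Lemma ap_christoffel_ext (U : set V) (G G' : V -> V -> V -> R^o) (J J' : V -> V -> V) y u v w :
  open U -> (forall z a b, U z -> G z a b = G' z a b) -> (forall z a, U z -> J z a = J' z a) ->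
  (forall a b, smooth_on U (fun z => G z a b)) -> (forall a, smooth_on U (fun z => J z a)) ->
  U y -> ap_christoffel G J y u v w = ap_christoffel G' J' y u v w.
Proof.
move=> oU eG eJ sG sJ Uy; rewrite /ap_christoffel.
rewrite !(christoffel_ext _ _ _ oU eG sG Uy) -!eJ// eG//.
rewrite -(open_eq_dird u oU (fun z => eJ z v) Uy)//.
exact: smooth_on_differentiable (sJ v) Uy.
Qed.

End Congruence.

Section ProductGeometry.
Context {R : realType} {n1 n2 : nat}.
Local Notation V1 := 'rV[R]_n1.
Local Notation V2 := 'rV[R]_n2.
Local Notation V := 'rV[R]_(n1 + n2).

Variables (U1 : set V1) (G1 : V1 -> V1 -> V1 -> R^o) (J1 : V1 -> V1 -> V1).
Hypotheses (oU1 : open U1) (sG1 : forall y u v, G1 y u v = G1 y v u).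
Hypotheses (bG1 : bilinear_family U1 G1) (lJ1 : linear_family U1 J1).

Variables (U2 : set V2) (G2 : V2 -> V2 -> V2 -> R^o) (J2 : V2 -> V2 -> V2).
Hypotheses (oU2 : open U2) (sG2 : forall y u v, G2 y u v = G2 y v u).
Hypotheses (bG2 : bilinear_family U2 G2) (lJ2 : linear_family U2 J2).
Hypothesis isoJ2 : forall y u v, U2 y -> G2 y (J2 y u) (J2 y v) = G2 y u v.

Variable phi : V1 -> R^o.
Hypothesis sphi : smooth_on U1 phi.

Definition warped_form (y u v : V) : R^o :=
  G1 (lsubmx y) (lsubmx u) (lsubmx v) + phi (lsubmx y) ^+ 2 * G2 (rsubmx y) (rsubmx u) (rsubmx v).

Definition prod_tensor (y v : V) : V :=
  row_mx (J1 (lsubmx y) (lsubmx v)) (J2 (rsubmx y) (rsubmx v)).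

Local Notation U := (prod_set U1 U2).

Lemma warped_form_smooth u v : smooth_on U (fun y => warped_form y u v).
Proof.
have oU := prod_set_open oU1 oU2.
have sp := smooth_on_lsub oU1 oU2 sphi.
apply: smooth_on_add => //; first exact: (smooth_on_lsub oU1 oU2 (metric_smooth bG1 _ _)).
apply: (smooth_on_mul oU).
  by apply: (smooth_on_ext oU _ (smooth_on_mul oU sp sp)) => y _; rewrite expr2.
exact: (smooth_on_rsub oU1 oU2 (metric_smooth bG2 _ _)).
Qed.

Lemma warped_form_sym y u v : warped_form y u v = warped_form y v u.
Proof. by rewrite /warped_form sG1 sG2. Qed.

Lemma warped_form_linear y u : U y -> linear (warped_form y u).
Proof.
move=> [Uy1 Uy2] a v w; rewrite /warped_form !linearP.
rewrite (bilinear_family2 _ bG1 Uy1) (bilinear_family2 _ bG2 Uy2) /GRing.scale/=.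
by ring.
Qed.

Lemma warped_form_bilinear : bilinear_family U warped_form.
Proof.
split=> v; split=> [y Uy|u]; do ?[exact: warped_form_smooth].
  move=> a u w; rewrite ![warped_form y _ v]warped_form_sym; exact: warped_form_linear.
exact: warped_form_linear.
Qed.

Lemma prod_tensor_linear : linear_family U prod_tensor.
Proof.
split=> [y [Uy1 Uy2] a u v|v].
  rewrite /prod_tensor !linearP lJ1.1// lJ2.1//.
  by rewrite scale_row_mx add_row_mx.
apply: smooth_on_row_mx; first exact: prod_set_open.
  exact: (smooth_on_lsub oU1 oU2 (lJ1.2 _)).
exact: (smooth_on_rsub oU1 oU2 (lJ2.2 _)).
Qed.

Lemma dird_warped_form y u v w : U y ->
  dird (fun z => warped_form z v w) y u =
  dird (fun z => G1 z (lsubmx v) (lsubmx w)) (lsubmx y) (lsubmx u) +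
  (2 * phi (lsubmx y) * dird phi (lsubmx y) (lsubmx u) * G2 (rsubmx y) (rsubmx v) (rsubmx w) +
   phi (lsubmx y) ^+ 2 * dird (fun z => G2 z (rsubmx v) (rsubmx w)) (rsubmx y) (rsubmx u)).
Proof.
move=> Uy; have [Uy1 Uy2] := Uy; have oU := prod_set_open oU1 oU2.
have d1 : differentiable (fun z => G1 z (lsubmx v) (lsubmx w)) (lsubmx y).
  exact: smooth_on_differentiable (metric_smooth bG1 _ _) Uy1.
have d2 : differentiable (fun z => G2 z (rsubmx v) (rsubmx w)) (rsubmx y).
  exact: smooth_on_differentiable (metric_smooth bG2 _ _) Uy2.
have dp : differentiable phi (lsubmx y) by exact: smooth_on_differentiable sphi Uy1.
pose A (z : V) : R^o := G1 (lsubmx z) (lsubmx v) (lsubmx w).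
pose B (z : V) : R^o := G2 (rsubmx z) (rsubmx v) (rsubmx w).
pose C (z : V) : R^o := phi (lsubmx z).
have sA : smooth_on U A by exact: (smooth_on_lsub oU1 oU2 (metric_smooth bG1 _ _)).
have sB : smooth_on U B by exact: (smooth_on_rsub oU1 oU2 (metric_smooth bG2 _ _)).
have sC : smooth_on U C by exact: (smooth_on_lsub oU1 oU2 sphi).
have dA := smooth_on_differentiable sA Uy; have dB := smooth_on_differentiable sB Uy.
have dC := smooth_on_differentiable sC Uy.
have sCC := smooth_on_mul oU sC sC; have dCC := smooth_on_differentiable sCC Uy.
have dCCB := smooth_on_differentiable (smooth_on_mul oU sCC sB) Uy.
have -> : (fun z => warped_form z v w) = (fun z => A z + C z * C z * B z).
  by apply/funext => z; rewrite /warped_form expr2.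
rewrite dirdD// (dirdM _ dCC dB) (dirdM _ dC dC).
rewrite [dird A y u](dird_lsub _ d1) [dird B y u](dird_rsub _ d2) [dird C y u](dird_lsub _ dp).
by rewrite /B /C; congr (_ + _); ring.
Qed.

Lemma christoffel_warped y u v w : U y ->
  christoffel warped_form y u v w =
  christoffel G1 (lsubmx y) (lsubmx u) (lsubmx v) (lsubmx w) +
  (phi (lsubmx y) ^+ 2 * christoffel G2 (rsubmx y) (rsubmx u) (rsubmx v) (rsubmx w) +
   phi (lsubmx y) * (dird phi (lsubmx y) (lsubmx u) * G2 (rsubmx y) (rsubmx v) (rsubmx w) +
     dird phi (lsubmx y) (lsubmx v) * G2 (rsubmx y) (rsubmx u) (rsubmx w) -
     dird phi (lsubmx y) (lsubmx w) * G2 (rsubmx y) (rsubmx u) (rsubmx v))).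
Proof.
move=> Uy; rewrite /christoffel !dird_warped_form//.
rewrite [G2 (rsubmx y) (rsubmx w) (rsubmx u)]sG2.
by field.
Qed.

(** The terms in [dird phi] come from d(phi^2) = 2 phi dphi, averaged over the plain half and the
    half twisted by [J]. In the term along [u] the isometry of [J2] makes both halves equal, so it
    carries no 1/2; the others keep a plain and a twisted summand. *)
Lemma ap_christoffel_warped y u v w : U y ->
  ap_christoffel warped_form prod_tensor y u v w =
  ap_christoffel G1 J1 (lsubmx y) (lsubmx u) (lsubmx v) (lsubmx w) +
  (phi (lsubmx y) ^+ 2 * ap_christoffel G2 J2 (rsubmx y) (rsubmx u) (rsubmx v) (rsubmx w) +
   phi (lsubmx y) * (dird phi (lsubmx y) (lsubmx u) * G2 (rsubmx y) (rsubmx v) (rsubmx w) +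
     2^-1 * (dird phi (lsubmx y) (lsubmx v) * G2 (rsubmx y) (rsubmx u) (rsubmx w) +
       dird phi (lsubmx y) (J1 (lsubmx y) (lsubmx v)) *
         G2 (rsubmx y) (rsubmx u) (J2 (rsubmx y) (rsubmx w))) -
     2^-1 * (dird phi (lsubmx y) (lsubmx w) * G2 (rsubmx y) (rsubmx u) (rsubmx v) +
       dird phi (lsubmx y) (J1 (lsubmx y) (lsubmx w)) *
         G2 (rsubmx y) (rsubmx u) (J2 (rsubmx y) (rsubmx v))))).
Proof.
move=> Uy; have [Uy1 Uy2] := Uy.
have dJ1 : differentiable (fun z => J1 z (lsubmx v)) (lsubmx y).
  exact: smooth_on_differentiable (lJ1.2 _) Uy1.
have dJ2 : differentiable (fun z => J2 z (rsubmx v)) (rsubmx y).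
  exact: smooth_on_differentiable (lJ2.2 _) Uy2.
have eJ : dird (fun z => prod_tensor z v) y u =
    row_mx (dird (fun z => J1 z (lsubmx v)) (lsubmx y) (lsubmx u))
           (dird (fun z => J2 z (rsubmx v)) (rsubmx y) (rsubmx u)).
  have dl : differentiable (fun z : V => J1 (lsubmx z) (lsubmx v)) y.
    exact: smooth_on_differentiable (smooth_on_lsub oU1 oU2 (lJ1.2 _)) Uy.
  have dr : differentiable (fun z : V => J2 (rsubmx z) (rsubmx v)) y.
    exact: smooth_on_differentiable (smooth_on_rsub oU1 oU2 (lJ2.2 _)) Uy.
  have [_ ->] := is_diff_row_mx dl dr.
  by rewrite (dird_lsub _ dJ1) (dird_rsub _ dJ2).
rewrite {1}/ap_christoffel !christoffel_warped// eJ {1}/warped_form.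
rewrite /prod_tensor !row_mxKl !row_mxKr isoJ2// /ap_christoffel.
by field.
Qed.

End ProductGeometry.

(** * The pairing of Koszul forms on a warped product *)

Section Sharp.
Context {R : realType} {n : nat}.
Local Notation V := 'rV[R]_n.
Implicit Types G : V -> V -> V -> R^o.

Definition gram G (y : V) : 'M[R]_n := \matrix_(i, j) G y 'e_i 'e_j.

(** The vector representing [l] in the metric, written with the inverse Gram matrix so that smooth
    dependence on the point follows from the cofactor formula. *)
Definition sharp G (y : V) (l : V -> R) : V := (\row_j l 'e_j) *m invmx (gram G y).

Lemma gramE G y (u : V) j : (forall v, linear (fun u => G y u v : R^o)) ->
  (u *m gram G y) 0 j = G y u 'e_j.
Proof.
move=> lG; rewrite mxE (linear_sum_delta u (lG _)); apply: eq_bigr => i _.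
by rewrite mxE.
Qed.

Lemma gram_unit G y : (forall v, linear (fun u => G y u v : R^o)) ->
  (forall u, linear (G y u)) -> (forall u, (forall v, G y u v = 0) -> u = 0) ->
  gram G y \in unitmx.
Proof.
move=> l1 l2 nd; rewrite -row_free_unit -kermx_eq0; apply/rowV0P => u.
rewrite sub_kermx => /eqP uG; apply: nd => v.
rewrite (linear_sum_delta v (l2 _)) big1// => j _.
by rewrite -gramE// uG mxE scaler0.
Qed.

Lemma sharpP G y (l : V -> R^o) v : (forall v, linear (fun u => G y u v : R^o)) ->
  (forall u, linear (G y u)) -> (forall u, (forall v, G y u v = 0) -> u = 0) ->
  linear l -> G y (sharp G y l) v = l v.
Proof.
move=> l1 l2 nd ll; rewrite (linear_sum_delta v (l2 _)) [RHS](linear_sum_delta v ll).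
apply: eq_bigr => j _; congr (_ *: _).
by rewrite -gramE// /sharp mulmxKV ?gram_unit// mxE.
Qed.

Section Smooth.
Context {W : normedModType R}.
Implicit Types U : set W.

Lemma smooth_on_det k U (A : W -> 'M[R]_k) : open U ->
  (forall i j, smooth_on U (fun y => A y i j : R^o)) ->
  smooth_on U (fun y => \det (A y) : R^o).
Proof.
move=> oU sA; apply: smooth_on_sum => // s _; apply: smooth_on_mul => //.
  exact: smooth_on_cst.
by apply: smooth_on_prod.
Qed.

Lemma smooth_on_invmx k U (A : W -> 'M[R]_k) : open U ->
  (forall i j, smooth_on U (fun y => A y i j : R^o)) -> (forall y, U y -> A y \in unitmx) ->
  forall i j, smooth_on U (fun y => invmx (A y) i j : R^o).
Proof.
move=> oU sA uA i j.
apply: (smooth_on_ext oU (f := fun y => (\det (A y))^-1 * cofactor (A y) j i)) => [y Uy|].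
  by rewrite /invmx uA// !mxE.
apply: smooth_on_mul => //.
  apply: smooth_on_inv => //; last exact: smooth_on_det.
  by move=> y Uy; have := uA _ Uy; rewrite unitmxE unitfE.
apply: smooth_on_mul => //; first exact: smooth_on_cst.
apply: smooth_on_det => // i' j'.
by apply: (smooth_on_ext oU _ (sA (lift j i') (lift i j'))) => y _; rewrite !mxE.
Qed.

(** The evaluation point [t y] is kept apart from [y] because the metric lives on the base while the
    form to be raised depends on the point of the product. *)
Lemma smooth_on_sharp U (U' : set V) G (t : W -> V) (l : W -> V -> R^o) : open U ->
  open U' -> (forall y, U y -> U' (t y)) -> smooth_on U t ->
  bilinear_family U' G -> (forall y u, U' y -> (forall v, G y u v = 0) -> u = 0) ->
  (forall v, smooth_on U (fun y => l y v)) ->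
  smooth_on U (fun y => sharp G (t y) (l y)).
Proof.
move=> oU oU' tU st bG nd sl; apply: smooth_on_row => // j.
apply: (smooth_on_ext oU (f := fun y => \sum_i l y 'e_i * invmx (gram G (t y)) i j)) => [y _|].
  by rewrite mxE; apply: eq_bigr => i _; rewrite mxE.
apply: smooth_on_sum => // i _; apply: smooth_on_mul => //.
apply: smooth_on_invmx => // [i' j'|y /tU Uty].
  have s := smooth_on_comp oU oU' tU st (metric_smooth bG 'e_i' 'e_j').
  by apply: (smooth_on_ext oU _ s) => y _; rewrite !mxE.
apply: gram_unit => [v|u|u]; [exact: bilinear_family1 bG Uty|exact: bilinear_family2 bG Uty|].
exact: nd.
Qed.

End Smooth.
End Sharp.

Section Pullback.
Context {R : realType} {n1 n2 : nat} {W : normedModType R}.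
Local Notation V := 'rV[R]_(n1 + n2).
Variables (U1 : set 'rV[R]_n1) (U2 : set 'rV[R]_n2).
Hypotheses (oU1 : open U1) (oU2 : open U2).

(** Fibre tensors receive arguments in the total space, so that the Leibniz rules for families apply
    to fields whose fibre components also vary with the base point. *)
Lemma linear_family_rsub (A : 'rV[R]_n2 -> 'rV[R]_n2 -> W) : linear_family U2 A ->
  linear_family (prod_set U1 U2) (fun (y : V) (u : V) => A (rsubmx y) (rsubmx u)).
Proof.
move=> [lA sA]; split=> [y [_ Uy]|v]; last exact: (smooth_on_rsub oU1 oU2 (sA _)).
exact: (linear_compf (lA _ Uy) (@rsubmx_linear _ _ _)).
Qed.

Lemma bilinear_family_rsub (A : 'rV[R]_n2 -> 'rV[R]_n2 -> 'rV[R]_n2 -> W) :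
  bilinear_family U2 A ->
  bilinear_family (prod_set U1 U2) (fun y u v : V => A (rsubmx y) (rsubmx u) (rsubmx v)).
Proof.
move=> [A1 A2]; split=> v.
  exact: (linear_family_rsub (A1 (rsubmx v))).
exact: (linear_family_rsub (A2 (rsubmx v))).
Qed.

Lemma trilinear_family_rsub (A : 'rV[R]_n2 -> 'rV[R]_n2 -> 'rV[R]_n2 -> 'rV[R]_n2 -> W) :
  trilinear_family U2 A -> trilinear_family (prod_set U1 U2)
    (fun y u v w : V => A (rsubmx y) (rsubmx u) (rsubmx v) (rsubmx w)).
Proof.
move=> [A12 A13 A23]; split=> v.
- exact: (bilinear_family_rsub (A12 (rsubmx v))).
- exact: (bilinear_family_rsub (A13 (rsubmx v))).
- exact: (bilinear_family_rsub (A23 (rsubmx v))).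
Qed.

End Pullback.

Section WarpedPairing.
Context {R : realType} {n1 n2 : nat}.
Local Notation V1 := 'rV[R]_n1.
Local Notation V2 := 'rV[R]_n2.
Local Notation V := 'rV[R]_(n1 + n2).

Variables (U1 : set V1) (G1 : V1 -> V1 -> V1 -> R^o) (J1 : V1 -> V1 -> V1).
Hypotheses (oU1 : open U1) (sG1 : forall y u v, G1 y u v = G1 y v u).
Hypotheses (bG1 : bilinear_family U1 G1) (lJ1 : linear_family U1 J1).
Hypothesis nd1 : forall y u, U1 y -> (forall v, G1 y u v = 0) -> u = 0.

Variables (U2 : set V2) (G2 : V2 -> V2 -> V2 -> R^o) (J2 : V2 -> V2 -> V2).
Hypotheses (oU2 : open U2) (sG2 : forall y u v, G2 y u v = G2 y v u).
Hypotheses (bG2 : bilinear_family U2 G2) (lJ2 : linear_family U2 J2).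
Hypothesis isoJ2 : forall y u v, U2 y -> G2 y (J2 y u) (J2 y v) = G2 y u v.
Hypothesis JJ2 : forall y v, U2 y -> J2 y (J2 y v) = v.

Variable phi : V1 -> R^o.
Hypothesis sphi : smooth_on U1 phi.

Local Notation Gt2 := (ap_christoffel G2 J2).
Variable c : 'I_n2 -> 'I_n2 -> 'I_n2 -> 'I_n2 -> V2 -> R^o.
Local Notation qs y := (quad_sum (fun i j k l => c i j k l y)).
Hypothesis sc : forall i j k l, smooth_on U2 (c i j k l).
Hypothesis rep2 : forall y u v, U2 y -> representable (G2 y) (Gt2 y u v).
Hypothesis diff2 : forall y z x v, U2 y -> representable (G2 y) (fun w =>
  dird (fun y' => Gt2 y' x v w) y z - qs y z w x v).

Local Notation U := (prod_set U1 U2).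
Local Notation GG := (warped_form G1 G2 phi).
Local Notation JJ := (prod_tensor J1 J2).
Local Notation Gt := (ap_christoffel GG JJ).

Variables X Y Z : V -> V.
Hypotheses (sX : smooth_on U X) (sY : smooth_on U Y) (sZ : smooth_on U Z).

Let oU : open U := prod_set_open oU1 oU2.
Let bG : bilinear_family U GG := warped_form_bilinear oU1 sG1 bG1 oU2 sG2 bG2 sphi.
Let lJ : linear_family U JJ := prod_tensor_linear oU1 lJ1 oU2 lJ2.
Let tGt : trilinear_family U Gt := ap_christoffel_trilinear oU bG lJ.
Let tGt2 : trilinear_family U2 Gt2 := ap_christoffel_trilinear oU2 bG2 lJ2.

Lemma self_adjoint2 y u v : U2 y -> G2 y u (J2 y v) = G2 y (J2 y u) v.
Proof. by move=> Uy; rewrite -[in LHS]isoJ2// JJ2. Qed.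

(** The vector whose dual under the fibre metric, times [phi], is the part of [Gt y u w] on vertical
    vectors due to the derivative of [phi]. Terms differentiating [phi] along the third argument
    vanish there, and self-adjointness moves [J2] onto [u]. *)
Definition mixed (y u w : V) : V2 :=
  dird phi (lsubmx y) (lsubmx u) *: rsubmx w +
  2^-1 *: (dird phi (lsubmx y) (lsubmx w) *: rsubmx u +
    dird phi (lsubmx y) (J1 (lsubmx y) (lsubmx w)) *: J2 (rsubmx y) (rsubmx u)).

Lemma ap_christoffel_vertical y u w (v2 : V2) : U y -> Gt y u w (row_mx 0 v2) =
  phi (lsubmx y) ^+ 2 * Gt2 (rsubmx y) (rsubmx u) (rsubmx w) v2 +
  phi (lsubmx y) * G2 (rsubmx y) (mixed y u w) v2.
Proof.
move=> Uy; have [Uy1 Uy2] := Uy.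
rewrite (ap_christoffel_warped oU1 bG1 lJ1 oU2 sG2 bG2 lJ2 isoJ2 sphi)//.
rewrite row_mxKl row_mxKr.
have tGt1 := ap_christoffel_trilinear oU1 bG1 lJ1.
rewrite (linear_zero (trilinear_family3 _ _ tGt1 Uy1)) (linear_zero (lJ1.1 _ Uy1)).
rewrite !(linear_zero (dird_linear _ _)) !mul0r addr0 mulr0 subr0 add0r.
have l1 v := bilinear_family1 v bG2 Uy2.
rewrite /mixed (linear_add (l1 _)) !(linear_scale _ _ (l1 _)) (linear_add (l1 _)).
by rewrite !(linear_scale _ _ (l1 _)) self_adjoint2.
Qed.

Local Notation L := (local_flat GG JJ X Y).

(** The metric term <dY X, .> has the factor phi^2 on the fibre; one [phi] stays outside, the other
    is absorbed here next to the mixed vector. *)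
Definition flat_mixed (y : V) : V2 :=
  phi (lsubmx y) *: rsubmx (dird Y y (X y)) + mixed y (X y) (Y y).

Lemma local_flat_family : linear_family U L.
Proof.
have sdY := smooth_on_dird_along oU sY sX.
split=> [y Uy|v].
  apply: linear_addf; first exact: trilinear_family3 tGt Uy.
  exact: bilinear_family2 bG Uy.
apply: smooth_on_add => //.
  exact: trilinear_family_apply oU tGt sX sY (smooth_on_cst _ v).
exact: bilinear_family_apply oU bG sdY (smooth_on_cst _ v).
Qed.

Lemma local_flat_vertical y v2 : U y -> L y (row_mx 0 v2) =
  phi (lsubmx y) ^+ 2 * Gt2 (rsubmx y) (rsubmx (X y)) (rsubmx (Y y)) v2 +
  phi (lsubmx y) * G2 (rsubmx y) (flat_mixed y) v2.
Proof.
move=> Uy; have [Uy1 Uy2] := Uy.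
rewrite /local_flat ap_christoffel_vertical// /warped_form row_mxKl row_mxKr.
rewrite (linear_zero (bilinear_family2 _ bG1 Uy1)) add0r /flat_mixed.
have l1 v := bilinear_family1 v bG2 Uy2.
rewrite [in RHS](linear_add (l1 v2)) (linear_scale _ _ (l1 v2)) /GRing.scale/=.
by ring.
Qed.

Definition flat_sharp (y : V) : V1 := sharp G1 (lsubmx y) (fun v1 => L y (row_mx v1 0)).

Lemma flat_sharpP y v1 : U y -> G1 (lsubmx y) (flat_sharp y) v1 = L y (row_mx v1 0).
Proof.
move=> Uy; have [Uy1 Uy2] := Uy.
rewrite (@sharpP _ _ G1 (lsubmx y) (fun v1 => L y (row_mx v1 0)) v1)// => [v|u|u|].
- exact: bilinear_family1 bG1 Uy1.
- exact: bilinear_family2 bG1 Uy1.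
- exact: nd1.
- exact: (linear_compf (local_flat_family.1 _ Uy) (@row_mx_linear_l _ _ _)).
Qed.

Lemma flat_sharp_smooth : smooth_on U flat_sharp.
Proof.
apply: (smooth_on_sharp oU oU1 _ _ bG1 nd1) => [y []//||v].
  exact: (linear_smooth_on (@lsubmx_linear R n1 n2)
    (linear_rV_continuous (@lsubmx_linear R n1 n2))).
exact: local_flat_family.2.
Qed.

(* The pairing of Gt (Z, w, .) with L, extended through the degenerate points. *)
Definition pairing (y w : V) : R^o :=
  Gt y (Z y) w (row_mx (flat_sharp y) 0) +
  (phi (lsubmx y) ^+ 2 *
     qs (rsubmx y) (rsubmx (Z y)) (rsubmx w) (rsubmx (X y)) (rsubmx (Y y)) +
   phi (lsubmx y) * Gt2 (rsubmx y) (rsubmx (Z y)) (rsubmx w) (flat_mixed y) +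
   phi (lsubmx y) * Gt2 (rsubmx y) (rsubmx (X y)) (rsubmx (Y y)) (mixed y (Z y) w) +
   G2 (rsubmx y) (mixed y (Z y) w) (flat_mixed y)).

Definition nabla_ext (y w : V) : R^o := dird (fun y' => L y' w) y (Z y) - pairing y w.

Lemma row_split_linear (h : V -> R^o) v : linear h ->
  h v = h (row_mx (lsubmx v) 0) + h (row_mx 0 (rsubmx v)).
Proof. by move=> lh; rewrite -linear_add// -row_mx_split hsubmxK. Qed.

(** On the base, nondegeneracy supplies the vector. On the fibre, phi s = phi^2 (phi^-1 s) where
    [phi] is nonzero; where it vanishes both sides are zero, whatever the value of the inverse. *)
Lemma representable_warped y (h : V -> R^o) : U y -> linear h ->
  (exists s, forall w2, h (row_mx 0 w2) = phi (lsubmx y) * G2 (rsubmx y) s w2) ->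
  representable (GG y) h.
Proof.
move=> [Uy1 Uy2] lh [s hs].
pose t := sharp G1 (lsubmx y) (fun v1 => h (row_mx v1 0)).
exists (row_mx t ((phi (lsubmx y))^-1 *: s)) => w.
rewrite (row_split_linear w lh) hs /warped_form row_mxKl row_mxKr; congr (_ + _).
  rewrite (@sharpP _ _ G1 (lsubmx y) (fun v1 => h (row_mx v1 0)))// => [v|u|u|].
  - exact: bilinear_family1 bG1 Uy1.
  - exact: bilinear_family2 bG1 Uy1.
  - exact: nd1.
  - exact: (linear_compf lh (@row_mx_linear_l _ _ _)).
rewrite (linear_scale _ _ (bilinear_family1 _ bG2 Uy2)) /GRing.scale/=.
have [->|p0] := eqVneq (phi (lsubmx y)) 0; first by rewrite expr0n !mul0r.
by field.
Qed.

Lemma ap_christoffel_representable y u w : U y -> representable (GG y) (Gt y u w).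
Proof.
move=> Uy; have [Uy1 Uy2] := Uy.
apply: representable_warped Uy (trilinear_family3 _ _ tGt Uy) _.
have l1 v := bilinear_family1 v bG2 Uy2.
have [s hs] := rep2 (rsubmx u) (rsubmx w) Uy2.
exists (phi (lsubmx y) *: s + mixed y u w) => w2.
rewrite ap_christoffel_vertical// hs (linear_add (l1 w2) (_ *: s)) (linear_scale _ _ (l1 _)).
by rewrite /GRing.scale/=; ring.
Qed.

(** The two alternatives are the situations met at a point of constant signature. If [phi] is
    nonzero, dividing the vertical parts by phi^2 gives representatives, and expanding their product
    gives the four fibre terms. If [phi] vanishes, only base parts pair. *)
Lemma pairing_regular y w : U y ->
  (phi (lsubmx y) != 0 /\ forall r s,
     (forall a, Gt2 (rsubmx y) (rsubmx (Z y)) (rsubmx w) a = G2 (rsubmx y) r a) ->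
     (forall a, Gt2 (rsubmx y) (rsubmx (X y)) (rsubmx (Y y)) a = G2 (rsubmx y) s a) ->
     qs (rsubmx y) (rsubmx (Z y)) (rsubmx w) (rsubmx (X y)) (rsubmx (Y y)) =
     G2 (rsubmx y) r s) \/
  (phi (lsubmx y) = 0 /\ ((forall u, dird phi (lsubmx y) u = 0) \/
     (forall u v, G2 (rsubmx y) u v = 0))) ->
  exists r s, [/\ forall v, Gt y (Z y) w v = GG y r v, forall v, L y v = GG y s v &
    GG y r s = pairing y w].
Proof.
move=> Uy; have [Uy1 Uy2] := Uy.
have lGt := trilinear_family3 (Z y) w tGt Uy.
have lL := local_flat_family.1 _ Uy.
have l1 v := bilinear_family1 v bG2 Uy2.
have G2lin a t d v : G2 (rsubmx y) (a + t *: d) v = G2 (rsubmx y) a v + t * G2 (rsubmx y) d v.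
  by rewrite (linear_add (l1 _)) (linear_scale _ _ (l1 _)).
pose r1 := sharp G1 (lsubmx y) (fun v1 => Gt y (Z y) w (row_mx v1 0)).
have r1P v1 : G1 (lsubmx y) r1 v1 = Gt y (Z y) w (row_mx v1 0).
  rewrite (@sharpP _ _ G1 (lsubmx y) (fun v1 => Gt y (Z y) w (row_mx v1 0)) v1)// => [v|u|u|].
  - exact: bilinear_family1 bG1 Uy1.
  - exact: bilinear_family2 bG1 Uy1.
  - exact: nd1.
  - exact: (linear_compf lGt (@row_mx_linear_l _ _ _)).
case=> [[p0 hq]|[p0 hd]].
  have [r2 hr2] := rep2 (rsubmx (Z y)) (rsubmx w) Uy2.
  have [s2 hs2] := rep2 (rsubmx (X y)) (rsubmx (Y y)) Uy2.
  exists (row_mx r1 (r2 + (phi (lsubmx y))^-1 *: mixed y (Z y) w)).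
  exists (row_mx (flat_sharp y) (s2 + (phi (lsubmx y))^-1 *: flat_mixed y)).
  split=> [v|v|]; rewrite /warped_form !row_mxKl !row_mxKr.
  - rewrite (row_split_linear v lGt) r1P ap_christoffel_vertical// hr2; congr (_ + _).
    by rewrite (G2lin r2); field.
  - rewrite (row_split_linear v lL) flat_sharpP// local_flat_vertical// hs2; congr (_ + _).
    by rewrite (G2lin s2); field.
  - rewrite r1P /pairing (hq _ _ hr2 hs2) hr2 hs2; congr (_ + _).
    rewrite (G2lin r2) ![G2 _ _ (s2 + _)]sG2 !(G2lin s2) [G2 _ s2 r2]sG2.
    by rewrite [G2 _ (flat_mixed y) r2]sG2 [G2 _ (flat_mixed y) (mixed _ _ _)]sG2; field.
(* This is the one fibre term of [pairing] without a factor [phi], so it must vanish by itself; each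
   summand of [mixed] contains a derivative of [phi]. *)
have gz : G2 (rsubmx y) (mixed y (Z y) w) (flat_mixed y) = 0.
  case: hd => [dphi0|G20]; last exact: G20.
  by rewrite /mixed !dphi0 !scale0r addr0 scaler0 addr0 (linear_zero (l1 _)).
exists (row_mx r1 0), (row_mx (flat_sharp y) 0).
split=> [v|v|]; rewrite /warped_form !row_mxKl !row_mxKr p0 expr0n mul0r addr0.
- by rewrite (row_split_linear v lGt) r1P ap_christoffel_vertical// p0 expr0n !mul0r !addr0.
- rewrite (row_split_linear v lL) flat_sharpP// local_flat_vertical// p0.
  by rewrite expr0n !mul0r !addr0.
- by rewrite r1P /pairing p0 expr0n !mul0r gz !addr0.
Qed.

Lemma smooth_on_lsub_field (A : V -> V) : smooth_on U A -> smooth_on U (fun y => lsubmx (A y)).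
Proof.
exact: (smooth_on_linear_comp (@lsubmx_linear R n1 n2)
  (linear_rV_continuous (@lsubmx_linear R n1 n2))).
Qed.

Lemma smooth_on_rsub_field (A : V -> V) : smooth_on U A -> smooth_on U (fun y => rsubmx (A y)).
Proof.
exact: (smooth_on_linear_comp (@rsubmx_linear R n1 n2)
  (linear_rV_continuous (@rsubmx_linear R n1 n2))).
Qed.

Lemma dphi_family : linear_family U (fun (y : V) (u : V1) => dird phi (lsubmx y) u).
Proof.
split=> [y _|v]; first exact: dird_linear.
exact: (smooth_on_lsub oU1 oU2 (smooth_on_dird v sphi)).
Qed.

Lemma J1_family : linear_family U (fun (y : V) (u : V1) => J1 (lsubmx y) u).
Proof.
split=> [y [Uy1 _]|v]; first exact: lJ1.1.
exact: (smooth_on_lsub oU1 oU2 (lJ1.2 v)).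
Qed.

Lemma J2_family : linear_family U (fun (y : V) (u : V2) => J2 (rsubmx y) u).
Proof.
split=> [y [_ Uy2]|v]; first exact: lJ2.1.
exact: (smooth_on_rsub oU1 oU2 (lJ2.2 v)).
Qed.

Lemma mixed_smooth (A B : V -> V) : smooth_on U A -> smooth_on U B ->
  smooth_on U (fun y => mixed y (A y) (B y)).
Proof.
move=> sA sB.
have lA := smooth_on_lsub_field sA; have lB := smooth_on_lsub_field sB.
have rA := smooth_on_rsub_field sA; have rB := smooth_on_rsub_field sB.
have dA := linear_family_apply oU dphi_family lA.
have dB := linear_family_apply oU dphi_family lB.
have jB := linear_family_apply oU J1_family lB.
have djB := linear_family_apply oU dphi_family jB.
have jA := linear_family_apply oU J2_family rA.
apply: smooth_on_add => //; first exact: smooth_on_scalev.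
apply: smooth_on_scale => //; apply: smooth_on_add => //; exact: smooth_on_scalev.
Qed.

Let sphi_l : smooth_on U (fun y => phi (lsubmx y)).
Proof. exact: (smooth_on_lsub oU1 oU2 sphi). Qed.

Let sphi_l2 : smooth_on U (fun y => phi (lsubmx y) ^+ 2 : R^o).
Proof.
by apply: (smooth_on_ext oU _ (smooth_on_mul oU sphi_l sphi_l)) => y _; rewrite expr2.
Qed.

Lemma flat_mixed_smooth : smooth_on U flat_mixed.
Proof.
apply: smooth_on_add => //; last exact: mixed_smooth.
apply: smooth_on_scalev => //; apply: smooth_on_rsub_field.
exact: smooth_on_dird_along.
Qed.

Let vert (A : V -> V2) (y : V) : V := row_mx 0 (A y).

Let vert_smooth (A : V -> V2) : smooth_on U A -> smooth_on U (vert A).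
Proof. by move=> sA; apply: smooth_on_row_mx => //; exact: smooth_on_cst. Qed.

Let tP3 := trilinear_family_rsub oU1 oU2 tGt2.
Let bP2 := bilinear_family_rsub oU1 oU2 bG2.

Lemma quad_sum_smooth (W : V -> V) : smooth_on U W -> smooth_on U (fun y =>
  qs (rsubmx y) (rsubmx (Z y)) (rsubmx (W y)) (rsubmx (X y)) (rsubmx (Y y))).
Proof.
move=> sW.
have sX2 i := smooth_on_coord i oU (smooth_on_rsub_field sX).
have sY2 i := smooth_on_coord i oU (smooth_on_rsub_field sY).
have sZ2 i := smooth_on_coord i oU (smooth_on_rsub_field sZ).
have sW2 i := smooth_on_coord i oU (smooth_on_rsub_field sW).
apply: smooth_on_sum => // i _; apply: smooth_on_sum => // k _.
apply: smooth_on_sum => // l _; apply: smooth_on_mul => //.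
  apply: smooth_on_mul => //; exact: smooth_on_mul.
apply: smooth_on_sum => // j _; apply: smooth_on_mul => //.
exact: (smooth_on_rsub oU1 oU2 (sc i j k l)).
Qed.

Lemma nabla_ext_smooth (W : V -> V) : smooth_on U W -> smooth_on U (fun y => nabla_ext y (W y)).
Proof.
move=> sW; have sfm := flat_mixed_smooth; have smx := mixed_smooth sZ sW.
have sl : smooth_on U (fun y => dird (fun y' => L y' (W y)) y (Z y)).
  exact: (linear_family_apply oU (linear_family_dird_fam oU local_flat_family sZ) sW).
have sh : smooth_on U (fun y => row_mx (flat_sharp y) (0 : V2)).
  by apply: smooth_on_row_mx => //; [exact: flat_sharp_smooth|exact: smooth_on_cst].
have s1 := trilinear_family_apply oU tGt sZ sW sh.
have s2 := smooth_on_mul oU sphi_l2 (quad_sum_smooth sW).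
have s3 : smooth_on U (fun y => Gt2 (rsubmx y) (rsubmx (Z y)) (rsubmx (W y)) (flat_mixed y)).
  apply: (smooth_on_ext oU _ (trilinear_family_apply oU tP3 sZ sW (vert_smooth sfm))) => y _.
  by rewrite row_mxKr.
have s4 : smooth_on U (fun y => Gt2 (rsubmx y) (rsubmx (X y)) (rsubmx (Y y)) (mixed y (Z y) (W y))).
  apply: (smooth_on_ext oU _ (trilinear_family_apply oU tP3 sX sY (vert_smooth smx))) => y _.
  by rewrite row_mxKr.
have s5 : smooth_on U (fun y => G2 (rsubmx y) (mixed y (Z y) (W y)) (flat_mixed y)).
  apply: (smooth_on_ext oU _ (bilinear_family_apply oU bP2 (vert_smooth smx) (vert_smooth sfm))).
  by move=> y _; rewrite !row_mxKr.
have s34 := smooth_on_add oU (smooth_on_add oU s2 (smooth_on_mul oU sphi_l s3))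
  (smooth_on_mul oU sphi_l s4).
have sp := smooth_on_add oU s1 (smooth_on_add oU s34 s5).
apply: (smooth_on_ext oU _ (smooth_on_add oU sl (smooth_on_scale (-1) oU sp))) => y _.
by rewrite /nabla_ext /pairing scaleN1r.
Qed.

Lemma mixed_linear y u : U y -> linear (mixed y u).
Proof.
move=> [Uy1 Uy2] a v w; rewrite /mixed !linearP lJ1.1//.
rewrite !(linear_add (dird_linear _ _)) !(linear_scale _ _ (dird_linear _ _)).
rewrite /GRing.scale/=; apply/rowP => j; rewrite !mxE; ring.
Qed.

Lemma nabla_ext_linear y : U y -> linear (nabla_ext y).
Proof.
move=> Uy; have [Uy1 Uy2] := Uy.
have lm := mixed_linear (Z y) Uy.
have l1 v := bilinear_family1 v bG2 Uy2.
have lD : linear (fun w => dird (fun y' => L y' w) y (Z y)).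
  by have [h _] := linear_family_dird_fam oU local_flat_family sZ; exact: h.
apply: linear_addf => //; apply: linear_oppf.
apply: linear_addf; first exact: trilinear_family2 tGt Uy.
apply: linear_addf; last exact: (linear_compf (l1 _) lm).
apply: linear_addf; last first.
  by apply: linear_scalef; exact: (linear_compf (trilinear_family3 _ _ tGt2 Uy2) lm).
apply: linear_addf; apply: linear_scalef.
  exact: (linear_compf (@quad_sum_linear _ _ _ _ _ _) (@rsubmx_linear _ _ _)).
exact: (linear_compf (trilinear_family2 _ _ tGt2 Uy2) (@rsubmx_linear _ _ _)).
Qed.

(** Vertical vectors are those on which a factor [phi] has to be exhibited. The product rule applied
    to phi^2 A + phi B leaves a single term without it, the derivative of [phi] times the dual of
    [flat_mixed]. *)
Lemma dird_flat_vertical y (w2 : V2) : U y ->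
  dird (fun y' => L y' (row_mx 0 w2)) y (Z y) =
  phi (lsubmx y) ^+ 2 *
    (dird (fun y' => Gt2 y' (rsubmx (X y)) (rsubmx (Y y)) w2) (rsubmx y) (rsubmx (Z y)) +
     Gt2 (rsubmx y) (rsubmx (dird X y (Z y))) (rsubmx (Y y)) w2 +
     Gt2 (rsubmx y) (rsubmx (X y)) (rsubmx (dird Y y (Z y))) w2) +
  2 * phi (lsubmx y) * dird phi (lsubmx y) (lsubmx (Z y)) *
    Gt2 (rsubmx y) (rsubmx (X y)) (rsubmx (Y y)) w2 +
  phi (lsubmx y) *
    (dird (fun y' => G2 y' (flat_mixed y) w2) (rsubmx y) (rsubmx (Z y)) +
     G2 (rsubmx y) (rsubmx (dird (vert flat_mixed) y (Z y))) w2) +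
  dird phi (lsubmx y) (lsubmx (Z y)) * G2 (rsubmx y) (flat_mixed y) w2.
Proof.
move=> Uy; have [Uy1 Uy2] := Uy; pose w : V := row_mx 0 w2.
pose A (y : V) : R^o := Gt2 (rsubmx y) (rsubmx (X y)) (rsubmx (Y y)) (rsubmx w).
pose B (y : V) : R^o := G2 (rsubmx y) (rsubmx (vert flat_mixed y)) (rsubmx w).
pose C (y : V) : R^o := phi (lsubmx y).
have sw : smooth_on U (fun=> w) by exact: smooth_on_cst.
have sv := vert_smooth flat_mixed_smooth.
have sA : smooth_on U A by exact: (trilinear_family_apply oU tP3 sX sY sw).
have sB : smooth_on U B by exact: (bilinear_family_apply oU bP2 sv sw).
have sCC := smooth_on_mul oU sphi_l sphi_l.
have dA := smooth_on_differentiable sA Uy; have dB := smooth_on_differentiable sB Uy.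
have dC := smooth_on_differentiable sphi_l Uy; have dCC := smooth_on_differentiable sCC Uy.
have dCCA := smooth_on_differentiable (smooth_on_mul oU sCC sA) Uy.
have dCB := smooth_on_differentiable (smooth_on_mul oU sphi_l sB) Uy.
have e y' : U y' -> C y' * C y' * A y' + C y' * B y' = L y' w.
  by move=> Uy'; rewrite local_flat_vertical// /A /B /vert /w !row_mxKr expr2.
rewrite (open_eq_dird _ oU e Uy); last exact: differentiableD.
rewrite dirdD// (dirdM _ dCC dA) (dirdM _ dC dC) (dirdM _ dC dB).
have eC : dird C y (Z y) = dird phi (lsubmx y) (lsubmx (Z y)).
  by apply: dird_lsub; exact: smooth_on_differentiable sphi Uy1.
have eA : dird A y (Z y) =
    dird (fun y' => Gt2 y' (rsubmx (X y)) (rsubmx (Y y)) w2) (rsubmx y) (rsubmx (Z y)) +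
     Gt2 (rsubmx y) (rsubmx (dird X y (Z y))) (rsubmx (Y y)) w2 +
     Gt2 (rsubmx y) (rsubmx (X y)) (rsubmx (dird Y y (Z y))) w2.
  rewrite (trilinear_family_dird _ oU tP3 sX sY sw Uy) dird_cst linear0 /w row_mxKr.
  rewrite (linear_zero (trilinear_family3 _ _ tGt2 Uy2)) addr0; congr (_ + _ + _).
  apply: (dird_rsub (h := fun y' => Gt2 y' (rsubmx (X y)) (rsubmx (Y y)) w2)).
  exact: smooth_on_differentiable (trilinear_family_smooth _ _ _ tGt2) Uy2.
have eB : dird B y (Z y) = dird (fun y' => G2 y' (flat_mixed y) w2) (rsubmx y) (rsubmx (Z y)) +
     G2 (rsubmx y) (rsubmx (dird (vert flat_mixed) y (Z y))) w2.
  rewrite (bilinear_family_dird _ oU bP2 sv sw Uy) dird_cst linear0 /w row_mxKr.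
  rewrite (linear_zero (bilinear_family2 _ bG2 Uy2)) addr0; congr (_ + _); last first.
    by rewrite row_mxKr.
  rewrite /vert !row_mxKr.
  apply: (dird_rsub (h := fun y' => G2 y' (flat_mixed y) w2)).
  exact: smooth_on_differentiable (metric_smooth bG2 _ _) Uy2.
by rewrite eC eA eB /A /B /C /vert /w !row_mxKr; ring.
Qed.

(** On a vertical vector [mixed] reduces to the derivative of [phi] along [Z] times [w2]. Again a
    single term lacks the factor [phi]; it equals the one in the derivative of [L], so [nabla_ext]
    is divisible by [phi] on the fibre. *)
Lemma pairing_vertical y (w2 : V2) : U y -> pairing y (row_mx 0 w2) =
  phi (lsubmx y) ^+ 2 *
    qs (rsubmx y) (rsubmx (Z y)) w2 (rsubmx (X y)) (rsubmx (Y y)) +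
  phi (lsubmx y) * Gt2 (rsubmx y) (rsubmx (Z y)) w2 (flat_mixed y) +
  phi (lsubmx y) * dird phi (lsubmx y) (lsubmx (Z y)) *
    Gt2 (rsubmx y) (rsubmx (X y)) (rsubmx (Y y)) w2 +
  dird phi (lsubmx y) (lsubmx (Z y)) * G2 (rsubmx y) (flat_mixed y) w2 -
  phi (lsubmx y) * (2^-1 * (dird phi (lsubmx y) (flat_sharp y) * G2 (rsubmx y) (rsubmx (Z y)) w2 +
    dird phi (lsubmx y) (J1 (lsubmx y) (flat_sharp y)) *
      G2 (rsubmx y) (J2 (rsubmx y) (rsubmx (Z y))) w2)).
Proof.
move=> Uy; have [Uy1 Uy2] := Uy.
have em : mixed y (Z y) (row_mx 0 w2) = dird phi (lsubmx y) (lsubmx (Z y)) *: w2.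
  rewrite /mixed row_mxKl row_mxKr (linear_zero (lJ1.1 _ Uy1)).
  by rewrite !(linear_zero (dird_linear _ _)) !scale0r addr0 scaler0 addr0.
have eG : Gt y (Z y) (row_mx 0 w2) (row_mx (flat_sharp y) 0) =
    - (phi (lsubmx y) * (2^-1 * (dird phi (lsubmx y) (flat_sharp y) * G2 (rsubmx y) (rsubmx (Z y)) w2 +
    dird phi (lsubmx y) (J1 (lsubmx y) (flat_sharp y)) *
      G2 (rsubmx y) (J2 (rsubmx y) (rsubmx (Z y))) w2))).
  rewrite (ap_christoffel_warped oU1 bG1 lJ1 oU2 sG2 bG2 lJ2 isoJ2 sphi)//.
  rewrite !row_mxKl !row_mxKr.
  have tGt1 := ap_christoffel_trilinear oU1 bG1 lJ1.
  rewrite (linear_zero (trilinear_family2 _ _ tGt1 Uy1)).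
  rewrite (linear_zero (trilinear_family3 _ _ tGt2 Uy2)).
  rewrite !(linear_zero (bilinear_family2 _ bG2 Uy2)) (linear_zero (lJ1.1 _ Uy1)).
  rewrite !(linear_zero (dird_linear _ _)) (self_adjoint2 (rsubmx (Z y)) w2 Uy2).
  by ring.
rewrite /pairing eG em !row_mxKr.
rewrite (linear_scale _ _ (trilinear_family3 _ _ tGt2 Uy2)).
rewrite (linear_scale _ _ (bilinear_family1 _ bG2 Uy2)) /GRing.scale/=.
by rewrite [G2 _ w2 _]sG2; ring.
Qed.

Lemma nabla_ext_representable y : U y -> representable (GG y) (nabla_ext y).
Proof.
move=> Uy; have [Uy1 Uy2] := Uy.
have l1 v := bilinear_family1 v bG2 Uy2.
(* This is the vertical part of [nabla_ext] with one [phi] divided out. The hypothesis [diff2]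
   covers the first summand; the term with [flat_mixed] as second argument of [Gt2] arises from
   metric compatibility. *)
have [s hs] : representable (G2 (rsubmx y)) (fun w2 : V2 =>
    phi (lsubmx y) * (dird (fun y' => Gt2 y' (rsubmx (X y)) (rsubmx (Y y)) w2) (rsubmx y) (rsubmx (Z y))
       - qs (rsubmx y) (rsubmx (Z y)) w2 (rsubmx (X y)) (rsubmx (Y y))) +
    phi (lsubmx y) * Gt2 (rsubmx y) (rsubmx (dird X y (Z y))) (rsubmx (Y y)) w2 +
    phi (lsubmx y) * Gt2 (rsubmx y) (rsubmx (X y)) (rsubmx (dird Y y (Z y))) w2 +
    dird phi (lsubmx y) (lsubmx (Z y)) * Gt2 (rsubmx y) (rsubmx (X y)) (rsubmx (Y y)) w2 +
    Gt2 (rsubmx y) (rsubmx (Z y)) (flat_mixed y) w2 +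
    G2 (rsubmx y) (rsubmx (dird (vert flat_mixed) y (Z y))) w2 +
    2^-1 * (dird phi (lsubmx y) (flat_sharp y) * G2 (rsubmx y) (rsubmx (Z y)) w2 +
      dird phi (lsubmx y) (J1 (lsubmx y) (flat_sharp y)) *
        G2 (rsubmx y) (J2 (rsubmx y) (rsubmx (Z y))) w2)).
  have rr u v := rep2 u v Uy2; have rm a := representable_metric (G2 (rsubmx y)) a.
  have h1 := representableZ l1 (phi (lsubmx y))
    (diff2 (rsubmx (Z y)) (rsubmx (X y)) (rsubmx (Y y)) Uy2).
  have h2 := representableZ l1 (phi (lsubmx y)) (rr (rsubmx (dird X y (Z y))) (rsubmx (Y y))).
  have h3 := representableZ l1 (phi (lsubmx y)) (rr (rsubmx (X y)) (rsubmx (dird Y y (Z y)))).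
  have h4 := representableZ l1 (dird phi (lsubmx y) (lsubmx (Z y)))
    (rr (rsubmx (X y)) (rsubmx (Y y))).
  have h5 := rr (rsubmx (Z y)) (flat_mixed y).
  have h6 := rm (rsubmx (dird (vert flat_mixed) y (Z y))).
  have h71 := representableZ l1 (dird phi (lsubmx y) (flat_sharp y)) (rm (rsubmx (Z y))).
  have h72 := representableZ l1 (dird phi (lsubmx y) (J1 (lsubmx y) (flat_sharp y)))
    (rm (J2 (rsubmx y) (rsubmx (Z y)))).
  have h7 := representableZ l1 2^-1 (representableD l1 h71 h72).
  exact: (representableD l1 (representableD l1 (representableD l1 (representableD l1
    (representableD l1 (representableD l1 h1 h2) h3) h4) h5) h6) h7).
have hv w2 : nabla_ext y (row_mx 0 w2) = phi (lsubmx y) * G2 (rsubmx y) s w2.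
  rewrite /nabla_ext dird_flat_vertical// pairing_vertical// -hs.
  rewrite (ap_christoffel_metric oU2 sG2 bG2 lJ2 isoJ2 _ _ _ Uy2).
  by ring.
apply: representable_warped Uy (nabla_ext_linear Uy) _.
by exists s.
Qed.

End WarpedPairing.

(** * Charts and tensors of a product manifold *)

Section ProductManifold.
Context {R : realType} {B F : charted_space R}.
Local Notation P := (prod_space B F).
Local Notation V := 'rV[R]_(mdim B + mdim F).
Implicit Types (p q x : P).

Local Notation cm p := (cmap (chart_at p)).
Local Notation ci p := (cinv (chart_at p)).
Local Notation Om p := (chart_image (chart_at p)).
Local Notation D p := (cdom (chart_at p)).

Lemma prod_chart_image m n (S T : Type) (c : chart R m S) (d : chart R n T) :
  chart_image (prod_chart c d) = prod_set (chart_image c) (chart_image d).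
Proof.
apply/seteqP; split=> [_ [[s t] [/= Ds Dt] <-]|y [[s Ds es] [t Dt et]]].
  by split; rewrite /= ?row_mxKl ?row_mxKr; [exists s|exists t].
by exists (s, t) => //=; rewrite es et hsubmxK.
Qed.

Lemma prod_is_chart m n (S T : topologicalType) (c : chart R m S) (d : chart R n T) :
  is_chart c -> is_chart d -> is_chart (prod_chart c d).
Proof.
move=> [oDc oIc cK cc ci] [oDd oId dK cd di]; split.
- exact: prod_open.
- by rewrite prod_chart_image; exact: prod_set_open.
- by move=> [s t] [/= Ds Dt]; rewrite row_mxKl row_mxKr cK// dK.
- move=> [s t] [/= Ds Dt]; apply: row_mx_continuous.
    by apply: (continuous_comp (f := fst)); [exact: cvg_fst|exact: cc].
  by apply: (continuous_comp (f := snd)); [exact: cvg_snd|exact: cd].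
- rewrite prod_chart_image => y [Iy1 Iy2].
  have c1 : {for y, continuous (cinv c \o (lsubmx : 'rV[R]_(m + n) -> 'rV[R]_m))}.
    apply: continuous_comp; last exact: ci.
    exact: linear_rV_continuous (@lsubmx_linear _ _ _) _.
  have c2 : {for y, continuous (cinv d \o (rsubmx : 'rV[R]_(m + n) -> 'rV[R]_n))}.
    apply: continuous_comp; last exact: di.
    exact: linear_rV_continuous (@rsubmx_linear _ _ _) _.
  exact: (cvg_pair c1 c2).
Qed.

Lemma chart_image_prod p : Om p = prod_set (Om p.1) (Om p.2).
Proof. exact: prod_chart_image. Qed.

Hypotheses (hB : smooth_manifold B) (hF : smooth_manifold F).

Lemma prod_smooth_manifold : smooth_manifold P.
Proof.
have [hausB scB chB trB] := hB; have [hausF scF chF trF] := hF; split.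
- exact: prod_hausdorff.
- exact: prod_second_countable.
- move=> p; have [c1 d1] := chB p.1; have [c2 d2] := chF p.2.
  by split; [exact: prod_is_chart|split].
- move=> p q.
  have oB := overlap_open hB (p := p.1) (q := q.1).
  have oF := overlap_open hF (p := p.2) (q := q.2).
  apply: (@smooth_on_sub _ _ _ (prod_set (overlap p.1 q.1) (overlap p.2 q.2))).
    move=> _ [[s t] [[/= Dp1 Dp2] [/= Dq1 Dq2]] <-] /=.
    by split; rewrite ?row_mxKl ?row_mxKr; exact: in_overlap.
  apply: smooth_on_row_mx; first exact: prod_set_open.
    exact: (smooth_on_lsub oB oF (transition_smooth hB p.1 q.1)).
  exact: (smooth_on_rsub oB oF (transition_smooth hF p.2 q.2)).
Qed.

Lemma coord_change_prod p q x (v : V) : D p.1 x.1 -> D q.1 x.1 -> D p.2 x.2 -> D q.2 x.2 ->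
  coord_change p q x v =
  row_mx (coord_change p.1 q.1 x.1 (lsubmx v)) (coord_change p.2 q.2 x.2 (rsubmx v)).
Proof.
move=> Dp1 Dq1 Dp2 Dq2; rewrite /coord_change.
have d1 := transition_diff hB Dp1 Dq1; have d2 := transition_diff hF Dp2 Dq2.
set y : V := cm p x.
have ey1 : lsubmx y = cm p.1 x.1 by rewrite /y /= row_mxKl.
have ey2 : rsubmx y = cm p.2 x.2 by rewrite /y /= row_mxKr.
rewrite -ey1 in d1 *; rewrite -ey2 in d2 *.
have oB := overlap_open hB (p := p.1) (q := q.1).
have oF := overlap_open hF (p := p.2) (q := q.2).
have Uy : prod_set (overlap p.1 q.1) (overlap p.2 q.2) y.
  by split; rewrite ?ey1 ?ey2; exact: in_overlap.
have dl : differentiable (fun z : V => transition p.1 q.1 (lsubmx z)) y.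
  exact: smooth_on_differentiable (smooth_on_lsub oB oF (transition_smooth hB p.1 q.1)) Uy.
have dr : differentiable (fun z : V => transition p.2 q.2 (rsubmx z)) y.
  exact: smooth_on_differentiable (smooth_on_rsub oB oF (transition_smooth hF p.2 q.2)) Uy.
have [_ e] := is_diff_row_mx dl dr.
rewrite -(dird_lsub _ d1) -(dird_rsub _ d2) -e.
by [].
Qed.

Lemma tvec_prod p x (v : V) : D p x ->
  tvec p x v = row_mx (tvec p.1 x.1 (lsubmx v)) (tvec p.2 x.2 (rsubmx v)) :> V.
Proof.
move=> [D1 D2]; rewrite !tvecE coord_change_prod//; exact: chart_at_dom.
Qed.

Lemma tcoord_prod p x (v : V) : D p x ->
  tcoord p x v = row_mx (tcoord p.1 x.1 (lsubmx v)) (tcoord p.2 x.2 (rsubmx v)) :> V.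
Proof.
move=> [D1 D2]; rewrite !tcoordE coord_change_prod//; exact: chart_at_dom.
Qed.

Section Tensors.
Variables (gB : tensor02 B) (J1 : tensor11 B) (gF : tensor02 F) (J2 : tensor11 F) (f : B -> R).
Local Notation g := (warped_metric gB gF f).
Local Notation J := (prod_structure J1 J2).

Lemma local_warped_metric p (y u v : V) : Om p y -> local_metric g p y u v =
  warped_form (local_metric gB p.1) (local_metric gF p.2) (f \o ci p.1) y u v.
Proof.
move=> Oy; have Dy : D p (ci p y) := cinv_dom prod_smooth_manifold Oy.
by rewrite /local_metric !(tvec_prod _ Dy) /warped_metric !row_mxKl !row_mxKr.
Qed.

Lemma local_prod_structure p (y v : V) : Om p y -> local_tensor J p y v =
  prod_tensor (local_tensor J1 p.1) (local_tensor J2 p.2) y v.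
Proof.
move=> Oy; have Dy : D p (ci p y) := cinv_dom prod_smooth_manifold Oy.
by rewrite /local_tensor (tvec_prod _ Dy) (tcoord_prod _ Dy) /prod_structure
  !row_mxKl !row_mxKr.
Qed.

Hypotheses (hgB : singular_metric gB) (hgF : singular_metric gF).
Hypotheses (hJ1 : almost_product_structure gB J1) (hJ2 : almost_product_structure gF J2).
Hypothesis hf : smooth_fun f.

Lemma warped_metric_singular : singular_metric g.
Proof.
have [sB lB smB] := hgB; have [sF lF smF] := hgF; split.
- by move=> x u v; rewrite /warped_metric sB sF.
- move=> x u a v w; rewrite /warped_metric !linearP lB lF.
  by rewrite /GRing.scale/= mulrDr mulrDr mulrCA addrACA.
- move=> p u v.
  have oO := chart_image_open prod_smooth_manifold (p := p).
  have oB := chart_image_open hB (p := p.1); have oF := chart_image_open hF (p := p.2).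
  have bB := local_metric_bilinear hgB p.1; have bF := local_metric_bilinear hgF p.2.
  have s := warped_form_smooth oB bB oF bF (hf p.1) u v.
  have s' : smooth_on (Om p) (warped_form (local_metric gB p.1) (local_metric gF p.2)
     (f \o ci p.1) ^~ u ^~ v).
    by apply: smooth_on_sub s => y Oy; rewrite -chart_image_prod.
  apply: (smooth_on_ext oO _ s') => y Oy.
  by rewrite -local_warped_metric.
Qed.

Lemma prod_structure_almost_product : almost_product_structure g J.
Proof.
have [l1 s1 JJ1 i1] := hJ1; have [l2 s2 JJ2 i2] := hJ2; split.
- move=> x a u v; rewrite /prod_structure !linearP l1 l2.
  by rewrite scale_row_mx add_row_mx.
- move=> p v.
  have oO := chart_image_open prod_smooth_manifold (p := p).
  have oB := chart_image_open hB (p := p.1); have oF := chart_image_open hF (p := p.2).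
  have [_ s] := prod_tensor_linear oB (local_tensor_linear hJ1 p.1) oF (local_tensor_linear hJ2 p.2).
  have s' : smooth_on (Om p) (prod_tensor (local_tensor J1 p.1) (local_tensor J2 p.2) ^~ v).
    by apply: smooth_on_sub (s v) => y Oy; rewrite -chart_image_prod.
  apply: (smooth_on_ext oO _ s') => y Oy.
  by rewrite -local_prod_structure.
- by move=> x v; rewrite /prod_structure !row_mxKl !row_mxKr JJ1 JJ2 hsubmxK.
- by move=> x u v; rewrite /warped_metric /prod_structure !row_mxKl !row_mxKr i1 i2.
Qed.

End Tensors.
End ProductManifold.

(** * Gluing along the constant signature region *)

Section Gluing.
Context {R : realType} {M : charted_space R}.
Hypothesis hM : smooth_manifold M.
Local Notation V := 'rV[R]_(mdim M).
Local Notation cm p := (cmap (chart_at p)).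
Local Notation ci p := (cinv (chart_at p)).
Local Notation Om p := (chart_image (chart_at p)).
Local Notation D p := (cdom (chart_at p)).
Variable g : tensor02 M.
Hypothesis hg : singular_metric g.

(** Representability is asked only at the centre [p], since the gluing uses at each point the
    extension centred there. *)
Definition local_extension (w : one_form M) (p : M) (U : set V) (e : one_form M) :=
  [/\ open U, U (cm p p), U `<=` Om p &
  [/\ forall W, smooth_vfield W -> smooth_on U (e W \o ci p : V -> R^o),
      forall W x, smooth_vfield W -> D p x -> U (cm p x) -> constant_signature_region g x ->
        e W x = w W x &
      exists u, represents g p u e]].

Lemma local_extension_continuous w p U e W x : local_extension w p U e -> smooth_vfield W ->
  D p x -> U (cm p x) -> {for x, continuous (e W : M -> R^o)}.
Proof.
move=> [oU _ UO [sE _ _]] sW Dx Ux.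
have h : {for x, continuous ((e W \o ci p : V -> R^o) \o cm p)}.
  apply: continuous_comp; first exact: cmap_continuous.
  exact: smooth_on_continuous (sE _ sW) Ux.
have e1 : \forall z \near x, ((e W \o ci p) \o cm p) z = e W z.
  have : \forall z \near x, D p z by apply: open_nbhs_nbhs; split=> //; exact: chart_dom_open.
  by apply: filterS => z Dz; rewrite /= (cinvK hM Dz).
move: h; rewrite /prop_for /continuous_at /= (cinvK hM Dx).
by apply: cvg_trans; apply: near_eq_cvg; apply: filterS e1 => z ->.
Qed.

(* Both sides are continuous and agree on the dense constant signature region. *)
Lemma local_extension_unique w p U e p' U' e' W x :
  local_extension w p U e -> local_extension w p' U' e' -> smooth_vfield W ->
  D p x -> U (cm p x) -> D p' x -> U' (cm p' x) -> e W x = e' W x.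
Proof.
move=> le le' sW Dx Ux Dx' Ux'; apply/eqP; rewrite -subr_eq0; apply/negP => /negP d0.
have c := local_extension_continuous le sW Dx Ux.
have c' := local_extension_continuous le' sW Dx' Ux'.
have cd : {for x, continuous ((e W : M -> R^o) - (e' W : M -> R^o))} by exact: continuousB.
have [oU _ _ [_ h _]] := le; have [oU' _ _ [_ h' _]] := le'.
pose A := [set z | D p z /\ U (cm p z)]; pose A' := [set z | D p' z /\ U' (cm p' z)].
have nA : nbhs x A by apply: open_nbhs_nbhs; split=> //; exact: chart_image_preimage_open.
have nA' : nbhs x A' by apply: open_nbhs_nbhs; split=> //; exact: chart_image_preimage_open.
have nd : nbhs x [set z | e W z - e' W z != 0].
  apply: (cd [set t : R^o | t != 0]); apply: open_nbhs_nbhs; split; last exact: d0.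
  exact: open_neq.
have : nbhs x ([set z | e W z - e' W z != 0] `&` (A `&` A')).
  exact: (filterI nd (filterI nA nA')).
rewrite nbhsE => -[N [oN Nx] NA].
have [z Oz Rz] := constant_signature_dense hM hg oN Nx.
have [/= dz [[Dz Uz] [Dz' Uz']]] := NA _ Oz.
by move: dz; rewrite h// h'// subrr eqxx.
Qed.

(** The glued form takes at each point the value of the extension centred at that point. Near a
    given point, uniqueness replaces all these choices by a single extension, which is smooth. *)
Lemma extension_glue (w : one_form M) :
  (forall p, exists U e, local_extension w p U e) ->
  exists2 e, A_bullet g e & forall Y, smooth_vfield Y -> forall p,
    constant_signature_region g p -> e Y p = w Y p.
Proof.
move=> loc.
pose Uf p := sval (cid (loc p)); pose ef p := sval (cid (svalP (cid (loc p)))).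
have le p : local_extension w p (Uf p) (ef p) := svalP (cid (svalP (cid (loc p)))).
exists (fun W p => ef p W p); last first.
  move=> W sW p Rp; have [_ Up _ [_ h _]] := le p; apply: h => //; exact: chart_at_dom.
apply: A_bullet_intro => // [W sW p|p]; last first.
  by have [_ _ _ [_ _ [u hu]]] := le p; exists u => W sW; rewrite hu.
apply: smooth_on_cover => y Oy; set q := ci p y.
have [oUq Uq UqO [sq _ _]] := le q.
pose A := [set x | D q x /\ Uf q (cm q x)].
have oA : open A by exact: chart_image_preimage_open.
have oN := chart_preimage_open hM (p := p) oA.
exists [set z | Om p z /\ A (ci p z)]; first by split=> //; split=> //; exact: chart_at_dom.
have st : smooth_on [set z | Om p z /\ A (ci p z)] (transition p q).
  by apply: smooth_on_sub (transition_smooth hM p q) => z [Oz [Dz _]].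
apply: (smooth_on_ext oN _ (smooth_on_comp oN oUq _ st (sq _ sW))) => [z [Oz [Dz Uz]]|z [Oz [Dz Uz]]].
  rewrite /= /transition/= (cinvK hM Dz).
  have [_ Ux _ _] := le (ci p z).
  exact: (local_extension_unique (le q) (le (ci p z)) sW Dz Uz (chart_at_dom hM _) Ux).
exact: Uz.
Qed.

End Gluing.

(** * Signature of a warped metric *)

Section WarpedSignature.
Context {R : realType} {B F : charted_space R}.
Variables (gB : tensor02 B) (gF : tensor02 F) (f : B -> R).
Hypotheses (hB : smooth_manifold B).
Hypotheses (hgB : singular_metric gB) (hgF : singular_metric gF).
Local Notation P := (prod_space B F).
Local Notation g := (warped_metric gB gF f).

Lemma form_bilinear (M : charted_space R) (h : tensor02 M) x (c : R) : singular_metric h ->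
  (forall u v, c * h x u v = c * h x v u) /\
  (forall u, linear (fun v => c * h x u v : R^o)).
Proof.
move=> [sh lh _]; split=> [u v|u]; first by rewrite sh.
exact: (linear_scalef c (lh x u)).
Qed.

Lemma pos_index_warped (x : P) : pos_index (g x) =
  (pos_index (gB x.1) + pos_index (fun u v => (f x.1 ^+ 2 * gF x.2 u v)%R))%N.
Proof.
have [s1 l1] := form_bilinear x.1 1 hgB; have [s2 l2] := form_bilinear x.2 (f x.1 ^+ 2) hgF.
rewrite -[pos_index (gB x.1)](pos_index_scale (gB x.1) ltr01).
rewrite -(pos_index_sum s1 l1 s2 l2); congr pos_index.
by apply/funext => u; apply/funext => v; rewrite /sum_form mul1r.
Qed.

Lemma neg_index_warped (x : P) : pos_index (fun u v => - g x u v) =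
  (pos_index (fun u v => (- gB x.1 u v)%R) +
   pos_index (fun u v => (f x.1 ^+ 2 * - gF x.2 u v)%R))%N.
Proof.
have [s1 l1] := form_bilinear x.1 (- 1) hgB.
have [s2 l2] := form_bilinear x.2 (- f x.1 ^+ 2) hgF.
have -> : (fun u v => - gB x.1 u v) = (fun u v => -1 * gB x.1 u v).
  by apply/funext => u; apply/funext => v; rewrite mulN1r.
have -> : (fun u v => f x.1 ^+ 2 * - gF x.2 u v) = (fun u v => - f x.1 ^+ 2 * gF x.2 u v).
  by apply/funext => u; apply/funext => v; rewrite mulrN mulNr.
rewrite -(pos_index_sum s1 l1 s2 l2); congr pos_index.
by apply/funext => u; apply/funext => v; rewrite /sum_form mulN1r mulNr opprD.
Qed.

(** Moving only along the fibre keeps the contribution of the base constant and the factor f^2 fixed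
    and positive, so constancy of the total indices passes to those of [gF]. *)
Lemma constant_signature_fiber (x : P) : constant_signature_region g x -> f x.1 != 0 ->
  constant_signature_region gF x.2.
Proof.
case: x => x1 x2; rewrite /constant_signature_region/= => Rx f0.
have f2 : 0 < f x1 ^+ 2 by rewrite exprn_even_gt0.
have cx : {for x2, continuous (fun q : F => (x1, q) : P)}.
  by apply: cvg_pair; [exact: cvg_cst|exact: cvg_id].
have : \forall q \near x2, form_signature (g (x1, q)) = form_signature (g (x1, x2)).
  exact: (cx _ Rx).
apply: filterS => q; rewrite /form_signature => -[].
rewrite !pos_index_warped !neg_index_warped /=.
by rewrite !pos_index_scale// => e1 e2; congr (_, _); lia.
Qed.

Lemma pos_index0 n : pos_index (fun _ _ : 'rV[R]_n => 0 : R) = 0%N.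
Proof.
have [W <- pW] := pos_index_witness (fun _ _ : 'rV[R]_n => 0 : R).
apply/eqP; rewrite mxrank_eq0; apply/rowV0P => v vW; apply/eqP; apply: contraT => v0.
by have := pW v vW v0; rewrite ltxx.
Qed.

(* Near a point of constant signature on {f = 0}, a nonzero value of f would
   enlarge the signature unless the fibre metric vanishes. *)
Lemma constant_signature_zero (x : P) : constant_signature_region g x -> f x.1 = 0 ->
  (forall u v, gF x.2 u v = 0) \/ (\forall b \near x.1, f b = 0).
Proof.
case: x => x1 x2; rewrite /constant_signature_region/= => Rx f0.
have [nz|nz] := pselect (exists u, gF x2 u u != 0); last first.
  left=> u v; have [sF lF _] := hgF.
  have z w : gF x2 w w = 0 by apply/eqP; apply/negP => /negP h; apply: nz; exists w.
  have := z (u + v); rewrite (linear_add (lF _ _)) sF (linear_add (lF _ _)) z add0r.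
  rewrite [gF _ (u + v) v]sF (linear_add (lF _ _)) z addr0 [gF _ v u]sF => /eqP.
  by rewrite -mulr2n mulrn_eq0 /= => /eqP.
right.
have cx : {for x1, continuous (fun b : B => (b, x2) : P)}.
  by apply: cvg_pair; [exact: cvg_id|exact: cvg_cst].
have h1 : \forall b \near x1, form_signature (g (b, x2)) = form_signature (g (x1, x2)).
  exact: (cx _ Rx).
have h2 := pos_index_semicontinuous hB x1 hgB.
have h3 := pos_index_semicontinuous hB x1 (singular_metric_opp hB hgB).
near=> b; apply/eqP; apply: contraT => fb.
have fb2 : 0 < f b ^+ 2 by rewrite exprn_even_gt0.
have e1 : form_signature (g (b, x2)) = form_signature (g (x1, x2)) by near: b.
have e2 : (pos_index (gB x1) <= pos_index (gB b))%N by near: b.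
have e3 : (pos_index (fun u v => (- gB x1 u v)%R) <= pos_index (fun u v => (- gB b u v)%R))%N.
  by near: b.
have z1 : (fun u v => f x1 ^+ 2 * gF x2 u v) = (fun u v => 0).
  by apply/funext => u; apply/funext => v; rewrite f0 expr0n mul0r.
have z2 : (fun u v => f x1 ^+ 2 * - gF x2 u v) = (fun u v => 0).
  by apply/funext => u; apply/funext => v; rewrite f0 expr0n mul0r.
move: e1; rewrite /form_signature !pos_index_warped !neg_index_warped /=.
rewrite z1 z2 pos_index0 !pos_index_scale// => -[e4 e5].
(* The indices of [gB] at [b] are at least those at [x1], yet adding those of [gF] to them gives
   back the indices at [x1]. Hence both indices of [gF] at [x2] vanish, which contradicts the vector
   found in [nz]. *)
have p0 : pos_index (gF x2) = 0%N by lia.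
have n0 : pos_index (fun u v => (- gF x2 u v)%R) = 0%N by lia.
have [u /negP nu] := nz; exfalso; apply: nu.
have [_ lF _] := hgF; have [sF _ _] := hgF.
have q a : gF x2 (a *: u) (a *: u) = a ^+ 2 * gF x2 u u.
  rewrite (linear_scale _ _ (lF _ _)) sF (linear_scale _ _ (lF _ _)) /GRing.scale/=.
  by rewrite mulrA expr2.
rewrite eq_le (pos_index_eq0 q p0) -oppr_le0.
apply: (@pos_index_eq0 _ _ (fun u v => - gF x2 u v)) => // a.
by rewrite q mulrN.
Unshelve. all: by end_near. Qed.

End WarpedSignature.

(** * The theorem *)

Section PointwiseCriteria.
Context {R : realType} {M : charted_space R}.
Hypothesis hM : smooth_manifold M.
Variables (g : tensor02 M) (J : tensor11 M).
Hypotheses (hg : singular_metric g) (hJ : almost_product_structure g J).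
Local Notation V := 'rV[R]_(mdim M).
Local Notation cm p := (cmap (chart_at p)).
Local Notation G := (local_metric g).
Local Notation Gt p := (ap_christoffel (G p) (local_tensor J p)).

Lemma local_metric_nondegenerate p y (u : V) : nondegenerate_metric g ->
  chart_image (chart_at p) y -> (forall v, G p y u v = 0) -> u = 0.
Proof.
move=> nd Oy hu; have Dy := cinv_dom hM Oy.
rewrite -(tcoord_tvec hM u Dy).
have -> : tvec p (cinv (chart_at p) y) u = 0.
  apply: (nd (cinv (chart_at p) y)) => v; have := hu (tcoord p (cinv (chart_at p) y) v).
  by rewrite /local_metric (tvec_tcoord hM).
by rewrite linear_zero//; exact: tcoord_linear.
Qed.

(** The remaining term <dY X, .> of the Koszul form is represented by construction, and arbitrary
    vectors at [p] extend to fields, so only the trilinear part at the centre of each chart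
    matters. *)
Lemma radical_stationary_pointwise :
  (forall p u v, representable (G p (cm p p)) (christoffel (G p) (cm p p) u v)) <->
  radical_stationary g.
Proof.
split=> [h X Y sX sY|rs p u v].
  apply: A_bullet_intro => // [W sW|p]; first exact: koszul_smooth.
  have Dp := chart_at_dom hM p; have Op := cmap_image Dp.
  have [r hr] := h p (vfield_in_chart X p (cm p p)) (vfield_in_chart Y p (cm p p)).
  exists (r + dird (vfield_in_chart Y p) (cm p p) (vfield_in_chart X p (cm p p))) => W sW.
  rewrite (koszulE hM hg sX sY sW Dp) hr -(local_metric_self hM).
  by rewrite (linear_add (local_metric_linear1 hg _ Op)) (vfield_in_chart_self hM W).
have Dp := chart_at_dom hM p; have Op := cmap_image Dp.
have [X sX Xp] := vfield_through hM p u; have [Y sY Yp] := vfield_through hM p v.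
have [_ /(_ p)[r hr]] := rs X Y sX sY.
exists (r - dird (vfield_in_chart Y p) (cm p p) (vfield_in_chart X p (cm p p))) => w.
have [W sW Wp] := vfield_through hM p w.
have := hr W sW; rewrite (koszulE hM hg sX sY sW Dp) !(vfield_in_chart_self hM) Xp Yp Wp.
rewrite (linear_sub (local_metric_linear1 hg _ Op)) (local_metric_self hM _ _ r) => <-.
by rewrite addrK.
Qed.

Lemma nabla_flat_A_bullet X Y :
  (forall p u v, representable (G p (cm p p)) (Gt p (cm p p) u v)) ->
  smooth_vfield X -> smooth_vfield Y -> A_bullet g (nabla_flat g J X Y).
Proof.
move=> h sX sY; apply: A_bullet_intro => // [W sW|p]; first exact: ap_koszul_smooth.
have Dp := chart_at_dom hM p; have Op := cmap_image Dp.
have [r hr] := h p (vfield_in_chart X p (cm p p)) (vfield_in_chart Y p (cm p p)).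
exists (tvec p p (r + dird (vfield_in_chart Y p) (cm p p) (vfield_in_chart X p (cm p p)))).
apply: (represents_nabla_flat hM hg hJ sX sY Dp) => v.
by rewrite /local_flat hr (linear_add (local_metric_linear1 hg _ Op)).
Qed.

End PointwiseCriteria.

Section Restriction.
Context {R : realType} {n : nat} {W : normedModType R}.
Local Notation V := 'rV[R]_n.
Variables (U U' : set V) (sub : U' `<=` U).

Lemma linear_family_sub (A : V -> V -> W) : linear_family U A -> linear_family U' A.
Proof.
by move=> [l s]; split=> [y /sub|v]; [exact: l|exact: smooth_on_sub (s v)].
Qed.

Lemma bilinear_family_sub (A : V -> V -> V -> W) : bilinear_family U A -> bilinear_family U' A.
Proof. by move=> [l r]; split=> v; exact: linear_family_sub. Qed.

End Restriction.

Section WarpedProduct.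
Context {R : realType} {B F : charted_space R}.
Variables (gB : tensor02 B) (J1 : tensor11 B) (gF : tensor02 F) (J2 : tensor11 F) (f : B -> R).
Hypotheses (hB : almost_product_singular_manifold gB J1) (hgB : nondegenerate_metric gB).
Hypotheses (hF : almost_product_semi_regular gF J2) (hf : smooth_fun f).
Local Notation P := (prod_space B F).
Local Notation V := 'rV[R]_(mdim B + mdim F).
Local Notation g := (warped_metric gB gF f).
Local Notation J := (prod_structure J1 J2).
Local Notation cm p := (cmap (chart_at p)).
Local Notation ci p := (cinv (chart_at p)).
Local Notation Om p := (chart_image (chart_at p)).
Local Notation D p := (cdom (chart_at p)).
Implicit Types (p x : P).

Let hBm : smooth_manifold B. Proof. by have [] := hB. Qed.
Let sgB : singular_metric gB. Proof. by have [] := hB. Qed.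
Let hJ1 : almost_product_structure gB J1. Proof. by have [] := hB. Qed.
Let hFm : smooth_manifold F. Proof. by have [[]] := hF. Qed.
Let sgF : singular_metric gF. Proof. by have [[]] := hF. Qed.
Let hJ2 : almost_product_structure gF J2. Proof. by have [[]] := hF. Qed.
Let hM : smooth_manifold P := prod_smooth_manifold hBm hFm.
Let hg : singular_metric g := warped_metric_singular hBm hFm sgB sgF hf.
Let hJ : almost_product_structure g J :=
  prod_structure_almost_product hBm hFm f hJ1 hJ2.

Local Notation G1 p := (local_metric gB p.1).
Local Notation G2 p := (local_metric gF p.2).
Local Notation JJ1 p := (local_tensor J1 p.1).
Local Notation JJ2 p := (local_tensor J2 p.2).
Local Notation phi p := (f \o ci p.1 : 'rV[R]_(mdim B) -> R^o).
Local Notation GG p := (warped_form (G1 p) (G2 p) (phi p)).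
Local Notation JJ p := (prod_tensor (JJ1 p) (JJ2 p)).

Let oB p : open (Om p.1). Proof. exact: chart_image_open. Qed.
Let oF p : open (Om p.2). Proof. exact: chart_image_open. Qed.
Let nd1 p y u : Om p.1 y -> (forall v, G1 p y u v = 0) -> u = 0.
Proof. exact: local_metric_nondegenerate. Qed.

Lemma warped_in_chart p (y u v : V) : Om p y -> GG p y u v = local_metric g p y u v.
Proof. by move=> Oy; rewrite local_warped_metric. Qed.

Lemma prod_structure_in_chart p (y v : V) : Om p y -> JJ p y v = local_tensor J p y v.
Proof. by move=> Oy; rewrite local_prod_structure. Qed.

Lemma warped_radical_stationary : radical_stationary g.
Proof.
have [_ rs _ _] := hF; have rF := (radical_stationary_pointwise hFm sgF).2 rs.
apply/(radical_stationary_pointwise hM hg) => p u v.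
have Op : Om p (cm p p) := cmap_image (chart_at_dom hM p).
have Up : prod_set (Om p.1) (Om p.2) (cm p p) by rewrite -chart_image_prod.
have bB := local_metric_bilinear sgB p.1; have bF := local_metric_bilinear sgF p.2.
have sB := local_metric_sym sgB p.1; have sF := local_metric_sym sgF p.2.
have bG := warped_form_bilinear (@oB p) sB bB (@oF p) sF bF (hf p.1).
have oU := prod_set_open (@oB p) (@oF p).
have ext w : christoffel (GG p) (cm p p) u v w = christoffel (local_metric g p) (cm p p) u v w.
  apply: (christoffel_ext _ _ _ oU _ _ Up) => [z a b Uz|a b]; last exact: (metric_smooth bG).
  by apply: warped_in_chart; rewrite chart_image_prod.
have [r hr] : representable (GG p (cm p p)) (christoffel (GG p) (cm p p) u v).
  have tG := christoffel_trilinear oU bG.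
  apply: (representable_warped bB (@nd1 p) bF Up (trilinear_family3 _ _ tG Up)).
  have [s hs] := rF p.2 (rsubmx u) (rsubmx v).
  (* The fibre representative with one factor [phi] removed; on vertical vectors the term
     differentiating [phi] along the last argument drops out. *)
  exists (phi p (lsubmx (cm p p)) *: s + (dird (phi p) (lsubmx (cm p p)) (lsubmx u) *: rsubmx v
    + dird (phi p) (lsubmx (cm p p)) (lsubmx v) *: rsubmx u)) => w2.
  rewrite (christoffel_warped (@oB p) bB (@oF p) sF bF (hf p.1))// !row_mxKl !row_mxKr.
  have Op1 := cmap_image (chart_at_dom hBm p.1); have Op2 := cmap_image (chart_at_dom hFm p.2).
  rewrite (linear_zero (trilinear_family3 _ _ (christoffel_trilinear (@oB p) bB) Op1)).
  rewrite (linear_zero (dird_linear _ _)).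
  have l1 := bilinear_family1 w2 bF Op2.
  rewrite (linear_add l1) !(linear_scale _ _ l1) (linear_add l1) !(linear_scale _ _ l1).
  rewrite hs /GRing.scale/=; ring.
by exists r => w; rewrite -ext hr warped_in_chart.
Qed.

Lemma warped_in_local_chart p (N : set 'rV[R]_(mdim F)) : open N -> N `<=` Om p.2 ->
  forall (y u v w : V), prod_set (Om p.1) N y ->
  ap_christoffel (GG p) (JJ p) y u v w =
  ap_christoffel (local_metric g p) (local_tensor J p) y u v w.
Proof.
move=> oN NO y u v w Uy; have oU := prod_set_open (@oB p) oN.
have sub z : prod_set (Om p.1) N z -> Om p z by rewrite chart_image_prod => -[? /NO].
apply: (ap_christoffel_ext _ _ _ oU _ _ _ _ Uy) => [z a b /sub|z a /sub|a b|a].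
- exact: warped_in_chart.
- exact: prod_structure_in_chart.
- have bG := warped_form_bilinear (@oB p) (local_metric_sym sgB p.1) (local_metric_bilinear sgB p.1)
    oN (local_metric_sym sgF p.2) (bilinear_family_sub NO (local_metric_bilinear sgF p.2)) (hf p.1).
  exact: metric_smooth bG a b.
- have lJ := prod_tensor_linear (@oB p) (local_tensor_linear hJ1 p.1) oN
    (linear_family_sub NO (local_tensor_linear hJ2 p.2)).
  exact: lJ.2.
Qed.

Lemma warped_nabla_flat X Y : smooth_vfield X -> smooth_vfield Y ->
  A_bullet g (nabla_flat g J X Y).
Proof.
apply: (nabla_flat_A_bullet hM hg hJ) => p u v.
have [N [c [oN Np NO [sc rep _ _]]]] := semi_regular_local hF p.2.
have Op : Om p (cm p p) := cmap_image (chart_at_dom hM p).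
have Up : prod_set (Om p.1) N (cm p p).
  by split; rewrite /= ?row_mxKl ?row_mxKr//; exact/cmap_image/chart_at_dom.
have [r hr] := ap_christoffel_representable (@oB p) (local_metric_sym sgB p.1)
  (local_metric_bilinear sgB p.1) (local_tensor_linear hJ1 p.1) (@nd1 p)
  oN (local_metric_sym sgF p.2) (bilinear_family_sub NO (local_metric_bilinear sgF p.2))
  (linear_family_sub NO (local_tensor_linear hJ2 p.2))
  (fun y u v Ny => local_tensor_iso hFm hJ2 u v (NO y Ny))
  (fun y v Ny => local_tensorK hFm hJ2 v (NO y Ny)) (hf p.1) rep u v Up.
by exists r => w; rewrite -(warped_in_local_chart oN NO)// hr warped_in_chart.
Qed.

Lemma warped_local_extension X Y Z p : smooth_vfield X -> smooth_vfield Y -> smooth_vfield Z ->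
  exists U e, local_extension g (nabla_form g J Z (nabla_flat g J X Y)) p U e.
Proof.
move=> sX sY sZ.
have [N [c [oN Np NO [sc rep preg pdiff]]]] := semi_regular_local hF p.2.
(* The coefficients [c] are controlled only on [N], so the fibre chart is shrunk while the base
   chart is kept whole. *)
pose U := prod_set (Om p.1) N.
have oU : open U := prod_set_open (@oB p) oN.
have UO : U `<=` Om p by move=> z; rewrite chart_image_prod => -[? /NO].
have Up : U (cm p p).
  by split; rewrite /= ?row_mxKl ?row_mxKr//; exact/cmap_image/chart_at_dom.
have sB := local_metric_sym sgB p.1; have sF := local_metric_sym sgF p.2.
have bB := local_metric_bilinear sgB p.1; have lB := local_tensor_linear hJ1 p.1.
have bF := bilinear_family_sub NO (local_metric_bilinear sgF p.2).
have lF := linear_family_sub NO (local_tensor_linear hJ2 p.2).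
have iF y u v (Ny : N y) := local_tensor_iso hFm hJ2 u v (NO y Ny).
have kF y v (Ny : N y) := local_tensorK hFm hJ2 v (NO y Ny).
have sXp : smooth_on U (vfield_in_chart X p) := smooth_on_sub UO (sX p).
have sYp : smooth_on U (vfield_in_chart Y p) := smooth_on_sub UO (sY p).
have sZp : smooth_on U (vfield_in_chart Z p) := smooth_on_sub UO (sZ p).
pose ne := nabla_ext (G1 p) (JJ1 p) (G2 p) (JJ2 p) (phi p) c
  (vfield_in_chart X p) (vfield_in_chart Y p) (vfield_in_chart Z p).
exists U, (fun W x => ne (cm p x) (vfield_in_chart W p (cm p x))); split=> //; split.
- move=> W sW; have sWp : smooth_on U (vfield_in_chart W p) := smooth_on_sub UO (sW p).
  have s := nabla_ext_smooth (@oB p) sB bB lB (@nd1 p) oN sF bF lF (hf p.1) sc sXp sYp sZp sWp.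
  apply: (smooth_on_ext oU _ s) => y Uy.
  by rewrite /= -[row_mx _ _]/(cm p (ci p y)) (cmapK hM (UO _ Uy)).
- move=> W x sW Dx Ux Rx; set y := cm p x in Ux *.
  have Oy := UO _ Ux.
  have ey1 : lsubmx y = cm p.1 x.1 by rewrite /y /= row_mxKl.
  have ey2 : rsubmx y = cm p.2 x.2 by rewrite /y /= row_mxKr.
  have [Dx1 Dx2] := Dx.
  have ephi : phi p (lsubmx y) = f x.1 by rewrite ey1 /= (cinvK hBm Dx1).
  have [|r [s [hr hs hrs]]] := @pairing_regular _ _ _ _ _ _ (@oB p) sB bB lB (@nd1 p) _ _ _ oN sF bF lF
     iF kF _ (hf p.1) c rep _ _ (vfield_in_chart Z p) sXp sYp y (vfield_in_chart W p y) Ux.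
    (* This supplies the alternative required by [pairing_regular]; vanishing of [f] near the base
       point enters through the vanishing of its derivative. *)
    have [f0|f0] := eqVneq (f x.1) 0; [right|left]; split; rewrite ?ephi//.
      have [G0|fnear] := constant_signature_zero hBm sgB sgF Rx f0.
        right=> u v; rewrite ey2 /local_metric (cinvK hFm Dx2); exact: G0.
      left=> u.
      have : \forall z \near lsubmx y, phi p z = 0.
        have c1 := cinv_continuous hBm Ux.1.
        apply: (c1 [set b | f b = 0]); rewrite ey1 (cinvK hBm Dx1); exact: fnear.
      rewrite /prop_near1 nbhsE => -[A [oA Ay] hA].
      have e0 z : A z -> (0 : R^o) = phi p z by move=> /hA.
      by rewrite (open_eq_dird u oA (f := fun=> 0) e0 Ay) ?dird_cst//; exact: differentiable_cst.
    move=> r s hr hs; apply: preg hr hs; first exact: Ux.2.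
    rewrite ey2 (cinvK hFm Dx2).
    exact: (constant_signature_fiber sgB sgF Rx f0).
  have Gte u v w := warped_in_local_chart oN NO u v w Ux.
  have hr' v : ap_christoffel (local_metric g p) (local_tensor J p) y (vfield_in_chart Z p y)
      (vfield_in_chart W p y) v = local_metric g p y r v.
    by rewrite -Gte hr warped_in_chart.
  have hle z v : U z -> local_flat (GG p) (JJ p) (vfield_in_chart X p) (vfield_in_chart Y p) z v =
     local_flat (local_metric g p) (local_tensor J p) (vfield_in_chart X p) (vfield_in_chart Y p) z v.
    move=> Uz; rewrite /local_flat (warped_in_local_chart oN NO _ _ _ Uz).
    by rewrite warped_in_chart//; exact: UO.
  have hs' v : local_flat (local_metric g p) (local_tensor J p) (vfield_in_chart X p)
      (vfield_in_chart Y p) y v = local_metric g p y s v.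
    by rewrite -hle// hs warped_in_chart.
  rewrite (nabla_formE hM hg hJ sX sY sZ sW Dx hr' hs').
  rewrite -warped_in_chart// hrs /ne /nabla_ext; congr (_ - _); apply/esym.
  apply: (open_eq_dird _ oU _ Ux) => [z Uz|]; first exact: hle.
  have lL := local_flat_family (@oB p) sB bB lB oN sF bF lF (hf p.1) sXp sYp.
  exact: smooth_on_differentiable (lL.2 _) Ux.
- have [r hr] := nabla_ext_representable (@oB p) sB bB lB (@nd1 p) oN sF bF lF iF kF (hf p.1)
    rep pdiff sXp sYp sZp Up.
  exists r => W sW; rewrite /ne hr (vfield_in_chart_self hM).
  by rewrite warped_in_chart ?(local_metric_self hM)//; exact: UO.
Qed.

End WarpedProduct.

Theorem theorem4p16 (R : realType) (B F : charted_space R)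
  (gB : tensor02 B) (J1 : tensor11 B) (gF : tensor02 F) (J2 : tensor11 F)
  (f : B -> R)
  (hB : almost_product_singular_manifold gB J1)
  (hgB : nondegenerate_metric gB)
  (hF : almost_product_semi_regular gF J2)
  (hf : smooth_fun f) :
  almost_product_semi_regular (warped_metric gB gF f) (prod_structure J1 J2).
Proof.
have [mB sB aB] := hB; have [[mF sF aF] _ _ _] := hF.
have hM := prod_smooth_manifold mB mF; have hg := warped_metric_singular mB mF sB sF hf.
split.
- by split=> //; exact: prod_structure_almost_product.
- exact: warped_radical_stationary hB hgB hF hf.
- exact: warped_nabla_flat hB hgB hF hf.
- move=> X Y Z sX sY sZ; apply: (extension_glue hM hg) => p.
  exact: warped_local_extension hB hgB hF hf _ _ _ _ sX sY sZ.
Qed.
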